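(* For every $\delta>0$ there is a discrete group $G_\delta$ and a self-adjoint element $S_\delta\in\mathbb{Z}[G_\delta]$ such that for some constant $C>0$ and some sequence of positive real numbers $\varepsilon_i$ converging to $0$ we have $$\mu_{S_\delta}\big((0,\varepsilon_i)\big) > \frac{C}{|\log(\varepsilon_i)|^{1+\delta}}\qquad\text{for all } i.$$ In particular, there do not exist constants $C',\eta>0$ such that $\mu_{S_\delta}((0,\varepsilon))<C'\varepsilon^{\eta}$ for all sufficiently small $\varepsilon>0$.
   Context: For a discrete group $G$, $\mathbb{Z}[G]$ is the integral group ring, with involution $(\sum a_g g)^*=\sum a_g g^{-1}$; $T$ is self-adjoint if $T=T^*$. An element $T\in\mathbb{C}[G]$ acts as a bounded operator on $l^2(G)$ by left multiplication. For self-adjoint $T$ with projection-valued spectral measure $\pi_T$, the spectral measure of $T$ is the measure on $\mathbb{R}$ given by $\mu_T(B)=\langle \pi_T(B)\zeta_e,\zeta_e\rangle$ for measurable $B\subset\mathbb{R}$, where $\zeta_e\in l^2(G)$ is the indicator function of the neutral element $e$ (that is, $\mu_T=\tau\circ\pi_T$ with $\tau$ the von Neumann trace on the group von Neumann algebra of $G$). *)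

(* Defs.v *)
From HB Require Import structures.
From mathcomp Require Import all_boot all_order all_algebra finmap.
From mathcomp Require Import complex monalg.
From mathcomp Require Import all_classical all_reals all_analysis.

Set Implicit Arguments.
Unset Strict Implicit.
Unset Printing Implicit Defensive.

Import Order.TTheory GRing.Theory Num.Theory.
Import numFieldNormedType.Exports.

Local Open Scope classical_set_scope.
Local Open Scope ring_scope.

(* The integral group ring Z[G] has [{malg int[G]}], the free Z-module on G, as
   its carrier: [T@_g] is the coefficient of g, [<< a *g g >>] is a.g. *)
Section GroupRing.
Context {G : groupType}.

Definition star (T : {malg int[G]}) : {malg int[G]} :=
  \sum_(g <- msupp T) << T@_g *g (g^-1)%g >>.

Definition self_adjoint (T : {malg int[G]}) : Prop := star T = T.

End GroupRing.

Section L2.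
Context {R : realType} {G : groupType}.
Local Notation C := R[i].

Definition sqnorm2 (f : G -> C) : \bar R :=
  \esum_(g in [set: G]) ((ComplexField.Normc.normc (f g)) ^+ 2)%:E.

Definition l2 (f : G -> C) : Prop := (sqnorm2 f < +oo)%E.

(* Unordered sum of an absolutely summable family; a junk value otherwise. *)
Definition rsum (u : G -> R) : R :=
  fine (\esum_(g in [set: G]) ((EFin \o u)^\+ g)%E)
  - fine (\esum_(g in [set: G]) ((EFin \o u)^\- g)%E).

Definition csum (u : G -> C) : C :=
  (rsum (fun g => complex.Re (u g)) +i* rsum (fun g => complex.Im (u g)))%C.

Definition inner (f h : G -> C) : C := csum (fun g => f g * conjc (h g)).

Definition zeta (g : G) : G -> C := fun x => (x == g)%:R.

(* Left multiplication by T: g maps zeta x to zeta (g * x), hence the inverse. *)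
Definition lact (T : {malg int[G]}) (f : G -> C) : G -> C :=
  fun x => \sum_(g <- msupp T) (T@_g)%:~R * f (g^-1 * x)%g.

(* An operator on l^2(G) is encoded by a map on all functions G -> C of which
   only the values on l^2(G) are relevant. *)
Record orthogonal_projection (P : (G -> C) -> (G -> C)) : Prop := {
  op_l2 : forall f, l2 f -> l2 (P f);
  op_linear : forall (a : C) f h, l2 f -> l2 h ->
    P (fun x => a * f x + h x) = (fun x => a * P f x + P h x);
  op_idem : forall f, l2 f -> P (P f) = P f;
  op_adj : forall f h, l2 f -> l2 h -> inner (P f) h = inner f (P h)
}.

Local Notation borelR := (measurableTypeR R).

(* Projection-valued measures on the Borel sets of the real line, with values
   in the orthogonal projections of l^2(G), countably additive in the strong
   operator topology. *)
Record projection_valued_measure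
    (E : set borelR -> (G -> C) -> (G -> C)) : Prop := {
  pvm_proj : forall B, measurable B -> orthogonal_projection (E B);
  pvm_setT : forall f, l2 f -> E setT f = f;
  pvm_setI : forall A B f, measurable A -> measurable B -> l2 f ->
    E (A `&` B) f = E A (E B f);
  pvm_sigma_additive : forall (B : nat -> set borelR) f,
    (forall i, measurable (B i)) -> trivIset setT B -> l2 f ->
    (fun n => sqnorm2 (fun x => E (\bigcup_i B i) f x
                                - \sum_(i < n) E (B i) f x)) @ \oo
      --> (0 : \bar R)%E
}.

Definition scalar_measure (E : set borelR -> (G -> C) -> (G -> C))
    (f : G -> C) (mu : {measure set borelR -> \bar R}) : Prop :=
  forall B, measurable B -> mu B = (complex.Re (inner (E B f) f))%:E.

(* E is the projection-valued spectral measure of T, i.e. T is the integral of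
   t dE(t); by polarization this is a condition on the diagonal scalar measures
   only. *)
Definition spectral_resolution (T : {malg int[G]})
    (E : set borelR -> (G -> C) -> (G -> C)) : Prop :=
  projection_valued_measure E /\
  forall f, l2 f -> exists mu : {measure set borelR -> \bar R},
    [/\ scalar_measure E f mu,
        mu.-integrable setT (fun t : borelR => (t : R)%:E)
      & inner (lact T f) f = (\int[mu]_t (t : R))%R%:C%C].

(* By the spectral theorem a self-adjoint T has exactly one spectral
   resolution E, so that mu is determined on Borel sets. *)
Definition is_spectral_measure (T : {malg int[G]})
    (mu : {measure set borelR -> \bar R}) : Prop :=
  exists E, spectral_resolution T E /\ scalar_measure E (zeta 1%g) mu.

End L2.

(* Main.v *)
From HB Require Import structures.
From mathcomp Require Import all_boot all_order all_algebra finmap.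
From mathcomp Require Import complex monalg.
From mathcomp Require Import all_classical all_reals all_analysis.
From mathcomp Require Import measurable_realfun perm finfield.
From mathcomp Require Import ring lra zify.
Require Import Defs.

Set Implicit Arguments.
Unset Strict Implicit.
Unset Printing Implicit Defensive.

Import Order.TTheory GRing.Theory Num.Theory.
Import numFieldNormedType.Exports.

Local Open Scope classical_set_scope.
Local Open Scope ring_scope.

(** A counter runs for a long time and shows up with a not so small weight.

    A Turing machine that counts in base [m], on tapes carrying a word of [d]
    digits between two end marks, halts only after at least [(m - 1) ^ d] steps
    ([run_halts]).  Let [sigma] be the operator that sends the basis vector of a
    configuration of this machine to the basis vector of the next one, or to
    zero if there is none.  Along a halting computation [x_0, .., x_L], the
    operator [1 - B sigma] sends [\sum_n B ^ n e_(x_n)] to [e_(x_0)], so that it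
    shortens a vector by a factor [B ^ L] at least.  Hence, with
    [U = q ^ 2 (1 - B sigma)], the block of the configurations with [d] digits
    contributes an eigenvalue below [eps_d = B ^- L] to [U^* U], where
    [L >= (m - 1) ^ d].  The machine lives in the group ring of a group in which
    each configuration with [d] digits has the trace [q ^- (d + 2)], where
    [q = m + 1].  So the mass of [(0, eps_d)] is at least [q ^- (d + 2)], whereas
    [|log eps_d| ^ (1 + delta)] is at least
    [(q - 2) ^ (d (1 + delta)) >= q ^ d] up to a constant as soon as [q] is large.
    Powers beat logarithms, hence no power of [eps] bounds this mass.

    That the eigenvalue is not zero costs nothing: if [B] is even, the matrix of
    [1 - B sigma] on a block is the identity modulo 2, so its determinant is odd
    ([cblock_inj]).

    The group is a wreath product of the permutations of a finite field [K],
    with [q] elements, by the integers.  At each cell of the tape the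
    permutations [x |-> b x + v] act.  The averages of the translations against
    the additive characters are projections; the dilations permute the
    nontrivial characters transitively and fix the trivial one.  So there are
    matrix units between any two of the [m = q - 1] nontrivial characters, which
    serve as digits, and a separate projection for the trivial one, which is the
    end mark ([unit_op_mul]).  Words become products of matrix units over
    consecutive cells ([tape]), and the shift moves the head ([place]).  If the
    characters take the values 1 and -1 then [q] times a matrix unit is in the
    integral group ring; this is why [K] has characteristic 2.

    Two placed words either agree or clash at a common cell, because of the end
    marks ([configs_clash]).  So the blocks, one for each [d], are orthogonal
    systems of matrix units, and they exhaust the Hilbert space since
    [\sum_d (d + 1) m ^ d q ^- (d + 2) = 1] ([weights_total]).  Therefore
    [U^* U] is an orthogonal sum of multiples of finite Hermitian matrices and
    its spectral resolution is an explicit atomic one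
    ([block_spectral_measure]). *)

(** * Unordered sums of real families *)

Section UnorderedSums.
Context {R : realType} {T : choiceType}.
Implicit Types (u v a b : T -> R).

Definition rsummable u := summable [set: T] (EFin \o u).

Lemma esum_fineK u : (forall x, 0 <= u x) -> rsummable u ->
  \esum_(x in [set: T]) (u x)%:E = (fine (\esum_(x in [set: T]) (u x)%:E))%:E.
Proof.
move=> u0; rewrite /rsummable summableE => us; rewrite fineK//.
by move: us; congr (_ \is a fin_num); apply: eq_esum => x _ /=; rewrite ger0_norm.
Qed.

Lemma rsummable_ge0 u : (forall x, 0 <= u x) ->
  (\esum_(x in [set: T]) (u x)%:E < +oo)%E -> rsummable u.
Proof.
move=> u0 us; rewrite /rsummable /summable; apply: le_lt_trans us.
by apply: le_esum => x _ /=; rewrite ger0_norm.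
Qed.

Lemma le_rsummable u v : (forall x, `|u x| <= v x) -> rsummable v -> rsummable u.
Proof.
move=> uv; rewrite /rsummable /summable; apply: le_lt_trans.
by apply: le_esum => x _ /=; rewrite lee_fin (le_trans (uv x))// ler_norm.
Qed.

Lemma rsummableD u v : rsummable u -> rsummable v -> rsummable (fun x => u x + v x).
Proof.
move=> us vs; have := summableD us vs; congr (summable _ _).
Qed.

Lemma esumZl (c : R) u : 0 <= c -> (forall x, 0 <= u x) ->
  \esum_(x in [set: T]) (c * u x)%:E = (c%:E * \esum_(x in [set: T]) (u x)%:E)%E.
Proof.
move=> c0 u0; rewrite /esum -ereal_supZl//; last first.
  by apply/set0P; exists (\sum_(x \in set0) (u x)%:E)%E; exists set0 => //; exact: fsets0.
rewrite image_comp; congr ereal_sup; apply: eq_imagel => A [finA _] /=.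
rewrite ge0_mule_fsumr//.
Qed.

Lemma rsummableZ (c : R) u : rsummable u -> rsummable (fun x => c * u x).
Proof.
move=> us; rewrite /rsummable /summable /=.
under eq_esum do rewrite normrM.
rewrite esumZl//; move: us; rewrite /rsummable summableE => /fineK <-.
by rewrite -EFinM ltry.
Qed.

Lemma rsummableN u : rsummable u -> rsummable (fun x => - u x).
Proof. by move=> /(rsummableZ (-1)); congr rsummable; apply/funext => x; rewrite mulN1r. Qed.

Lemma rsummable_norm u : rsummable u -> rsummable (fun x => `|u x|).
Proof.
by rewrite /rsummable /summable; apply: le_lt_trans; apply: le_esum => x _ /=;
  rewrite normr_id.
Qed.

End UnorderedSums.

Section RealSums.
Context {R : realType} {G : groupType}.
Implicit Types (u v a b : G -> R).

(** Any decomposition into summable nonnegative parts may replace the canonical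
    one, which is not additive. *)
Lemma rsumE u a b : rsummable a -> rsummable b ->
  (forall x, 0 <= a x) -> (forall x, 0 <= b x) ->
  (forall x, u x = a x - b x) ->
  rsum u = fine (\esum_(x in [set: G]) (a x)%:E)
         - fine (\esum_(x in [set: G]) (b x)%:E).
Proof.
move=> sa sb a0 b0 uab; rewrite /rsum.
have -> : EFin \o u = ((EFin \o a) \- (EFin \o b))%E.
  by apply/funext => x /=; rewrite uab EFinB.
have sab := summableB sa sb.
have h1 := summable_funepos sab; have h2 := summable_funeneg sab.
have fin f : (forall x, 0 <= f x)%E -> summable setT f ->
    \esum_(x in [set: G]) f x \is a fin_num.
  move=> f0; rewrite summableE; congr (_ \is a fin_num).
  by apply: eq_esum => x _; rewrite gee0_abs.
have := @esumB _ _ _ _ _ sa sb (fun x _ => a0 x) (fun x _ => b0 x).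
move=> e; rewrite -!fineB; first by rewrite e.
- by apply: fin => // x; rewrite lee_fin.
- by apply: fin => // x; rewrite lee_fin.
- exact: fin.
- exact: fin.
Qed.

Lemma rsum_ge0 u : (forall x, 0 <= u x) -> rsummable u ->
  rsum u = fine (\esum_(x in [set: G]) (u x)%:E).
Proof.
move=> u0 us; rewrite (@rsumE u u (fun=> 0))//; last 2 first.
- by apply: (le_rsummable _ us) => x; rewrite normr0.
- by move=> x; rewrite subr0.
by rewrite [X in fine X - _](esum_fineK u0 us) /= (esum1 (a := fun=> 0%:E))// subr0.
Qed.

Let pos u : G -> R := fun x => (`|u x| + u x) / 2.
Let neg u : G -> R := fun x => (`|u x| - u x) / 2.

Let pos_ge0 u x : 0 <= pos u x.
Proof. by rewrite divr_ge0//; have := ler_norm (- u x); rewrite normrN; lra. Qed.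
Let neg_ge0 u x : 0 <= neg u x.
Proof. by rewrite divr_ge0//; have := ler_norm (u x); lra. Qed.
Let posneg u x : u x = pos u x - neg u x.
Proof. by rewrite /pos /neg; lra. Qed.
Let pos_summable u : rsummable u -> rsummable (pos u).
Proof.
move=> /rsummable_norm; apply: le_rsummable => x; rewrite ger0_norm// /pos.
by have := ler_norm (u x); lra.
Qed.
Let neg_summable u : rsummable u -> rsummable (neg u).
Proof.
move=> /rsummable_norm; apply: le_rsummable => x; rewrite ger0_norm// /neg.
by have := ler_norm (- u x); rewrite normrN; lra.
Qed.

Let rsum_posneg u : rsummable u -> rsum u = rsum (pos u) - rsum (neg u).
Proof.
move=> us; have [pu nu] := (pos_summable us, neg_summable us).
by rewrite (rsumE pu nu)// !rsum_ge0.
Qed.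

Let rsumD_ge0 u v : (forall x, 0 <= u x) -> (forall x, 0 <= v x) ->
  rsummable u -> rsummable v -> rsum (fun x => u x + v x) = rsum u + rsum v.
Proof.
move=> u0 v0 us vs; rewrite !rsum_ge0//; last 2 first.
- by move=> x; rewrite addr_ge0.
- exact: rsummableD.
under eq_esum do rewrite EFinD.
rewrite esumD//; [|by move=> x _; rewrite lee_fin|by move=> x _; rewrite lee_fin].
by rewrite (esum_fineK u0 us) (esum_fineK v0 vs).
Qed.

Lemma rsumD u v : rsummable u -> rsummable v ->
  rsum (fun x => u x + v x) = rsum u + rsum v.
Proof.
move=> us vs; rewrite (rsum_posneg us) (rsum_posneg vs).
have [pu nu] := (pos_summable us, neg_summable us).
have [pv nv] := (pos_summable vs, neg_summable vs).
rewrite (@rsumE _ (fun x => pos u x + pos v x) (fun x => neg u x + neg v x)).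
- rewrite -!rsum_ge0 ?rsumD_ge0//; try exact: rsummableD; try by move=> x; rewrite addr_ge0.
  by ring.
- exact: rsummableD.
- exact: rsummableD.
- by move=> x; rewrite addr_ge0.
- by move=> x; rewrite addr_ge0.
- by move=> x; rewrite {1}(posneg u) {1}(posneg v); ring.
Qed.

Lemma rsumN u : rsummable u -> rsum (fun x => - u x) = - rsum u.
Proof.
move=> us; have [pu nu] := (pos_summable us, neg_summable us).
rewrite (rsum_posneg us) opprB (rsum_ge0 _ pu)// (rsum_ge0 _ nu)//.
apply: rsumE => // x.
by rewrite {1}(posneg u) opprB.
Qed.

Lemma rsumZ c u : rsummable u -> rsum (fun x => c * u x) = c * rsum u.
Proof.
wlog c0 : c / 0 <= c => [H|] us.
  have [/H->//|c0] := leP 0 c.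
  rewrite -[c in RHS]opprK mulNr -H// ?oppr_ge0 ?ltW// -rsumN; last exact: rsummableZ.
  by congr rsum; apply/funext => x; rewrite mulNr opprK.
have [pu nu] := (pos_summable us, neg_summable us).
rewrite (rsum_posneg us) (@rsumE _ (fun x => c * pos u x) (fun x => c * neg u x)).
- rewrite !esumZl// (esum_fineK _ pu)// (esum_fineK _ nu)//.
  by rewrite !rsum_ge0//= mulrBr.
- exact: rsummableZ.
- exact: rsummableZ.
- by move=> x; rewrite mulr_ge0.
- by move=> x; rewrite mulr_ge0.
- by move=> x; rewrite {1}(posneg u) mulrBr.
Qed.

Lemma rsummable_reindex (e : G -> G) u : bijective e ->
  rsummable u -> rsummable (u \o e).
Proof.
move=> be; rewrite /rsummable /summable.
by rewrite (reindex_esum [set: G] [set: G] e)//; rewrite setTT_bijective.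
Qed.

Lemma rsum_reindex (e : G -> G) u : bijective e -> rsum (u \o e) = rsum u.
Proof.
move=> be; have bij : set_bij [set: G] [set: G] e by rewrite setTT_bijective.
rewrite /rsum; congr (fine _ - fine _); symmetry.
  rewrite (reindex_esum [set: G] [set: G] e)//; apply: eq_esum => x _.
  by rewrite !funeposE.
rewrite (reindex_esum [set: G] [set: G] e)//; apply: eq_esum => x _.
by rewrite !funenegE.
Qed.

Lemma esum_point y (a : G -> \bar R) : (forall x, 0 <= a x)%E ->
  (forall x, x != y -> a x = 0%E) -> \esum_(x in [set: G]) a x = a y.
Proof.
move=> a0 ay; rewrite -[RHS](@esum_set1 _ _ y)//.
rewrite [RHS]esum_mkcond; apply: eq_esum => x _.
case: ifPn => // xy; apply: ay; apply: contraNneq xy => ->; exact/mem_set.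
Qed.

Lemma rsummable_point y u : (forall x, x != y -> u x = 0) -> rsummable u.
Proof.
move=> uy; rewrite /rsummable /summable (@esum_point y)//= ?ltry// => x /uy ->.
by rewrite normr0.
Qed.

Lemma rsum_point y u : (forall x, x != y -> u x = 0) -> rsum u = u y.
Proof.
move=> uy; have us := rsummable_point uy.
have p0 x : x != y -> pos u x = 0 by move=> /uy h; rewrite /pos h normr0 addr0 mul0r.
have n0 x : x != y -> neg u x = 0 by move=> /uy h; rewrite /neg h normr0 subr0 mul0r.
rewrite (rsumE (pos_summable us) (neg_summable us))//.
rewrite !(@esum_point y)//=; first by move=> x; rewrite lee_fin.
- by move=> x /n0 ->.
- by move=> x; rewrite lee_fin.
- by move=> x /p0 ->.
Qed.

End RealSums.

(** * Complex sums *)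

Section ComplexSums.
Context {R : realType} {G : groupType}.
Local Notation C := R[i].
Local Notation Re := (@complex.Re R).
Local Notation Im := (@complex.Im R).
Local Notation normc := (@ComplexField.Normc.normc R).
Implicit Types (u v : G -> C) (f h k : G -> C) (c z w : C).

Lemma sqr_normcE z : normc z ^+ 2 = Re z ^+ 2 + Im z ^+ 2.
Proof. by case: z => a b /=; rewrite sqr_sqrtr// addr_ge0// sqr_ge0. Qed.

Lemma normc_ge0 z : 0 <= normc z.
Proof. by case: z => a b /=; rewrite sqrtr_ge0. Qed.

Lemma ReD z w : Re (z + w) = Re z + Re w. Proof. by case: z; case: w. Qed.
Lemma ImD z w : Im (z + w) = Im z + Im w. Proof. by case: z; case: w. Qed.
Lemma ReM z w : Re (z * w) = Re z * Re w - Im z * Im w.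
Proof. by case: z; case: w. Qed.
Lemma ImM z w : Im (z * w) = Re z * Im w + Im z * Re w.
Proof. by case: z; case: w. Qed.
Lemma ReJ z : Re (conjc z) = Re z. Proof. by case: z. Qed.
Lemma ImJ z : Im (conjc z) = - Im z. Proof. by case: z. Qed.
Lemma complex_ext z w : Re z = Re w -> Im z = Im w -> z = w.
Proof. by case: z => a b; case: w => a' b' /= -> ->. Qed.

Lemma conjcD z w : conjc (z + w) = conjc z + conjc w. Proof. exact: rmorphD. Qed.
Lemma conjcB z w : conjc (z - w) = conjc z - conjc w. Proof. exact: rmorphB. Qed.
Lemma conjcM z w : conjc (z * w) = conjc z * conjc w. Proof. exact: rmorphM. Qed.

Lemma realcD (a b : R) : ((a + b)%:C = a%:C + b%:C)%C.
Proof. by apply: complex_ext; rewrite ?ReD ?ImD /= ?addr0. Qed.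
Lemma realcB (a b : R) : ((a - b)%:C = a%:C - b%:C)%C.
Proof. by apply: complex_ext; rewrite ?ReD ?ImD /= ?subrr. Qed.
Lemma realcM (a b : R) : ((a * b)%:C = a%:C * b%:C)%C.
Proof. by apply: complex_ext; rewrite ?ReM ?ImM /=; ring. Qed.

Lemma realc_inj (a b : R) : (a%:C = b%:C)%C -> a = b.
Proof. by case. Qed.
Lemma realcJ (a : R) : (conjc a%:C = a%:C)%C.
Proof. by apply: complex_ext; rewrite ?ReJ ?ImJ /= ?oppr0. Qed.

Lemma mul_conjc z : z * conjc z = (normc z ^+ 2)%:C%C.
Proof. by apply: complex_ext; rewrite ?ReM ?ImM ReJ ImJ ?sqr_normcE /=; ring. Qed.

Lemma normc_conjc z : normc (conjc z) = normc z.
Proof. by case: z => a b /=; rewrite sqrrN. Qed.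

Lemma abs_Re_normc z : `|Re z| <= normc z.
Proof.
rewrite -(@ler_pXn2r _ 2)// ?nnegrE ?normc_ge0// sqr_normcE real_normK ?num_real//.
by rewrite lerDl sqr_ge0.
Qed.
Lemma abs_Im_normc z : `|Im z| <= normc z.
Proof.
rewrite -(@ler_pXn2r _ 2)// ?nnegrE ?normc_ge0// sqr_normcE real_normK ?num_real//.
by rewrite lerDr sqr_ge0.
Qed.

Definition csummable u := rsummable (Re \o u) /\ rsummable (Im \o u).

Lemma csum_lin c u v : csummable u -> csummable v ->
  csum (fun x => c * u x + v x) = c * csum u + csum v.
Proof.
move=> [ru iu] [rv iv]; have [rv' iv'] := (rsummableN iu, rsummableN iv).
apply: complex_ext; rewrite ?ReD ?ReM ?ImD ?ImM /=.
  rewrite (_ : (fun g => _) = fun g => (Re c * (Re \o u) g + - Im c * (Im \o u) g) + (Re \o v) g).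
    rewrite !rsumD ?rsumZ//; first by rewrite mulNr.
    - exact: rsummableZ.
    - exact: rsummableZ.
    - by apply: rsummableD; exact: rsummableZ.
  by apply/funext => g; rewrite ReD ReM mulNr.
rewrite (_ : (fun g => _) = fun g => (Re c * (Im \o u) g + Im c * (Re \o u) g) + (Im \o v) g).
  rewrite !rsumD ?rsumZ//.
  - exact: rsummableZ.
  - exact: rsummableZ.
  - by apply: rsummableD; exact: rsummableZ.
by apply/funext => g; rewrite ImD ImM.
Qed.

Lemma csum_conj u : csummable u -> csum (fun x => conjc (u x)) = conjc (csum u).
Proof.
move=> [ru iu]; apply: complex_ext; rewrite ?ReJ ?ImJ /=.
  by congr rsum; apply/funext => g; rewrite ReJ.
by rewrite -rsumN//; congr rsum; apply/funext => g; rewrite ImJ.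
Qed.

Lemma csum_reindex (e : G -> G) u : bijective e -> csum (u \o e) = csum u.
Proof.
move=> be; rewrite /csum -(rsum_reindex (fun g => Re (u g)) be).
by rewrite -(rsum_reindex (fun g => Im (u g)) be).
Qed.

Lemma csum_point y u : (forall x, x != y -> u x = 0) -> csum u = u y.
Proof.
move=> uy; apply: complex_ext; rewrite /csum /=.
  by rewrite (@rsum_point _ _ y)// => x /uy ->.
by rewrite (@rsum_point _ _ y)// => x /uy ->.
Qed.

(** * The Hilbert space of square summable functions *)

Definition sqfun f : G -> R := fun x => normc (f x) ^+ 2.
Definition nsq f : R := fine (sqnorm2 f).

Lemma sqfun_ge0 f x : 0 <= sqfun f x. Proof. exact: sqr_ge0. Qed.
Hint Resolve sqfun_ge0 : core.

Lemma l2P f : l2 f <-> rsummable (sqfun f).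
Proof.
split=> [h|h]; first exact: (rsummable_ge0 (sqfun_ge0 f) h).
rewrite /l2 /sqnorm2 (esum_fineK _ h) ?ltry//.
Qed.

Lemma nsqE f : l2 f -> sqnorm2 f = (nsq f)%:E.
Proof. by move=> /l2P h; rewrite /nsq /sqnorm2 (esum_fineK _ h). Qed.

Lemma nsq_rsum f : l2 f -> nsq f = rsum (sqfun f).
Proof. by move=> /l2P h; rewrite rsum_ge0. Qed.

Lemma nsq_ge0 f : l2 f -> 0 <= nsq f.
Proof.
by move=> lf; rewrite -lee_fin -nsqE//; apply: esum_ge0 => x _; rewrite lee_fin sqr_ge0.
Qed.

Lemma sqfun_le_nsq f x : l2 f -> normc (f x) ^+ 2 <= nsq f.
Proof.
move=> lf; rewrite -lee_fin -nsqE// -(@esum_set1 _ _ x (fun x => (normc (f x) ^+ 2)%:E)); last first.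
  by rewrite lee_fin; exact: sqfun_ge0.
rewrite [leLHS]esum_mkcond; apply: le_esum => y _.
by case: ifPn => // _; rewrite lee_fin; exact: sqfun_ge0.
Qed.

Lemma nsq0_eq0 f : l2 f -> nsq f = 0 -> f = fun=> 0.
Proof.
move=> lf f0; apply/funext => x; apply: ComplexField.Normc.eq0_normc.
have := sqfun_le_nsq x lf; rewrite f0 => h; apply/eqP; rewrite -sqrf_eq0 eq_le h.
exact: sqr_ge0.
Qed.

Lemma sqfunD_le f h x : sqfun (fun y => f y + h y) x <= 2 * sqfun f x + 2 * sqfun h x.
Proof.
rewrite /sqfun !sqr_normcE ReD ImD.
have := sqr_ge0 (Re (f x) - Re (h x)); have := sqr_ge0 (Im (f x) - Im (h x)).
by rewrite !sqrrB !sqrrD; lra.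
Qed.

Lemma l2D f h : l2 f -> l2 h -> l2 (fun x => f x + h x).
Proof.
move=> /l2P lf /l2P lh; apply/l2P.
apply: (@le_rsummable _ _ _ (fun x => 2 * sqfun f x + 2 * sqfun h x)).
  by move=> x; rewrite ger0_norm// sqfunD_le.
by apply: rsummableD; apply: rsummableZ.
Qed.

Lemma nsqD_le f h : l2 f -> l2 h ->
  nsq (fun x => f x + h x) <= 2 * nsq f + 2 * nsq h.
Proof.
move=> lf lh; have lfh := l2D lf lh.
move/l2P: (lf) => sf; move/l2P: (lh) => sh.
rewrite !nsq_rsum// -!rsumZ// -rsumD; [|exact: rsummableZ..].
rewrite -lee_fin -nsq_rsum// -nsqE// rsum_ge0.
- rewrite -esum_fineK.
  + by apply: le_esum => x _; rewrite lee_fin sqfunD_le.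
  + by move=> x; rewrite addr_ge0// mulr_ge0.
  + by apply: rsummableD; apply: rsummableZ.
- by move=> x; rewrite addr_ge0// mulr_ge0.
- by apply: rsummableD; apply: rsummableZ.
Qed.

Lemma sqfunZ c f x : sqfun (fun y => c * f y) x = normc c ^+ 2 * sqfun f x.
Proof. by rewrite /sqfun ComplexField.Normc.normcM exprMn. Qed.

Lemma l2Z c f : l2 f -> l2 (fun x => c * f x).
Proof.
move=> /l2P lf; apply/l2P; rewrite (_ : sqfun _ = fun x => normc c ^+ 2 * sqfun f x).
  exact: rsummableZ.
by apply/funext => x; rewrite sqfunZ.
Qed.

Lemma nsqZ c f : l2 f -> nsq (fun x => c * f x) = normc c ^+ 2 * nsq f.
Proof.
move=> lf; rewrite !nsq_rsum//; last exact: l2Z.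
have -> : sqfun (fun x => c * f x) = fun x => normc c ^+ 2 * sqfun f x.
  by apply/funext => x; rewrite sqfunZ.
by move/l2P : lf; exact: rsumZ.
Qed.

Lemma l2_0 : l2 (fun _ : G => 0 : C).
Proof.
rewrite /l2 /sqnorm2 esum1 ?ltry// => x _.
by rewrite ComplexField.Normc.normc0 expr0n.
Qed.

Lemma l2B f h : l2 f -> l2 h -> l2 (fun x => f x - h x).
Proof.
move=> lf lh; have := l2D lf (l2Z (-1) lh); congr l2.
by apply/funext => x; rewrite mulN1r.
Qed.

Lemma l2_sum (I : Type) (r : seq I) (P : pred I) (F : I -> G -> C) :
  (forall i, l2 (F i)) -> l2 (fun x => \sum_(i <- r | P i) F i x).
Proof.
move=> lF; elim: r => [|i r IH].
  by have := l2_0; congr l2; apply/funext => x; rewrite big_nil.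
case: (boolP (P i)) => Pi; last first.
  by move: IH; congr l2; apply/funext => x; rewrite big_cons (negbTE Pi).
by have := l2D (lF i) IH; congr l2; apply/funext => x; rewrite big_cons Pi.
Qed.

Lemma l2_reindex (e : G -> G) f : bijective e -> l2 f -> l2 (f \o e).
Proof. by move=> be /l2P lf; apply/l2P; exact: (rsummable_reindex be lf). Qed.

Lemma nsq_reindex (e : G -> G) f : bijective e -> l2 f -> nsq (f \o e) = nsq f.
Proof.
move=> be lf; rewrite !nsq_rsum//; last exact: l2_reindex.
exact: (rsum_reindex (sqfun f) be).
Qed.

Lemma l2_mul f h : l2 f -> l2 h -> csummable (fun x => f x * conjc (h x)).
Proof.
move=> /l2P lf /l2P lh.
have dom x : normc (f x * conjc (h x)) <= sqfun f x + sqfun h x.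
  rewrite ComplexField.Normc.normcM normc_conjc /sqfun.
  have := sqr_ge0 (normc (f x) - normc (h x)); rewrite sqrrB.
  have := mulr_ge0 (normc_ge0 (f x)) (normc_ge0 (h x)).
  by lra.
split; apply: (le_rsummable _ (rsummableD lf lh)) => x.
  exact: le_trans (abs_Re_normc _) (dom x).
exact: le_trans (abs_Im_normc _) (dom x).
Qed.

Lemma eq_innerl f k h : f =1 k -> inner f h = inner k h.
Proof. by move=> /funext ->. Qed.

Lemma inner_linl c f k h : l2 f -> l2 k -> l2 h ->
  inner (fun x => c * f x + k x) h = c * inner f h + inner k h.
Proof.
move=> lf lk lh; rewrite /inner -csum_lin; [|exact: l2_mul..].
by congr csum; apply/funext => x; rewrite mulrDl mulrA.
Qed.

Lemma inner_conj f h : l2 f -> l2 h -> inner h f = conjc (inner f h).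
Proof.
move=> lf lh; rewrite /inner -csum_conj; last exact: l2_mul.
by congr csum; apply/funext => x; rewrite conjcM conjcK mulrC.
Qed.

Lemma innerDl f k h : l2 f -> l2 k -> l2 h ->
  inner (fun x => f x + k x) h = inner f h + inner k h.
Proof.
move=> lf lk lh; rewrite -[in RHS](mul1r (inner f h)) -inner_linl//.
by apply: eq_innerl => x; rewrite mul1r.
Qed.

Lemma inner0l h : inner (fun=> 0) h = 0.
Proof.
rewrite /inner (@csum_point (1%g)) ?mul0r// => x _.
by rewrite mul0r.
Qed.

Lemma innerZl c f h : l2 f -> l2 h -> inner (fun x => c * f x) h = c * inner f h.
Proof.
move=> lf lh; rewrite -[RHS]addr0 -(inner0l h) -inner_linl//; last exact: l2_0.
by apply: eq_innerl => x; rewrite addr0.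
Qed.

Lemma innerBl f k h : l2 f -> l2 k -> l2 h ->
  inner (fun x => f x - k x) h = inner f h - inner k h.
Proof.
move=> lf lk lh; rewrite -mulN1r addrC -inner_linl//.
by apply: eq_innerl => x; rewrite mulN1r addrC.
Qed.

Lemma innerDr f h k : l2 f -> l2 h -> l2 k ->
  inner f (fun x => h x + k x) = inner f h + inner f k.
Proof.
move=> lf lh lk; rewrite (inner_conj (l2D lh lk))// innerDl// conjcD.
by rewrite -!inner_conj.
Qed.

Lemma innerZr c f h : l2 f -> l2 h -> inner f (fun x => c * h x) = conjc c * inner f h.
Proof.
move=> lf lh; rewrite (inner_conj (l2Z c lh))// innerZl// conjcM.
by rewrite -!inner_conj.
Qed.

Lemma innerBr f h k : l2 f -> l2 h -> l2 k ->
  inner f (fun x => h x - k x) = inner f h - inner f k.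
Proof.
move=> lf lh lk; rewrite (inner_conj (l2B lh lk))// innerBl// conjcB.
by rewrite -!inner_conj.
Qed.

Lemma inner0r h : inner h (fun=> 0) = 0.
Proof.
have e x : h x * conjc (0 : C) = 0 by rewrite conjc0 mulr0.
by rewrite /inner (@csum_point 1%g) ?e// => x _; rewrite e.
Qed.

Lemma inner_self f : l2 f -> inner f f = (nsq f)%:C%C.
Proof.
move=> lf; rewrite nsq_rsum// /inner /csum /real_complex_def; congr (_ +i* _)%C.
  by congr rsum; apply/funext => x; rewrite mul_conjc.
rewrite (@rsum_point _ _ 1%g) ?mul_conjc// => x _.
by rewrite mul_conjc.
Qed.

Lemma inner_suml (I : Type) (r : seq I) (P : pred I) (F : I -> G -> C) h :
  l2 h -> (forall i, l2 (F i)) ->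
  inner (fun x => \sum_(i <- r | P i) F i x) h = \sum_(i <- r | P i) inner (F i) h.
Proof.
move=> lh lF; elim: r => [|i r IH].
  rewrite big_nil (_ : (fun x => _) = fun=> 0) ?inner0l//.
  by apply/funext => x; rewrite big_nil.
rewrite big_cons; case: (boolP (P i)) => Pi; last first.
  rewrite -IH; apply: eq_innerl => x.
  by rewrite big_cons (negbTE Pi).
rewrite -IH -innerDl//; last exact: l2_sum.
by apply: eq_innerl => x; rewrite big_cons Pi.
Qed.

Lemma nsqD_orth f h : l2 f -> l2 h -> inner f h = 0 ->
  nsq (fun x => f x + h x) = nsq f + nsq h.
Proof.
move=> lf lh fh; apply: realc_inj.
have lfh := l2D lf lh.
rewrite -[LHS]inner_self// innerDl// !innerDr// (inner_conj lf lh) fh conjc0.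
by rewrite addr0 add0r !inner_self// realcD.
Qed.

(** The square of the length of [|h|^2 f - <f, h> h] is nonnegative. *)
Lemma CauchySchwarz f h : l2 f -> l2 h -> normc (inner f h) ^+ 2 <= nsq f * nsq h.
Proof.
move=> lf lh; have [h0|h0] := eqVneq (nsq h) 0.
  by rewrite h0 mulr0 (nsq0_eq0 lh h0) inner0r ComplexField.Normc.normc0 expr0n.
have b0 : 0 < nsq h by rewrite lt_neqAle eq_sym h0 nsq_ge0.
set z := inner f h.
have l1 : l2 (fun x => (nsq h)%:C%C * f x) by exact: l2Z.
have l2' : l2 (fun x => z * h x) by exact: l2Z.
have /nsq_ge0 := l2B l1 l2'.
suff -> : nsq (fun x => (nsq h)%:C%C * f x - z * h x) = nsq h * (nsq f * nsq h - normc z ^+ 2).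
  by rewrite pmulr_rge0// subr_ge0.
apply: realc_inj; rewrite -[LHS]inner_self; last exact: l2B.
rewrite innerBl//; last exact: l2B.
rewrite !innerBr// !innerZl// !innerZr// !inner_self// (inner_conj lf)// -/z.
rewrite !realcJ realcM realcB realcM -mul_conjc.
by ring.
Qed.

Lemma l2_zeta (g : G) : l2 (zeta g : G -> C).
Proof.
apply/l2P; apply: (@rsummable_point _ _ g) => x /negbTE xg.
by rewrite /sqfun /zeta xg ComplexField.Normc.normc0 expr0n.
Qed.

Lemma inner_zeta f g : inner f (zeta g) = f g.
Proof.
rewrite /inner (@csum_point g) /zeta ?eqxx ?conjc1 ?mulr1// => x /negbTE ->.
by rewrite conjc0 mulr0.
Qed.

Lemma nsq_zeta (g : G) : nsq (zeta g : G -> C) = 1.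
Proof. by apply: realc_inj; rewrite -inner_self ?inner_zeta /zeta ?eqxx//; exact: l2_zeta. Qed.

Lemma nsq0 : nsq (fun=> 0) = 0 :> R.
Proof. by apply: realc_inj; rewrite -inner_self ?inner0l//; exact: l2_0. Qed.

End ComplexSums.

(** * Operators generated by the shifts *)

Section Operators.
Context {R : realType} {G : groupType}.
Local Notation C := R[i].
Local Notation Re := (@complex.Re R).
Local Notation Im := (@complex.Im R).
Local Notation normc := (@ComplexField.Normc.normc R).
Local Notation op := ((G -> C) -> (G -> C)).
Implicit Types (f h k : G -> C) (c z w : C) (U V : op) (P : C -> Prop).

Definition lshift (g : G) : op := fun f x => f (g^-1 * x)%g.

(** Pairs made of an operator and its formal adjoint, obtained from the left
    translations with scalars in [P].  Carrying the adjoint along gives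
    boundedness, adjunction and the trace property by induction; the parameter
    [P] later singles out the integral combinations. *)
Inductive gop P : op -> op -> Prop :=
| gop_shift g : gop P (lshift g) (lshift g^-1)
| gop_scale c U V : P c -> gop P U V ->
    gop P (fun f x => c * U f x) (fun f x => conjc c * V f x)
| gop_add U V U' V' : gop P U V -> gop P U' V' ->
    gop P (fun f x => U f x + U' f x) (fun f x => V f x + V' f x)
| gop_comp U V U' V' : gop P U V -> gop P U' V' ->
    gop P (fun f => U (U' f)) (fun f => V' (V f)).

Definition fop := gop (fun=> True).

Lemma gopW P U V : gop P U V -> fop U V.
Proof. by elim=> *; [exact: gop_shift|exact: gop_scale|exact: gop_add|exact: gop_comp]. Qed.

Lemma gop_sym P U V : (forall c, P c -> P (conjc c)) -> gop P U V -> gop P V U.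
Proof.
move=> PJ; elim=> [g|c A B Pc _ IH|A B A' B' _ IH _ IH'|A B A' B' _ IH _ IH'].
- by rewrite -[X in gop P _ (lshift X)]invgK; exact: gop_shift.
- rewrite (_ : (fun f x => c * A f x) = (fun f x => conjc (conjc c) * A f x)).
    by apply: gop_scale => //; exact: PJ.
  by apply/funext => f; apply/funext => x; rewrite conjcK.
- exact: gop_add.
- exact: gop_comp.
Qed.

Lemma fop_sym U V : fop U V -> fop V U. Proof. exact: gop_sym. Qed.

Lemma eq_gop P U V U' V' : (forall f, U f =1 U' f) -> (forall f, V f =1 V' f) ->
  gop P U V -> gop P U' V'.
Proof.
move=> eU eV; have -> : U' = U by apply/funext => f; apply/funext => x; rewrite eU.
by have -> : V' = V by apply/funext => f; apply/funext => x; rewrite eV.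
Qed.

Lemma gop_sum P (I : Type) (r : seq I) (Q : pred I) (U V : I -> op) : P 0 ->
  (forall i, gop P (U i) (V i)) ->
  gop P (fun f x => \sum_(i <- r | Q i) U i f x) (fun f x => \sum_(i <- r | Q i) V i f x).
Proof.
move=> P0 UV; elim: r => [|i r IH].
  apply: (eq_gop _ _ (gop_scale P0 (gop_shift P 1%g))) => f x.
    by rewrite big_nil mul0r.
  by rewrite big_nil conjc0 mul0r.
case: (boolP (Q i)) => Qi; last first.
  by apply: (eq_gop _ _ IH) => f x; rewrite big_cons (negbTE Qi).
by apply: (eq_gop _ _ (gop_add (UV i) IH)) => f x; rewrite big_cons Qi.
Qed.

Lemma gop_lin P U V c f h : gop P U V ->
  U (fun x => c * f x + h x) = fun x => c * U f x + U h x.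
Proof.
move=> UV; elim: UV c f h => [g|d A B _ _ IH|A B A' B' _ IH _ IH'|A B A' B' _ IH _ IH'] c f h.
- by [].
- by apply/funext => x; rewrite IH; ring.
- by apply/funext => x; rewrite IH IH'; ring.
- by rewrite IH' IH.
Qed.

Lemma gopD P U V f h : gop P U V -> U (fun x => f x + h x) = fun x => U f x + U h x.
Proof.
move=> UV; transitivity (U (fun x => 1 * f x + h x)).
  by congr U; apply/funext => x; rewrite mul1r.
by rewrite (gop_lin _ _ _ UV); apply/funext => x; rewrite mul1r.
Qed.

Lemma gop0 P U V : gop P U V -> U (fun=> 0) = fun=> 0.
Proof.
move=> UV; have := gop_lin (-1) (fun=> 0) (fun=> 0) UV.
rewrite (_ : (fun x : G => _) = fun=> 0); last by apply/funext => x; rewrite mulr0 addr0.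
by move=> ->; apply/funext => x; rewrite mulN1r addNr.
Qed.

Lemma gopZ P U V c f : gop P U V -> U (fun x => c * f x) = fun x => c * U f x.
Proof.
move=> UV; transitivity (U (fun x => c * f x + (fun=> 0) x)).
  by congr U; apply/funext => x; rewrite addr0.
by rewrite (gop_lin _ _ _ UV) (gop0 UV); apply/funext => x; rewrite addr0.
Qed.

Lemma gopB P U V f h : gop P U V -> U (fun x => f x - h x) = fun x => U f x - U h x.
Proof.
move=> UV; transitivity (U (fun x => -1 * h x + f x)).
  by congr U; apply/funext => x; rewrite mulN1r addrC.
by rewrite (gop_lin _ _ _ UV); apply/funext => x; rewrite mulN1r addrC.
Qed.

Lemma gop_sumr P U V (I : Type) (r : seq I) (Q : pred I) (F : I -> G -> C) : gop P U V ->
  U (fun x => \sum_(i <- r | Q i) F i x) = fun x => \sum_(i <- r | Q i) U (F i) x.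
Proof.
move=> UV; elim: r => [|i r IH].
  transitivity (U (fun=> 0)); first by congr U; apply/funext => x; rewrite big_nil.
  by rewrite (gop0 UV); apply/funext => x; rewrite big_nil.
case: (boolP (Q i)) => Qi; last first.
  transitivity (U (fun x => \sum_(i <- r | Q i) F i x)).
    by congr U; apply/funext => x; rewrite big_cons (negbTE Qi).
  by rewrite IH; apply/funext => x; rewrite big_cons (negbTE Qi).
transitivity (U (fun x => F i x + \sum_(i <- r | Q i) F i x)).
  by congr U; apply/funext => x; rewrite big_cons Qi.
by rewrite (gopD _ _ UV) IH; apply/funext => x; rewrite big_cons Qi.
Qed.

Lemma mulg_bij (g : G) : bijective (fun x => g * x)%g.
Proof. by exists (fun x => g^-1 * x)%g => x; rewrite ?mulKg ?mulVKg. Qed.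

Lemma gop_bound P U V : gop P U V -> exists2 K : R, 0 <= K &
  forall f, l2 f -> l2 (U f) /\ nsq (U f) <= K * nsq f.
Proof.
elim=> [g|d A B _ _ [K K0 IH]|A B A' B' _ [K K0 IH] _ [K' K'0 IH']
       |A B A' B' _ [K K0 IH] _ [K' K'0 IH']].
- exists 1 => // f lf; split.
    exact: (l2_reindex (mulg_bij g^-1)).
  by rewrite mul1r -(nsq_reindex (mulg_bij g^-1) lf).
- exists (normc d ^+ 2 * K) => [|f lf]; first by rewrite mulr_ge0// sqr_ge0.
  have [lA bA] := IH f lf; split; first exact: l2Z.
  by rewrite nsqZ// -[leRHS]mulrA ler_wpM2l// sqr_ge0.
- exists (2 * K + 2 * K') => [|f lf]; first by rewrite addr_ge0// mulr_ge0.
  have [lA bA] := IH f lf; have [lA' bA'] := IH' f lf.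
  split; first exact: l2D.
  apply: le_trans (nsqD_le lA lA') _.
  by move: bA bA'; lra.
- exists (K * K') => [|f lf]; first by rewrite mulr_ge0.
  have [lA' bA'] := IH' f lf; have [lA bA] := IH _ lA'.
  by split => //; apply: le_trans bA _; rewrite -mulrA ler_wpM2l.
Qed.

Lemma gop_l2 P U V f : gop P U V -> l2 f -> l2 (U f).
Proof. by move=> /gop_bound[K _ h] /h[]. Qed.

Lemma fop_adj U V f h : fop U V -> l2 f -> l2 h -> inner (U f) h = inner f (V h).
Proof.
move=> UV; elim: UV f h => [g|d A B _ AB IH|A B A' B' AB IH AB' IH'|A B A' B' AB IH AB' IH']
  f h lf lh.
- rewrite /inner -(csum_reindex _ (mulg_bij g)); congr csum; apply/funext => x /=.
  by rewrite /lshift mulKg invgK.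
- have [lA lB] := (gop_l2 AB lf, gop_l2 (fop_sym AB) lh).
  by rewrite innerZl// innerZr// conjcK IH.
- have [lA lB] := (gop_l2 AB lf, gop_l2 (fop_sym AB) lh).
  have [lA' lB'] := (gop_l2 AB' lf, gop_l2 (fop_sym AB') lh).
  by rewrite innerDl// innerDr// IH// IH'.
- have [lA' lB] := (gop_l2 AB' lf, gop_l2 (fop_sym AB) lh).
  by rewrite IH// IH'.
Qed.

Lemma gop_right P U V f (g : G) : gop P U V -> U (fun x => f (x * g)%g) = fun x => U f (x * g)%g.
Proof.
move=> UV; elim: UV f => [k|d A B _ _ IH|A B A' B' _ IH _ IH'|A B A' B' _ IH _ IH'] f.
- by apply/funext => x; rewrite /lshift mulgA.
- by rewrite IH.
- by rewrite IH IH'.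
- by rewrite IH' IH.
Qed.

Lemma lshiftE (g h : G) f : lshift g (lshift h f) = lshift (g * h)%g f.
Proof. by apply/funext => x; rewrite /lshift invgM mulgA. Qed.

Lemma lshift1 f : lshift 1%g f = f.
Proof. by apply/funext => x; rewrite /lshift invg1 mul1g. Qed.

Lemma lshift_zeta (g h : G) : lshift g (zeta h : G -> C) = zeta (g * h)%g.
Proof.
apply/funext => x; rewrite /lshift /zeta; congr (_%:R); congr nat_of_bool.
by apply/eqP/eqP => [<-|->]; rewrite ?mulKg ?mulVKg.
Qed.

Lemma gop_zeta P U V (g : G) : gop P U V -> U (zeta g) = fun x => U (zeta 1%g) (x * g^-1)%g.
Proof.
move=> UV; rewrite -(gop_right _ _ UV); congr U; apply/funext => x.
by rewrite /zeta divg_eq1.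
Qed.

(** The trace of the group von Neumann algebra. *)
Definition tr U : C := U (zeta 1%g) 1%g.

(** For a translation [V] this is the commutation with right translations, and
    the general case follows by induction. *)
Lemma trC U V U' V' : fop U U' -> fop V V' -> tr (fun f => U (V f)) = tr (fun f => V (U f)).
Proof.
move=> FU FV; elim: FV U U' FU => [g|d A B _ AB IH|A B A' B' AB IH AB' IH'|A B A' B' AB IH AB' IH']
  U U' UU'; rewrite /tr /=.
- rewrite lshift_zeta mulg1 (gop_zeta _ UU') /lshift !mul1g mulg1//.
- rewrite (gopZ _ _ UU') -/(tr (fun f => U (A f))) (IH _ _ UU')//.
- rewrite (gopD _ _ UU'); rewrite -/(tr (fun f => U (A f))) (IH _ _ UU').
  by rewrite -/(tr (fun f => U (A' f))) (IH' _ _ UU').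
- rewrite -/(tr (fun f => (fun k => U (A k)) (A' f))).
  rewrite (IH' (fun k => U (A k)) _ (gop_comp UU' AB)).
  rewrite -/(tr (fun f => (fun k => A' (U k)) (A f))).
  by rewrite (IH (fun k => A' (U k)) _ (gop_comp AB' UU')).
Qed.

End Operators.

(** * Limits of square summable functions *)

Section SquareSummableLimits.
Context {R : realType} {G : groupType}.
Local Notation C := R[i].
Local Notation Re := (@complex.Re R).
Local Notation Im := (@complex.Im R).
Local Notation normc := (@ComplexField.Normc.normc R).
Implicit Types (f h k : G -> C) (s : nat -> G -> C).

Lemma squeeze0 (a b : nat -> R) : (forall n, 0 <= a n) -> (forall n, a n <= b n) ->
  b @ \oo --> (0 : R) -> a @ \oo --> (0 : R).
Proof.
move=> a0 ab b0; apply: (squeeze_cvgr (f := fun=> 0) (h := b)) => //; last exact: cvg_cst.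
by near=> n; rewrite a0 ab.
Unshelve. all: by end_near.
Qed.

Lemma cvg0_const (a : R) (b : nat -> R) : 0 <= a -> (forall n, a <= b n) ->
  b @ \oo --> (0 : R) -> a = 0.
Proof.
move=> a0 ab b0; have := squeeze0 (a := fun=> a) (fun=> a0) ab b0.
by move=> /cvg_lim <-//; rewrite lim_cst.
Qed.

Lemma sqr_normcD_le (z w : C) : normc (z + w) ^+ 2 <= 2 * normc z ^+ 2 + 2 * normc w ^+ 2.
Proof.
rewrite !sqr_normcE ReD ImD.
by have := sqr_ge0 (Re z - Re w); have := sqr_ge0 (Im z - Im w); lra.
Qed.

Lemma normcN (z : C) : normc (- z) = normc z.
Proof. by case: z => a b /=; rewrite !sqrrN. Qed.

(** Convergence through squared distances, the form in which the square norms
    deliver it. *)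
Definition ccvg (z : nat -> C) (w : C) := (fun n => normc (w - z n) ^+ 2) @ \oo --> (0 : R).

Lemma ccvg_unique z w w' : ccvg z w -> ccvg z w' -> w = w'.
Proof.
move=> zw zw'; apply/eqP; rewrite -subr_eq0; apply/eqP/ComplexField.Normc.eq0_normc.
apply/eqP; rewrite -sqrf_eq0; apply/eqP.
apply: (@cvg0_const _ (fun n => 2 * normc (w - z n) ^+ 2 + 2 * normc (w' - z n) ^+ 2)).
- exact: sqr_ge0.
- move=> n; have -> : w - w' = (w - z n) + - (w' - z n) by ring.
  by apply: le_trans (sqr_normcD_le _ _) _; rewrite normcN.
- rewrite [X in _ --> X](_ : 0 = 2 * 0 + 2 * 0); last by ring.
  by apply: cvgD; apply: cvgMr => //; exact: cvg_cst.
Qed.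

Let sq_cvg (u : nat -> R) (l : R) :
  (fun n => (l - u n) ^+ 2) @ \oo --> (0 : R) -> u @ \oo --> l.
Proof.
move=> h; apply/cvgrPdist_lt => e e0.
move/cvgrPdist_lt : h => /(_ (e ^+ 2) (exprn_gt0 _ e0)).
apply: filterS => n; rewrite sub0r normrN.
rewrite ger0_norm ?sqr_ge0// => h; rewrite -(@ltr_pXn2r _ 2)// ?nnegrE ?(ltW e0)//.
by rewrite real_normK ?num_real.
Qed.

Lemma ccvg_Re z w : ccvg z w -> (fun n => Re (z n)) @ \oo --> Re w.
Proof.
move=> zw; apply: sq_cvg; apply: squeeze0 zw => n; first exact: sqr_ge0.
by rewrite sqr_normcE; case: (z n) => a b; case: w => a' b' /=; rewrite lerDl sqr_ge0.
Qed.

Lemma ccvg_Im z w : ccvg z w -> (fun n => Im (z n)) @ \oo --> Im w.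
Proof.
move=> zw; apply: sq_cvg; apply: squeeze0 zw => n; first exact: sqr_ge0.
by rewrite sqr_normcE; case: (z n) => a b; case: w => a' b' /=; rewrite lerDr sqr_ge0.
Qed.

Lemma ReIm_ccvg (z : nat -> C) (a b : R) : (fun n => Re (z n)) @ \oo --> a ->
  (fun n => Im (z n)) @ \oo --> b -> ccvg z (a +i* b)%C.
Proof.
move=> za zb; rewrite /ccvg.
rewrite (_ : (fun n => _) = (fun n => (a - Re (z n)) ^+ 2 + (b - Im (z n)) ^+ 2)); last first.
  by apply/funext => n; rewrite sqr_normcE; case: (z n).
rewrite [X in _ --> X](_ : 0 = (a - a) * (a - a) + (b - b) * (b - b)); last by ring.
by apply: cvgD; apply: cvgM; apply: cvgB => //; exact: cvg_cst.
Qed.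

Lemma ccvg_sqr_normc z w : ccvg z w -> (fun n => normc (z n) ^+ 2) @ \oo --> normc w ^+ 2.
Proof.
move=> zw; rewrite sqr_normcE.
rewrite (_ : (fun n => _) = (fun n => Re (z n) * Re (z n) + Im (z n) * Im (z n))).
  by apply: cvgD; apply: cvgM; by [exact: ccvg_Re|exact: ccvg_Im].
by apply/funext => n; rewrite sqr_normcE.
Qed.

Definition l2cvg s h :=
  [/\ forall n, l2 (s n), l2 h
    & (fun n => nsq (fun x => h x - s n x)) @ \oo --> (0 : R)].

Lemma l2cvg_inner s h k : l2cvg s h -> l2 k ->
  ccvg (fun n => inner (s n) k) (inner h k).
Proof.
move=> [ls lh sh] lk; apply: (@squeeze0 _ (fun n => nsq (fun x => h x - s n x) * nsq k)).
- by move=> n; exact: sqr_ge0.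
- by move=> n; rewrite -innerBl//; apply: CauchySchwarz => //; exact: l2B.
- by rewrite -[X in _ --> X](mul0r (nsq k)); apply: cvgMl => //; exact: cvg_cst.
Qed.

Lemma l2cvg_unique s h h' : l2cvg s h -> l2cvg s h' -> h = h'.
Proof.
move=> [ls lh sh] [_ lh' sh']; apply/funext => x.
rewrite -(inner_zeta h) -(inner_zeta h').
by apply: (@ccvg_unique (fun n => inner (s n) (zeta x))); apply: l2cvg_inner;
  by [split|exact: l2_zeta].
Qed.

Lemma l2cvg_lin c s s' h h' : l2cvg s h -> l2cvg s' h' ->
  l2cvg (fun n x => c * s n x + s' n x) (fun x => c * h x + h' x).
Proof.
move=> [ls lh sh] [ls' lh' sh']; split.
- by move=> n; apply: l2D => //; exact: l2Z.
- by apply: l2D => //; exact: l2Z.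
apply: (@squeeze0 _ (fun n => 2 * (normc c ^+ 2 * nsq (fun x => h x - s n x)) +
    2 * nsq (fun x => h' x - s' n x))).
- by move=> n; apply: nsq_ge0; apply: l2B; apply: l2D => //; exact: l2Z.
- move=> n; have l1 := l2B lh (ls n); have l1' := l2B lh' (ls' n).
  rewrite -nsqZ//; apply: le_trans (nsqD_le (l2Z c l1) l1').
  rewrite le_eqVlt; apply/orP; left; apply/eqP; congr nsq; apply/funext => x; ring.
- rewrite [X in _ --> X](_ : 0 = 2 * (normc c ^+ 2 * 0) + 2 * 0); last by ring.
  by apply: cvgD; [apply: cvgMr; apply: cvgMr|apply: cvgMr].
Qed.

Lemma l2cvg_cst h : l2 h -> l2cvg (fun=> h) h.
Proof.
move=> lh; split => //.
rewrite (_ : (fun n => _) = fun=> 0); first exact: cvg_cst.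
apply/funext => _; rewrite -(@nsq0 R G); congr nsq; apply/funext => x.
by rewrite subrr.
Qed.

Lemma l2cvg_op P (U V : (G -> C) -> (G -> C)) s h : gop P U V -> l2cvg s h ->
  l2cvg (fun n => U (s n)) (U h).
Proof.
move=> UV [ls lh sh]; have [K K0 bU] := gop_bound UV.
split=> [n||]; [exact: gop_l2 UV (ls n)|exact: gop_l2 UV lh|].
apply: (@squeeze0 _ (fun n => K * nsq (fun x => h x - s n x))).
- by move=> n; apply: nsq_ge0; apply: l2B; exact: gop_l2 UV _.
- by move=> n; rewrite -(gopB _ _ UV); have [] := bU _ (l2B lh (ls n)).
- by rewrite -[X in _ --> X](mulr0 K); apply: cvgMr => //; exact: cvg_cst.
Qed.

Lemma eq_l2cvg s s' h : (forall n, s n =1 s' n) -> l2cvg s h -> l2cvg s' h.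
Proof.
by move=> ss; have -> : s' = s by apply/funext => n; apply/funext => x; rewrite ss.
Qed.

(** Fatou's lemma: the bound holds for all finite partial sums of the square
    norm of the limit. *)
Lemma nsq_fatou s h (e : R) :
  (forall n, l2 (s n)) -> (forall x, ccvg (s ^~ x) (h x)) ->
  (\forall n \near \oo, nsq (s n) <= e) -> l2 h /\ nsq h <= e.
Proof.
move=> ls sh se.
suff le : (sqnorm2 h <= e%:E)%E.
  have lh : l2 h by apply: le_lt_trans le (ltry _).
  by split => //; rewrite -lee_fin -nsqE.
apply: ge_ereal_sup => _ [A [finA _] <-].
rewrite fsbig_finite//= sumEFin lee_fin.
have cv : (fun n => \sum_(i <- fset_set A) normc (s n i) ^+ 2) @ \oo -->
    \sum_(i <- fset_set A) normc (h i) ^+ 2.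
  elim: (enum_fset (fset_set A)) => [|x r IH].
    by rewrite big_nil; under eq_fun do rewrite big_nil; exact: cvg_cst.
  rewrite big_cons; under eq_fun do rewrite big_cons.
  by apply: cvgD => //; exact: (ccvg_sqr_normc (sh x)).
have cvn := cvgP _ cv; rewrite -(cvg_lim _ cv)//.
apply: limr_le => //; apply: filterS se => n; apply: le_trans.
rewrite -lee_fin -nsqE// -sumEFin -fsbig_finite//.
by apply: ereal_sup_ubound; exists A.
Qed.

Lemma real_cauchy_cvg (u b : nat -> R) : b @ \oo --> (0 : R) ->
  (forall n m, (n <= m)%N -> (u m - u n) ^+ 2 <= b n) -> exists l : R, u @ \oo --> l.
Proof.
move=> b0 ub; exists (lim (u @ \oo)); apply/cauchy_cvgP/cauchy_exP => e e0.
move/cvgrPdist_lt : b0 => /(_ (e ^+ 2) (exprn_gt0 _ e0)).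
move=> [N _ /(_ N (leqnn N))/=]; rewrite sub0r normrN => bN; exists (u N); exists N => // n /= Nn.
rewrite /ball/= distrC -(@ltr_pXn2r _ 2)// ?nnegrE ?(ltW e0)//.
rewrite real_normK ?num_real//; apply: le_lt_trans (ub _ _ Nn) _.
exact: le_lt_trans (ler_norm _) bN.
Qed.

Lemma l2_complete s (b : nat -> R) : (forall n, l2 (s n)) -> b @ \oo --> (0 : R) ->
  (forall n m, (n <= m)%N -> nsq (fun x => s m x - s n x) <= b n) ->
  exists h, l2cvg s h.
Proof.
move=> ls b0 sb.
have bnd x n m : (n <= m)%N -> normc (s m x - s n x) ^+ 2 <= b n.
  by move=> /sb; apply: le_trans; exact: (sqfun_le_nsq x (l2B (ls m) (ls n))).
have cRe x : exists l : R, (fun n => Re (s n x)) @ \oo --> l.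
  apply: (real_cauchy_cvg b0) => n m /(bnd x); apply: le_trans.
  by rewrite sqr_normcE; case: (s n x) => ? ?; case: (s m x) => ? ? /=; rewrite lerDl sqr_ge0.
have cIm x : exists l : R, (fun n => Im (s n x)) @ \oo --> l.
  apply: (real_cauchy_cvg b0) => n m /(bnd x); apply: le_trans.
  by rewrite sqr_normcE; case: (s n x) => ? ?; case: (s m x) => ? ? /=; rewrite lerDr sqr_ge0.
have /choice[h sh] : forall x, exists l, ccvg (s ^~ x) l.
  move=> x; have [l ll] := cRe x; have [l' ll'] := cIm x.
  by exists (l +i* l')%C; exact: ReIm_ccvg.
have key n : l2 (fun x => h x - s n x) /\ nsq (fun x => h x - s n x) <= b n.
  apply: (@nsq_fatou (fun m x => s m x - s n x)).
  - by move=> m; exact: l2B.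
  - move=> x; apply: squeeze0 (sh x) => m; first exact: sqr_ge0.
    by have -> : h x - s n x - (s m x - s n x) = h x - s m x by ring.
  - by exists n => // m /= /sb.
have lh : l2 h.
  have := l2D (key 0%N).1 (ls 0%N); congr l2; apply/funext => x.
  by rewrite subrK.
exists h; split => //; apply: squeeze0 b0 => n; last exact: (key n).2.
exact: nsq_ge0 (key n).1.
Qed.

End SquareSummableLimits.

(** * Atomic measures *)

Section AtomicMeasures.
Context {R : realType} {d : measure_display} {T : measurableType d}.
Implicit Types (u : nat -> R).

Lemma nn_series u (W : R) : (forall k, 0 <= u k) ->
  (forall n, \sum_(0 <= k < n) u k <= W) ->
  exists l : R, [/\ (fun n => \sum_(0 <= k < n) u k) @ \oo --> l,
    (\sum_(0 <= k <oo) (u k)%:E)%E = l%:E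
    & forall n, \sum_(0 <= k < n) u k <= l].
Proof.
move=> u0 uW; pose v n := \sum_(0 <= k < n) u k.
have ndv : nondecreasing_seq v.
  by apply/nondecreasing_seqP => n; rewrite /v big_nat_recr//= lerDl.
have cv : cvgn v.
  by apply: nondecreasing_is_cvgn => //; exists W => _ [n _ <-]; exact: uW.
exists (limn v); split => //; last by move=> n; exact: nondecreasing_cvgn_le.
apply/cvg_lim => //.
under eq_fun do rewrite sumEFin.
by apply: cvg_EFin => //; exact: nearW.
Qed.

Variables (w : nat -> {nonneg R}) (lam : nat -> T).

Definition atoms : {measure set T -> \bar R} :=
  mseries (fun k => mscale (w k) (dirac (lam k))) 0.

Lemma atomsE (B : set T) :
  atoms B = (\sum_(0 <= k <oo) ((w k)%:num * (lam k \in B)%:R)%:E)%E.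
Proof.
apply: eq_eseriesr => k _; rewrite /= /mscale /= diracE EFinM.
by [].
Qed.

Lemma atoms_ge0_integral (f : T -> \bar R) : measurable_fun setT f ->
  (forall t, 0 <= f t)%E ->
  (\int[atoms]_t f t = \sum_(0 <= k <oo) ((w k)%:num)%:E * f (lam k))%E.
Proof.
move=> mf f0; rewrite ge0_integral_measure_series//; apply: eq_eseriesr => k _.
by rewrite ge0_integral_mscale// integral_dirac// diracT mul1e.
Qed.

End AtomicMeasures.

(** The identity is unbounded on the line but bounded on the atoms. *)
Lemma atoms_integral {R : realType} (w : nat -> {nonneg R})
    (lam : nat -> measurableTypeR R) (W L : R) : (forall k, `|lam k : R| <= L) ->
  (forall n, \sum_(0 <= k < n) (w k)%:num <= W) ->
  (atoms w lam).-integrable setT (fun t : measurableTypeR R => (t : R)%:E) /\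
  (fun n => \sum_(0 <= k < n) (w k)%:num * (lam k : R)) @ \oo --> \int[atoms w lam]_t (t : R).
Proof.
move=> lamL wW.
have L0 : 0 <= L by apply: le_trans (lamL 0%N).
have wge k : 0 <= (w k)%:num by [].
have bnd (g : R -> R) : (forall t, 0 <= g t) -> (forall t, g t <= `|t|) ->
    exists l : R, (fun n => \sum_(0 <= k < n) (w k)%:num * g (lam k)) @ \oo --> l /\
      (\sum_(0 <= k <oo) ((w k)%:num * g (lam k))%:E)%E = l%:E.
  move=> g0 gt; have [|n|l [h1 h2 _]] := @nn_series R (fun k => (w k)%:num * g (lam k)) (L * W).
  - by move=> k; rewrite mulr_ge0.
  - apply: (@le_trans _ _ (\sum_(0 <= k < n) L * (w k)%:num)); last first.
      by rewrite -mulr_sumr ler_wpM2l.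
    by apply: ler_sum => k _; rewrite mulrC ler_wpM2r// (le_trans (gt _))//.
  - by exists l.
have mid : measurable_fun setT (fun t : measurableTypeR R => (t : R)%:E).
  by apply/measurable_EFinP; exact: measurable_id.
have [la [_ ea]] := bnd (fun t => `|t|) (fun t => normr_ge0 t) (fun t => lexx _).
have int : (atoms w lam).-integrable setT (fun t : measurableTypeR R => (t : R)%:E).
  apply/integrableP; split => //.
  rewrite atoms_ge0_integral//; last by apply: measurableT_comp.
  under eq_eseriesr do rewrite -EFinM.
  by rewrite ea ltry.
split => //.
have [p [cp ep]] := bnd (fun t => Num.max t 0) (fun t => ltac:(by rewrite le_max lexx orbT))
  (fun t => ltac:(by rewrite ge_max ler_norm normr_ge0)).
have [q [cq eq]] := bnd (fun t => Num.max (- t) 0) (fun t => ltac:(by rewrite le_max lexx orbT))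
  (fun t => ltac:(by rewrite ge_max -normrN ler_norm normr_ge0)).
have -> : \int[atoms w lam]_t (t : R) = p - q.
  rewrite /Rintegral integralE.
  rewrite atoms_ge0_integral//; last exact: measurable_funepos.
  rewrite atoms_ge0_integral//; last exact: measurable_funeneg.
  under eq_eseriesr do rewrite funeposE -EFin_max -EFinM.
  under [X in fine (_ - X)]eq_eseriesr do rewrite funenegE -EFinN -EFin_max -EFinM.
  by rewrite ep eq.
rewrite (_ : (fun n => _) = (fun n => \sum_(0 <= k < n) (w k)%:num * Num.max (lam k) 0
   - \sum_(0 <= k < n) (w k)%:num * Num.max (- lam k) 0)); first exact: cvgB.
apply/funext => n; rewrite -sumrB; apply: eq_bigr => k _.
rewrite -mulrBr; congr (_ * _); rewrite /Num.max.
by case: (ltP (lam k : R) 0); case: (ltP (- (lam k : R)) 0); rewrite ?subr0 ?sub0r ?opprK//; lra.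
Qed.

(** * The spectral resolution of an orthogonal series *)

Section OrthogonalSeries.
Context {R : realType} {G : groupType}.
Local Notation C := R[i].
Local Notation Re := (@complex.Re R).
Local Notation op := ((G -> C) -> (G -> C)).
Implicit Types (f h : G -> C) (k : nat) (P : pred nat).

Variables (Q : nat -> op).
Hypothesis Qself : forall k, fop (Q k) (Q k).
Hypothesis Qidem : forall k f, Q k (Q k f) = Q k f.
Hypothesis Qorth : forall k l f, k != l -> Q k (Q l f) = fun=> 0.
Hypothesis Qtotal : (fun n => \sum_(0 <= k < n) Re (tr (Q k))) @ \oo --> (1 : R).

Let lQ k f : l2 f -> l2 (Q k f). Proof. exact: gop_l2 (Qself k). Qed.

Definition psum P f n : G -> C := fun x => \sum_(0 <= k < n | P k) Q k f x.

Lemma l2_psum P f n : l2 f -> l2 (psum P f n).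
Proof. by move=> lf; apply: l2_sum => k; exact: lQ. Qed.

Lemma Q_psum P f n k : Q k (psum P f n) = if (k < n)%N && P k then Q k f else fun=> 0.
Proof.
rewrite /psum (gop_sumr _ _ _ (Qself k)); case: ifPn => [/andP[kn Pk]|kP].
  apply/funext => x; rewrite big_mkcond (bigD1_seq k) ?mem_index_iota ?iota_uniq//=.
  rewrite Pk Qidem big1 ?addr0// => i ik; case: ifP => // _.
  by rewrite Qorth// eq_sym.
apply/funext => x; rewrite big_seq_cond big1// => i /andP[]; rewrite mem_index_iota => /= ine Pi.
rewrite Qorth//; apply: contraNneq kP => ->.
by rewrite ine.
Qed.

Lemma inner_Q k f h : l2 f -> l2 h -> inner (Q k f) h = inner f (Q k h).
Proof. exact: fop_adj (Qself k). Qed.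

Lemma inner_psum P f h n : l2 f -> l2 h ->
  inner (psum P f n) h = \sum_(0 <= k < n | P k) inner (Q k f) h.
Proof. by move=> lf lh; apply: inner_suml => // k; exact: lQ. Qed.

Lemma inner_QQ k f : l2 f -> inner (Q k f) f = (nsq (Q k f))%:C%C.
Proof.
move=> lf; rewrite -inner_self; last exact: lQ.
by rewrite -inner_Q//; [rewrite Qidem|exact: lQ].
Qed.

Lemma realc_sum (I : Type) (r : seq I) (S : pred I) (F : I -> R) :
  ((\sum_(i <- r | S i) F i)%:C)%C = \sum_(i <- r | S i) ((F i)%:C)%C :> C.
Proof.
elim: r => [|i r IH]; first by rewrite !big_nil.
by rewrite !big_cons; case: ifP => // _; rewrite realcD IH.
Qed.

Lemma conjc_sum (I : Type) (r : seq I) (S : pred I) (F : I -> C) :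
  conjc (\sum_(i <- r | S i) F i) = \sum_(i <- r | S i) conjc (F i).
Proof. exact: rmorph_sum. Qed.

Lemma nsq_range n m f : l2 f -> (n <= m)%N -> forall P,
  nsq (fun x => psum P f m x - psum P f n x) = \sum_(n <= k < m | P k) nsq (Q k f).
Proof.
move=> lf nm P.
have -> : (fun x => psum P f m x - psum P f n x) = fun x => \sum_(n <= k < m | P k) Q k f x.
  by apply/funext => x; rewrite /psum (big_cat_nat (leq0n n) nm)//= addrAC subrr add0r.
set g := fun x => _; have lg : l2 g by apply: l2_sum => k; exact: lQ.
apply: realc_inj; rewrite -inner_self// {1}/g inner_suml//; last by move=> k; exact: lQ.
rewrite realc_sum big_seq_cond [RHS]big_seq_cond; apply: eq_bigr => k /andP[kr Pk].
have Qg : Q k g = Q k f.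
  rewrite /g (gop_sumr _ _ _ (Qself k)); apply/funext => x.
  rewrite big_mkcond (bigD1_seq k) ?iota_uniq//= Pk Qidem big1 ?addr0// => i ik.
  by case: ifP => // _; rewrite Qorth// eq_sym.
by rewrite inner_Q// Qg -inner_QQ// inner_Q.
Qed.

Lemma nsq_psum_split f n : l2 f -> nsq f =
  \sum_(0 <= k < n) nsq (Q k f) + nsq (fun x => f x - psum predT f n x).
Proof.
move=> lf; have lp := l2_psum predT n lf; have lr := l2B lf lp.
have e : f = fun x => psum predT f n x + (f x - psum predT f n x).
  by apply/funext => x; rewrite addrC subrK.
rewrite {1}e nsqD_orth//; last first.
  rewrite inner_psum// big_seq big1// => k; rewrite mem_index_iota => /= kn.
  rewrite inner_Q// (gopB _ _ (Qself k)) Q_psum kn /=.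
  rewrite (_ : (fun x => _) = fun=> 0) ?inner0r//.
  by apply/funext => x; rewrite subrr.
have := nsq_range lf (leq0n n) predT => <-.
congr (nsq _ + _); apply/funext => x.
by rewrite /psum [X in _ - X]big_geq// subr0.
Qed.

Lemma bessel f n : l2 f -> \sum_(0 <= k < n) nsq (Q k f) <= nsq f.
Proof.
move=> lf; rewrite (nsq_psum_split n lf) lerDl nsq_ge0//.
by apply: l2B => //; exact: l2_psum.
Qed.

Lemma psum_cvg P f : l2 f -> exists h, l2cvg (psum P f) h.
Proof.
move=> lf.
have [|n|l [cl _ le_l]] := @nn_series R (fun k => nsq (Q k f)) (nsq f).
- by move=> k; apply: nsq_ge0; exact: lQ.
- exact: bessel.
apply: (@l2_complete _ _ _ (fun n => l - \sum_(0 <= k < n) nsq (Q k f))).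
- by move=> n; exact: l2_psum.
- by rewrite -[X in _ --> X](subrr l); apply: cvgB => //; exact: cvg_cst.
move=> n m nm; rewrite nsq_range//; apply: (@le_trans _ _ (\sum_(n <= k < m) nsq (Q k f))).
  rewrite big_mkcond; apply: ler_sum => k _; case: ifP => // _.
  by apply: nsq_ge0; exact: lQ.
rewrite lerBrDl; apply: le_trans (le_l m).
by rewrite (big_cat_nat (leq0n n) nm).
Qed.

(** The projection onto the closed sum of the ranges indexed by [P]. *)
Definition projsum P f : G -> C := xget (fun=> 0) [set h | l2cvg (psum P f) h].

Lemma projsum_cvg P f : l2 f -> l2cvg (psum P f) (projsum P f).
Proof. by move=> lf; have [h hP] := psum_cvg P lf; exact: (xgetI (fun=> 0) hP). Qed.

Lemma projsum_eq P f h : l2 f -> l2cvg (psum P f) h -> projsum P f = h.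
Proof. by move=> lf; apply: l2cvg_unique; exact: projsum_cvg. Qed.

Lemma l2_projsum P f : l2 f -> l2 (projsum P f).
Proof. by move=> /(projsum_cvg P)[]. Qed.

Lemma projsum_lin P c f h : l2 f -> l2 h ->
  projsum P (fun x => c * f x + h x) = fun x => c * projsum P f x + projsum P h x.
Proof.
move=> lf lh; apply: projsum_eq; first by apply: l2D => //; exact: l2Z.
apply: eq_l2cvg (l2cvg_lin c (projsum_cvg P lf) (projsum_cvg P lh)) => n x.
rewrite /psum mulr_sumr -big_split /=; apply: eq_bigr => k _.
by rewrite (gop_lin _ _ _ (Qself k)).
Qed.

Lemma near_l2cvg (s : nat -> G -> C) h N : (forall n, l2 (s n)) ->
  (forall n, (N <= n)%N -> s n = h) -> l2cvg s h.
Proof.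
move=> ls sh; have lh : l2 h by rewrite -(sh N).
split => //; apply: (cvg_near_cst); exists N => // n /= Nn.
rewrite sh//; apply/eqP; rewrite -(@nsq0 R G); apply/eqP; congr nsq.
by apply/funext => x; rewrite subrr.
Qed.

Lemma Q_projsum P f k : l2 f -> Q k (projsum P f) = if P k then Q k f else fun=> 0.
Proof.
move=> lf; apply: (l2cvg_unique (l2cvg_op (Qself k) (projsum_cvg P lf))).
apply: (@near_l2cvg _ _ k.+1) => [n|n kn]; first by apply: lQ; exact: l2_psum.
by rewrite Q_psum kn.
Qed.

Lemma projsum_comp P P' f : l2 f ->
  projsum P (projsum P' f) = projsum (predI P P') f.
Proof.
move=> lf; apply: projsum_eq; first exact: l2_projsum.
apply: eq_l2cvg (projsum_cvg (predI P P') lf) => n x.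
rewrite /psum big_mkcondr; apply: eq_bigr => k _.
by rewrite Q_projsum//; case: ifP.
Qed.

Lemma projsumD P P' f : l2 f -> (forall k, ~~ (P k && P' k)) ->
  projsum (predU P P') f = fun x => projsum P f x + projsum P' f x.
Proof.
move=> lf PP'; apply: projsum_eq => //.
rewrite (_ : (fun x => _) = fun x => 1 * projsum P f x + projsum P' f x); last first.
  by apply/funext => x; rewrite mul1r.
apply: eq_l2cvg (l2cvg_lin 1 (projsum_cvg P lf) (projsum_cvg P' lf)) => n x.
rewrite mul1r /psum big_mkcond [X in _ + X]big_mkcond [RHS]big_mkcond -big_split.
apply: eq_bigr => k _ /=; have := PP' k.
by case: (P k); case: (P' k); rewrite //= ?addr0 ?add0r.
Qed.

Lemma projsum_adj P f h : l2 f -> l2 h ->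
  inner (projsum P f) h = inner f (projsum P h).
Proof.
move=> lf lh; apply: (ccvg_unique (l2cvg_inner (projsum_cvg P lf) lh)).
have := l2cvg_inner (projsum_cvg P lh) lf.
rewrite /ccvg (inner_conj lf (l2_projsum P lh)); apply: squeeze0 => n.
  exact: sqr_ge0.
rewrite (_ : inner (psum P f n) h = conjc (inner (psum P h n) f)).
  by rewrite -(normc_conjc (conjc _ - _)) conjcB conjcK.
rewrite -inner_conj//; last exact: l2_psum.
rewrite inner_psum// (inner_conj (l2_psum P n lh) lf) inner_psum// conjc_sum.
by apply: eq_bigr => k _; rewrite inner_Q// (inner_conj (lQ k lh) lf).
Qed.

Lemma nsq_Q_zeta k (g : G) : nsq (Q k (zeta g)) = Re (tr (Q k)).
Proof.
have -> : tr (Q k) = (nsq (Q k (zeta g)))%:C%C; last by [].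
rewrite -inner_QQ; last exact: l2_zeta.
by rewrite inner_zeta (gop_zeta _ (Qself k)) mulgV.
Qed.

(** Completeness: the trace condition says that the partial sums exhaust the
    vector at the identity, hence, by right translation, every basis vector. *)
Lemma projsum_zeta (g : G) : l2cvg (psum predT (zeta g)) (zeta g).
Proof.
have lz := @l2_zeta R G; split => [n||//]; first exact: l2_psum.
  exact: lz.
rewrite (_ : (fun n => _) = fun n => 1 - \sum_(0 <= k < n) Re (tr (Q k))).
  by rewrite -[X in _ --> X](subrr 1); apply: cvgB => //; exact: cvg_cst.
apply/funext => n; rewrite -(@nsq_zeta R G g) (nsq_psum_split n (lz g)).
rewrite (eq_bigr (fun k => Re (tr (Q k)))); last by move=> k _; rewrite nsq_Q_zeta.
by rewrite addrAC subrr add0r.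
Qed.

Lemma projsumT f : l2 f -> projsum predT f = f.
Proof.
move=> lf; apply/funext => x.
rewrite -(inner_zeta (projsum _ _)) projsum_adj//; last exact: l2_zeta.
by rewrite (projsum_eq (l2_zeta x) (projsum_zeta x)) inner_zeta.
Qed.

Lemma inner_projsum_cvg P f : l2 f ->
  (fun n => \sum_(0 <= k < n | P k) nsq (Q k f)) @ \oo --> Re (inner (projsum P f) f).
Proof.
move=> lf; have := ccvg_Re (l2cvg_inner (projsum_cvg P lf) lf).
suff -> : (fun n => Re (inner (psum P f n) f)) =
    (fun n => \sum_(0 <= k < n | P k) nsq (Q k f)) by [].
apply/funext => n; rewrite inner_psum//.
rewrite (eq_bigr (fun k => ((nsq (Q k f))%:C)%C)); last by move=> k _; rewrite inner_QQ.
by rewrite -realc_sum.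
Qed.

Lemma nsq_projsum P f : l2 f -> nsq (projsum P f) = Re (inner (projsum P f) f).
Proof.
move=> lf; have lp := l2_projsum P lf.
rewrite -{2}(_ : projsum P (projsum P f) = projsum P f); last first.
  rewrite projsum_comp//; congr (projsum _ f); apply/funext => k /=.
  by rewrite andbb.
by rewrite projsum_adj// inner_self.
Qed.

Variables (lam : nat -> R) (L : R).
Hypothesis lamL : forall k, `|lam k| <= L.
Local Notation borelR := (measurableTypeR R).

Definition spec_proj (B : set borelR) : op := projsum (fun k => (lam k : borelR) \in B).

Let lE B f : l2 f -> l2 (spec_proj B f). Proof. exact: l2_projsum. Qed.

Let nsq_ge0' k f : 0 <= if asbool (l2 f) then nsq (Q k f) else 0.
Proof. by case: asboolP => // lf; apply: nsq_ge0; exact: gop_l2 (Qself k) lf. Qed.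

Let wt f k : {nonneg R} := NngNum (nsq_ge0' k f).

Let wtE f k : l2 f -> (wt f k)%:num = nsq (Q k f).
Proof. by move=> lf /=; rewrite asboolT. Qed.

Definition spec_measure f : {measure set borelR -> \bar R} := atoms (wt f) (lam : nat -> borelR).

Lemma spec_measureE B f : l2 f -> spec_measure f B = (Re (inner (spec_proj B f) f))%:E.
Proof.
move=> lf; rewrite /spec_measure atomsE; apply/cvg_lim => //.
apply: cvg_EFin; first by apply: nearW => n; rewrite sumEFin.
have := @inner_projsum_cvg (fun k => (lam k : borelR) \in B) f lf.
rewrite (_ : (fun n => \sum_(0 <= k < n | _) _) =
  fine \o (fun n => (\sum_(0 <= k < n) ((wt f k)%:num * ((lam k : borelR) \in B)%:R)%:E)%E)) //.
apply/funext => n; rewrite /= sumEFin /= big_mkcond; apply: eq_bigr => k _.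
by rewrite asboolT//; case: ifP; rewrite ?mulr1 ?mulr0.
Qed.

Lemma spec_projM A B f : l2 f -> spec_proj (A `&` B) f = spec_proj A (spec_proj B f).
Proof.
move=> lf; rewrite /spec_proj projsum_comp//; congr (projsum _ f).
by apply/funext => k; rewrite in_setI.
Qed.

Lemma spec_projT f : l2 f -> spec_proj setT f = f.
Proof.
move=> lf; rewrite -[RHS](projsumT lf).
by congr (projsum _ f); apply/funext => k; rewrite in_setT.
Qed.

Lemma spec_projU A B f : l2 f -> A `&` B = set0 ->
  spec_proj (A `|` B) f = fun x => spec_proj A f x + spec_proj B f x.
Proof.
move=> lf AB; rewrite -projsumD//.
  by congr (projsum _ f); apply/funext => k; rewrite in_setU.
by move=> k; rewrite -in_setI AB in_set0.
Qed.

Lemma spec_proj0 f : l2 f -> spec_proj set0 f = fun=> 0.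
Proof.
move=> lf; apply: projsum_eq => //; apply: (@near_l2cvg _ _ 0%N) => n.
  exact: l2_psum.
move=> _; apply/funext => x; rewrite /psum big_pred0// => k.
by rewrite in_set0.
Qed.

(** Countable additivity in the strong topology reduces to the continuity from
    above of the scalar measures, because [|E(F) f|^2 = <E(F) f, f>]. *)
Lemma spec_pvm : projection_valued_measure spec_proj.
Proof.
split.
- move=> B _; split.
  + by move=> f; exact: lE.
  + by move=> a f h lf lh; exact: projsum_lin.
  + by move=> f lf; rewrite -spec_projM// setIid.
  + by move=> f h lf lh; exact: projsum_adj.
- exact: spec_projT.
- by move=> A B f _ _; exact: spec_projM.
move=> B f mB tB lf.
have fsum n : (fun x => \sum_(i < n) spec_proj (B i) f x) =
    spec_proj (\bigcup_(i < n) B i) f.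
  elim: n => [|n IH].
    by rewrite bigcup_mkord big_ord0 spec_proj0//; apply/funext => x; rewrite big_ord0.
  rewrite bigcup_mkord big_ord_recr /= -bigcup_mkord spec_projU//.
    by rewrite -IH; apply/funext => x; rewrite big_ord_recr.
  rewrite setI_bigcupl; apply: bigcup0 => i /= ni.
  by move/trivIsetP : tB => /(_ i n Logic.I Logic.I); apply; rewrite neq_ltn ni.
have split n : (fun x => spec_proj (\bigcup_i B i) f x - \sum_(i < n) spec_proj (B i) f x) =
    spec_proj (\bigcup_i B i `\` \bigcup_(i < n) B i) f.
  have -> : spec_proj (\bigcup_i B i) f = fun x => spec_proj (\bigcup_(i < n) B i) f x +
      spec_proj (\bigcup_i B i `\` \bigcup_(i < n) B i) f x.
    rewrite -spec_projU//; last exact: setDIK.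
    congr (spec_proj _ f); rewrite setDUK//.
    by apply: bigcup_sub => i _; exact: bigcup_sup.
  apply/funext => x; rewrite -(congr1 (@^~ x) (fsum n)) addrAC subrr add0r//.
have mU : measurable (\bigcup_i B i) by exact: bigcup_measurable.
have mUn n : measurable (\bigcup_(i < n) B i) by exact: bigcup_measurable.
pose F n := \bigcup_i B i `\` \bigcup_(i < n) B i.
have mF n : measurable (F n) by exact: measurableD.
rewrite (_ : (fun n => _) = fun n => spec_measure f (F n)); last first.
  apply/funext => n; rewrite split nsqE; last exact: lE.
  by rewrite nsq_projsum// spec_measureE.
rewrite -(measure0 (spec_measure f)) (_ : set0 = \bigcap_n F n).
  apply: nonincreasing_cvg_mu => //.
  - by rewrite spec_measureE// ltry.
  - exact: bigcap_measurable.
  - move=> n m nm; apply/subsetPset => x [Ux Unx]; split => // -[i /= ni Bx].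
    by apply: Unx; exists i => //=; exact: leq_trans nm.
apply/esym; rewrite -subset0 => x Fx; have [[i _ Bx] _] := Fx 0%N Logic.I.
by have [_] := Fx i.+1 Logic.I; apply; exists i => /=.
Qed.

Lemma spec_integral f : l2 f ->
  (spec_measure f).-integrable setT (fun t : borelR => (t : R)%:E) /\
  (fun n => \sum_(0 <= k < n) nsq (Q k f) * lam k) @ \oo --> \int[spec_measure f]_t (t : R).
Proof.
move=> lf; have bw n : \sum_(0 <= k < n) (wt f k)%:num <= nsq f.
  rewrite (eq_bigr (fun k => nsq (Q k f))); first exact: bessel.
  by move=> k _; rewrite wtE.
have [i cv] := @atoms_integral R (wt f) (lam : nat -> borelR) (nsq f) L lamL bw.
split=> //; suff -> : (fun n => \sum_(0 <= k < n) nsq (Q k f) * lam k) =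
  (fun n => \sum_(0 <= k < n) (wt f k)%:num * (lam k : R)) by [].
by apply/funext => n; apply: eq_bigr => k _; rewrite wtE.
Qed.

Lemma spec_measure_ge k B : (lam k : borelR) \in B ->
  ((Re (tr (Q k)))%:E <= spec_measure (zeta 1%g) B)%E.
Proof.
move=> kB; have lz := @l2_zeta R G 1%g.
rewrite spec_measureE// lee_fin -(nsq_Q_zeta k 1%g).
have cv := @inner_projsum_cvg (fun k => (lam k : borelR) \in B) _ lz.
rewrite -(cvg_lim _ cv)//; apply: limr_ge; first exact: cvgP cv.
exists k.+1 => // n /= kn.
rewrite big_mkcond (bigD1_seq k) ?iota_uniq ?mem_index_iota//= kB lerDl.
apply: sumr_ge0 => i _; case: ifP => // _.
by apply: nsq_ge0; exact: lQ.
Qed.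

Variables (T T' : op).
Hypothesis TT : fop T T'.
Hypothesis TQ : forall k f, l2 f -> T (Q k f) = fun x => (lam k)%:C%C * Q k f x.

Lemma spec_operator f : l2 f -> inner (T f) f = (\int[spec_measure f]_t (t : R))%:C%C.
Proof.
move=> lf; have [_ cv] := spec_integral lf.
have := l2cvg_inner (l2cvg_op TT (projsum_cvg predT lf)) lf.
rewrite projsumT// => cv1; apply: (ccvg_unique cv1).
rewrite (_ : (fun n => _) = fun n => (\sum_(0 <= k < n) nsq (Q k f) * lam k)%:C%C).
  by apply: (@ReIm_ccvg R _ _ 0) => //=; exact: cvg_cst.
apply/funext => n; rewrite /psum (gop_sumr _ _ _ TT) inner_suml//; last first.
  by move=> k; exact: (gop_l2 TT (lQ k lf)).
rewrite realc_sum; apply: eq_bigr => k _.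
rewrite TQ// innerZl//; last exact: lQ.
by rewrite inner_QQ// realcM mulrC.
Qed.

End OrthogonalSeries.

(** * Integral operators come from the group ring *)

Section IntegralOperators.
Context {R : realType} {G : groupType}.
Local Notation C := R[i].
Local Notation op := ((G -> C) -> (G -> C)).
Implicit Types (f h : G -> C) (T : {malg int[G]}).

Definition intcoef (c : C) := exists n : int, c = n%:~R.

Lemma conjc_int (n : int) : conjc (n%:~R : C) = n%:~R.
Proof. exact: rmorph_int. Qed.

Lemma lactEw T (d : {fset G}) f x : (msupp T `<=` d)%fset ->
  lact T f x = \sum_(g <- d) (T@_g)%:~R * f (g^-1 * x)%g.
Proof.
move=> Td; rewrite /lact; apply: (big_fset_incl _ Td) => g _ gT.
by rewrite mcoeff_outdom// mul0r.
Qed.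

Lemma lactD T T' f x : lact (T + T') f x = lact T f x + lact T' f x.
Proof.
rewrite (lactEw _ _ (msuppD_le T T')) (@lactEw T (msupp T `|` msupp T')%fset) ?fsubsetUl//.
rewrite (@lactEw T' (msupp T `|` msupp T')%fset) ?fsubsetUr// -big_split.
by apply: eq_bigr => g _ /=; rewrite mcoeffD rmorphD mulrDl.
Qed.

Lemma lactU (n : int) g f x : lact << n *g g >> f x = n%:~R * lshift g f x.
Proof. by rewrite (lactEw _ _ msuppU_le) big_seq_fset1 mcoeffUU. Qed.

Lemma lact0 f x : lact 0 f x = 0 :> C.
Proof. by rewrite /lact msupp0 big_seq_fset0. Qed.

Lemma mcoeff_star T k : (star T)@_k = T@_(k^-1)%g.
Proof.
rewrite {2}[T]monalgE /star !raddf_sum; apply: eq_bigr => g _ /=.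
by rewrite !mcoeffU eqg_invLR.
Qed.

Lemma starD T T' : star (T + T') = star T + star T'.
Proof. by apply/malgP => k; rewrite mcoeffD !mcoeff_star mcoeffD. Qed.

Lemma starU (n : int) (g : G) : star << n *g g >> = << n *g (g^-1)%g >>.
Proof. by apply/malgP => k; rewrite mcoeff_star !mcoeffU eqg_invLR. Qed.

Lemma star0 : star 0 = 0 :> {malg int[G]}.
Proof. by apply/malgP => k; rewrite mcoeff_star !mcoeff0. Qed.

(** The image of the vector of the identity displays the coefficients. *)
Lemma lact_inj T T' : (forall f x, lact T f x = lact T' f x :> C) -> T = T'.
Proof.
have coef (S : {malg int[G]}) k : lact S (zeta 1%g) k = (S@_k)%:~R :> C.
  rewrite (@lactEw S (k |` msupp S)%fset) ?fsubsetUr//.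
  rewrite (big_fsetD1 k) ?fset1U1//= /zeta mulVg eqxx mulr1 big_seq big1 ?addr0// => g.
  rewrite !inE => /andP[gk _]; rewrite mulg_eq1 (inj_eq invg_inj) (negbTE gk) mulr0//.
move=> TT; apply/malgP => k; apply/eqP; have := TT (zeta 1%g) k.
by rewrite !coef => /eqP; rewrite eqr_int.
Qed.

Lemma gop_int_list U V : gop intcoef U V -> exists s : seq (int * G),
  (forall f x, U f x = \sum_(p <- s) (p.1)%:~R * lshift p.2 f x) /\
  (forall f x, V f x = \sum_(p <- s) (p.1)%:~R * lshift (p.2)^-1 f x).
Proof.
elim=> [g|_ A B [n ->] _ [s [sA sB]]|A B A' B' _ [s [sA sB]] _ [s' [sA' sB']]
       |A B A' B' _ [s [sA sB]] _ [s' [sA' sB']]].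
- by exists [:: (1, g)]; split=> f x; rewrite big_seq1 mul1r.
- exists [seq (n * p.1, p.2) | p <- s]; split=> f x; rewrite big_map ?sA ?sB ?conjc_int mulr_sumr;
    by apply: eq_bigr => p _; rewrite /= intrM mulrA.
- by exists (s ++ s'); split=> f x; rewrite big_cat /= ?sA ?sA' ?sB ?sB'.
exists [seq (p.1 * p'.1, (p.2 * p'.2)%g) | p <- s, p' <- s']; split=> f x.
  rewrite big_allpairs_dep sA; apply: eq_bigr => p _.
  rewrite {1}/lshift sA' mulr_sumr; apply: eq_bigr => p' _.
  by rewrite /= intrM mulrA -lshiftE.
rewrite big_allpairs_dep exchange_big sB'; apply: eq_bigr => p' _.
rewrite {1}/lshift sB mulr_sumr; apply: eq_bigr => p _.
by rewrite /= intrM [in RHS](mulrC p.1%:~R) mulrA invgM -lshiftE.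
Qed.

Lemma gop_int_malg U V : gop intcoef U V ->
  exists T : {malg int[G]}, lact T = U /\ lact (star T) = V.
Proof.
move=> /gop_int_list[s [sU sV]]; exists (\sum_(p <- s) << p.1 *g p.2 >>).
split; apply/funext => f; apply/funext => x; rewrite ?sU ?sV.
  by elim: s {sU sV} => [|p s IH]; rewrite ?big_nil ?lact0// !big_cons lactD lactU IH.
elim: s {sU sV} => [|p s IH]; rewrite ?big_nil ?star0 ?lact0//.
by rewrite !big_cons starD lactD starU lactU IH.
Qed.

Lemma gop_int_selfadj U : gop intcoef U U ->
  exists T : {malg int[G]}, lact T = U /\ self_adjoint T.
Proof.
move=> /gop_int_malg[T [TU TU']]; exists T; split => //.
by apply: lact_inj => f x; rewrite TU TU'.
Qed.

End IntegralOperators.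

(** * Positive matrices *)

Section LinearAlgebra.
Local Open Scope sesquilinear_scope.
Context {C : numClosedFieldType} {n : nat}.
Implicit Types (A M : 'M[C]_n).

Lemma trmxC_mul m p r (A : 'M[C]_(m, r)) (B : 'M[C]_(r, p)) : (A *m B)^t* = B^t* *m A^t*.
Proof. by rewrite trmx_mul map_mxM. Qed.

Lemma tr_trmxC_mul m p (B : 'M[C]_(m, p)) :
  \tr (B^t* *m B) = \sum_(j < p) \sum_(i < m) `|B i j| ^+ 2.
Proof.
apply: eq_bigr => j _; rewrite mxE; apply: eq_bigr => i _.
by rewrite !mxE mulrC -normCK.
Qed.

Lemma tr_trmxC_ge0 m p (B : 'M[C]_(m, p)) : 0 <= \tr (B^t* *m B).
Proof. by rewrite tr_trmxC_mul; do 2 apply: sumr_ge0 => ? _; rewrite exprn_ge0. Qed.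

Lemma tr_trmxC_eq0 m p (B : 'M[C]_(m, p)) : \tr (B^t* *m B) = 0 -> B = 0.
Proof.
rewrite tr_trmxC_mul => /eqP; rewrite psumr_eq0; last first.
  by move=> j _; apply: sumr_ge0 => i _; rewrite exprn_ge0.
move=> /allP B0; apply/matrixP => i j; rewrite mxE; apply/eqP.
have /= := B0 j (mem_index_enum j); rewrite psumr_eq0; last first.
  by move=> k _; rewrite exprn_ge0.
by move=> /allP /(_ i (mem_index_enum i)) /=; rewrite sqrf_eq0 normr_eq0.
Qed.

(** The spectral theorem in the form of projections of rank one, for which no
    eigenvector has to be chosen when they are transported to operators. *)
Record eigenprojections M (E : 'I_n -> 'M[C]_n) (l : 'I_n -> C) : Prop := {
  ep_mul : forall j k, E j *m E k = if j == k then E j else 0;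
  ep_adj : forall j, (E j)^t* = E j;
  ep_sum : \sum_j E j = 1%:M;
  ep_eig : forall j, M *m E j = l j *: E j;
  ep_tr : forall j, \tr (E j) = 1
}.

Lemma hermitian_eigenprojections A : exists E l, eigenprojections (A^t* *m A) E l.
Proof.
set M := A^t* *m A.
have MM : M^t* = M by rewrite /M trmxC_mul trmxCK.
have /orthomx_spectralP MP : M \is normalmx by apply/normalmxP; rewrite MM.
set P := spectralmx M in MP; set D := spectral_diag M in MP.
have uP : P \is unitarymx := spectral_unitarymx M.
have PP : P *m P^t* = 1%:M by exact/unitarymxP.
have PP' : P^t* *m P = 1%:M by rewrite -(invmx_unitary uP) mulVmx// unitarymx_unit.
rewrite invmx_unitary// in MP.
have DD j k : delta_mx j j *m delta_mx k k = if j == k then delta_mx j j else 0 :> 'M[C]_n.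
  by case: eqVneq => [->|jk]; rewrite ?mul_delta_mx// mul_delta_mx_0.
exists (fun j => P^t* *m delta_mx j j *m P), (fun j => D 0 j); split.
- move=> j k; rewrite -!mulmxA (mulmxA P) PP mul1mx (mulmxA (delta_mx _ _)) DD.
  by case: ifP; rewrite ?mul0mx ?mulmx0.
- move=> j; rewrite !trmxC_mul trmxCK mulmxA; congr (_ *m _ *m _).
  by apply/matrixP => x y; rewrite !mxE andbC rmorph_nat.
- rewrite -mulmx_suml -mulmx_sumr (_ : \sum_j delta_mx j j = 1%:M) ?mulmx1//.
  apply/matrixP => x y; rewrite summxE (bigD1 x)//= !mxE eqxx /= big1 ?addr0.
    by rewrite eq_sym.
  by move=> i /negbTE ix; rewrite mxE eq_sym ix.
- move=> j; rewrite MP -!mulmxA (mulmxA P) PP mul1mx scalemxAr scalemxAl.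
  congr (_ *m _); rewrite mulmxA; congr (_ *m _).
  by apply/matrixP => x y; rewrite mul_diag_mx !mxE; case: eqVneq => [->|]; rewrite ?mulr0.
- move=> j; rewrite -mulmxA mxtrace_mulC -mulmxA PP mulmx1.
  rewrite /mxtrace (bigD1 j)//= mxE !eqxx big1 ?addr0// => i /negbTE ij.
  by rewrite mxE ij.
Qed.

Lemma eigenprojections_gt0 A E l : \det A != 0 -> eigenprojections (A^t* *m A) E l ->
  forall j, 0 < l j.
Proof.
move=> dA [Emul Eadj _ Eeig Etr] j.
have key : \tr ((A *m E j)^t* *m (A *m E j)) = l j.
  by rewrite trmxC_mul Eadj -mulmxA (mulmxA (A^t*)) Eeig -scalemxAr Emul eqxx mxtraceZ Etr mulr1.
rewrite lt_neqAle eq_sym -key tr_trmxC_ge0 andbT; apply/eqP => /tr_trmxC_eq0 AE0.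
have uA : A \in unitmx by rewrite unitmxE unitfE.
have E0 : E j = 0 by rewrite -[E j](mulKmx uA) AE0 mulmx0.
by have := Etr j; rewrite E0 mxtrace0 => /eqP; rewrite eq_sym oner_eq0.
Qed.

(** The Rayleigh quotient of [v] is an average of the eigenvalues, with weights
    [|E j v|^2]. *)
Lemma small_eigenvalue A E l (c : C) (v : 'cV[C]_n) : eigenprojections (A^t* *m A) E l ->
  (forall j, 0 <= l j) -> 0 <= c -> v != 0 ->
  \tr ((A *m v)^t* *m (A *m v)) <= c * \tr (v^t* *m v) -> exists j, l j <= c.
Proof.
move=> [Emul Eadj Esum Eeig Etr] l0 c0 v0 Av.
have EE j : \tr ((E j *m v)^t* *m (E j *m v)) = \tr (v^t* *m E j *m v).
  by rewrite trmxC_mul Eadj -mulmxA (mulmxA (E j)) Emul eqxx mulmxA.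
have v1 : v = \sum_j E j *m v by rewrite -mulmx_suml Esum mul1mx.
have vE : \tr (v^t* *m v) = \sum_j \tr ((E j *m v)^t* *m (E j *m v)).
  rewrite {2}v1 mulmx_sumr raddf_sum.
  by apply: eq_bigr => j _; rewrite EE mulmxA.
have AvE : \tr ((A *m v)^t* *m (A *m v)) = \sum_j l j * \tr ((E j *m v)^t* *m (E j *m v)).
  rewrite trmxC_mul -mulmxA (mulmxA (A^t*)) {2}v1.
  rewrite !mulmx_sumr raddf_sum; apply: eq_bigr => j _.
  by rewrite EE (mulmxA _ (E j)) Eeig -scalemxAl -scalemxAr mulmxA [LHS]mxtraceZ.
case: (pickP (fun j => l j <= c)) => [j ljc|Nl]; first by exists j.
exfalso; move: Av; rewrite AvE vE mulr_sumr -subr_ge0 -sumrB => S0.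
have ge0 j : 0 <= (l j - c) * \tr ((E j *m v)^t* *m (E j *m v)).
  apply: mulr_ge0 (tr_trmxC_ge0 _); rewrite subr_ge0 ltW// real_ltNge ?ger0_real//.
  by rewrite Nl.
have Z : \sum_j (l j - c) * \tr ((E j *m v)^t* *m (E j *m v)) = 0.
  apply/eqP; rewrite eq_le sumr_ge0// andbT -oppr_ge0 -sumrN.
  by move: S0; congr (0 <= _); apply: eq_bigr => j _; rewrite mulrBl opprB.
move/eqP : Z; rewrite psumr_eq0// => /allP Z.
case/negP: v0; apply/eqP; apply: tr_trmxC_eq0; rewrite vE big1// => j _.
have /= := Z j (mem_index_enum j); rewrite mulf_eq0 => /orP[|/eqP//].
by rewrite subr_eq0 => /eqP ljc; have := Nl j; rewrite ljc lexx.
Qed.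

End LinearAlgebra.

(** * Block systems of matrix units *)

Lemma le_of_sqr_le {R : realType} (x K : R) : 0 <= K -> x ^+ 2 <= K -> x <= 1 + K.
Proof. by move=> K0 xK; rewrite leNgt; apply/negP => h; nra. Qed.

Lemma sum_sub_seq {R : realType} (t : nat -> R) (s : seq nat) n : (forall k, 0 <= t k) -> uniq s ->
  all (fun k => (k < n)%N) s -> \sum_(k <- s) t k <= \sum_(0 <= k < n) t k.
Proof.
move=> t0 us sn; rewrite [leRHS](bigID (mem s))/= -[X in _ <= X + _]big_filter.
have ps : perm_eq [seq i <- index_iota 0 n | i \in s] s.
  apply: uniq_perm => // [|k]; first by rewrite filter_uniq ?iota_uniq.
  rewrite mem_filter mem_index_iota /=; case ks: (k \in s) => //=.
  by have /allP/(_ _ ks) := sn.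
by rewrite (perm_big _ ps) /= lerDl sumr_ge0.
Qed.

Section MatrixUnits.
Local Open Scope sesquilinear_scope.
Context {R : realType} {G : groupType}.
Local Notation C := R[i].
Local Notation Re := (@complex.Re R).
Local Notation op := ((G -> C) -> (G -> C)).
Implicit Types (f h : G -> C) (d : nat).

Variables (N : nat -> nat) (u : forall d, 'I_(N d) -> 'I_(N d) -> op) (w : nat -> R).
Hypothesis u_adj : forall d i j, fop (u i j : op) (@u d j i).
Hypothesis u_mul : forall d i j k l f,
  u i j (@u d k l f) = if j == k then u i l f else fun=> 0.
Hypothesis u_orth : forall d d' i j k l f, d != d' ->
  @u d i j (@u d' k l f) = fun=> 0.
Hypothesis u_tr : forall d i, tr (@u d i i) = (w d)%:C%C.
Hypothesis u_total : (fun n => \sum_(0 <= d < n) (N d)%:R * w d) @ \oo --> (1 : R).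

(** The representation of the matrix algebra given by the matrix units. *)
Definition mop d (a : 'M[C]_(N d)) : op :=
  fun f x => \sum_i \sum_j a i j * u i j f x.

Lemma mop_adj d (a : 'M[C]_(N d)) : fop (mop a) (mop (a^t*)).
Proof.
apply: (@eq_gop _ _ _ (fun f x => \sum_i \sum_j a i j * u i j f x)
  (fun f x => \sum_i \sum_j conjc (a i j) * u j i f x)) => //.
  move=> f x; rewrite exchange_big; apply: eq_bigr => j _; apply: eq_bigr => i _.
  by rewrite !mxE.
apply: (@gop_sum _ _ _ _ _ _ (fun i f x => \sum_j a i j * u i j f x)
  (fun i f x => \sum_j conjc (a i j) * u j i f x)) => // i.
apply: (@gop_sum _ _ _ _ _ _ (fun j f x => a i j * u i j f x)
  (fun j f x => conjc (a i j) * u j i f x)) => // j.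
exact: (@gop_scale _ _ _ (a i j) _ _ Logic.I (u_adj i j)).
Qed.

Lemma mop_mul d (a b : 'M[C]_(N d)) f : mop a (mop b f) = mop (a *m b) f.
Proof.
apply/funext => x; rewrite /mop.
have e i j : u i j (mop b f) = fun x => \sum_l b j l * u i l f x.
  rewrite /mop (gop_sumr _ _ _ (u_adj i j)); apply/funext => y.
  rewrite (bigD1 j)//= (gop_sumr _ _ _ (u_adj i j)) [X in _ + X]big1 ?addr0.
    apply: eq_bigr => l _; rewrite (gopZ _ _ (u_adj i j)).
    by rewrite u_mul eqxx.
  move=> k kj; rewrite (gop_sumr _ _ _ (u_adj i j)) big1// => l _.
  by rewrite (gopZ _ _ (u_adj i j)) u_mul eq_sym (negbTE kj) mulr0.
apply: eq_bigr => i _; under eq_bigr do rewrite (e i) mulr_sumr.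
rewrite exchange_big; apply: eq_bigr => l _; rewrite mxE mulr_suml.
by apply: eq_bigr => j _; rewrite mulrA.
Qed.

Lemma mop_orth d d' (a : 'M[C]_(N d)) (b : 'M[C]_(N d')) f : d != d' ->
  mop a (mop b f) = fun=> 0.
Proof.
move=> dd'; apply/funext => x; rewrite /mop big1// => i _; rewrite big1// => j _.
rewrite (gop_sumr _ _ _ (u_adj i j)) big1 ?mulr0// => k _.
rewrite (gop_sumr _ _ _ (u_adj i j)) big1// => l _.
by rewrite (gopZ _ _ (u_adj i j)) u_orth// mulr0.
Qed.

Lemma tr_u d (i j : 'I_(N d)) : tr (u i j) = if i == j then (w d)%:C%C else 0.
Proof.
case: eqVneq => [->|ij]; first exact: u_tr.
transitivity (tr (fun f => u i i (u i j f))).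
  by rewrite /tr u_mul eqxx.
rewrite (trC (u_adj i i) (u_adj i j)) /tr u_mul eq_sym (negbTE ij)//.
Qed.

Lemma tr_mop d (a : 'M[C]_(N d)) : tr (mop a) = \tr a * (w d)%:C%C.
Proof.
rewrite /tr /mop /mxtrace mulr_suml; apply: eq_bigr => i _.
rewrite (bigD1 i)//= -/(tr (u i i)) tr_u eqxx big1 ?addr0// => j ji.
by rewrite -/(tr (u i j)) tr_u eq_sym (negbTE ji) mulr0.
Qed.

Lemma mop_lin d (a b : 'M[C]_(N d)) c f x : mop (c *: a + b) f x = c * mop a f x + mop b f x.
Proof.
rewrite /mop mulr_sumr -big_split; apply: eq_bigr => i _ /=.
rewrite mulr_sumr -big_split; apply: eq_bigr => j _ /=.
by rewrite !mxE mulrDl mulrA.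
Qed.

Lemma mop0 d f x : mop (0 : 'M[C]_(N d)) f x = 0.
Proof. by rewrite /mop big1// => i _; rewrite big1// => j _; rewrite mxE mul0r. Qed.

Lemma mopZ d (a : 'M[C]_(N d)) c f x : mop (c *: a) f x = c * mop a f x.
Proof. by rewrite -[c *: a]addr0 mop_lin mop0 addr0. Qed.

Let P d : op := mop (1%:M : 'M[C]_(N d)).

Let P_self d : fop (P d) (P d).
Proof. by have := mop_adj (1%:M : 'M[C]_(N d)); rewrite trmx1 map_mx1. Qed.

Let P_idem d f : P d (P d f) = P d f.
Proof. by rewrite /P mop_mul mulmx1. Qed.

Let P_orth d d' f : d != d' -> P d (P d' f) = fun=> 0.
Proof. exact: mop_orth. Qed.

Let P_total : (fun n => \sum_(0 <= d < n) Re (tr (P d))) @ \oo --> (1 : R).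
Proof.
suff -> : (fun n => \sum_(0 <= d < n) Re (tr (P d))) =
  (fun n => \sum_(0 <= d < n) (N d)%:R * w d) by [].
apply/funext => n; apply: eq_bigr => d _.
rewrite tr_mop mxtrace1 (_ : (N d)%:R = ((N d)%:R : R)%:C%C) -?realcM//.
by apply: complex_ext; elim: (N d) => // m IH; rewrite -!natr1 ?ReD ?ImD IH /= ?addr0.
Qed.

Variables (S S' : op) (A : forall d, 'M[C]_(N d)).
Hypothesis SS : fop S S'.
Hypothesis S_u : forall d i j f,
  S (@u d i j f) = fun x => \sum_k A d k i * u k j f x.

Lemma S_mop d (a : 'M[C]_(N d)) f : S (mop a f) = mop (A d *m a) f.
Proof.
rewrite /mop (gop_sumr _ _ _ SS); apply/funext => x.
under eq_bigr => i _.
  rewrite (gop_sumr _ _ _ SS); under eq_bigr => j _.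
    rewrite (gopZ _ _ SS) S_u mulr_sumr; over.
  rewrite exchange_big; over.
rewrite exchange_big; apply: eq_bigr => k _; rewrite exchange_big; apply: eq_bigr => j _.
by rewrite mxE mulr_suml; apply: eq_bigr => i _; rewrite mulrA (mulrC (a i j)).
Qed.

(** A block is invariant under [S], and so is the closed span of the other
    blocks, because the blocks exhaust the space. *)
Lemma block_reduces d f : l2 f -> P d (S f) = P d (S (P d f)).
Proof.
move=> lf; pose D : op := fun f x => P d (S f) x + (-1) * P d (S (P d f)) x.
have FD : fop D (fun f x => S' (P d f) x + conjc (-1) * P d (S' (P d f)) x).
  apply: gop_add; first exact: (gop_comp (P_self d) SS).
  apply: (@gop_scale _ _ _ (-1) (fun f => P d (S (P d f))) (fun f => P d (S' (P d f)))) => //.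
  exact: (gop_comp (P_self d) (gop_comp SS (P_self d))).
have D0 d' h : D (P d' h) = fun=> 0.
  apply/funext => x; rewrite /D; have [e|dd'] := eqVneq d d'.
    by rewrite -e P_idem mulN1r subrr.
  rewrite P_orth// (gop0 SS) (gop0 (P_self d)) mulr0 addr0.
  by rewrite /P S_mop mop_orth.
have cv := @projsum_cvg _ _ P P_self P_idem P_orth predT f lf.
rewrite (projsumT P_self P_idem P_orth P_total lf) in cv.
have D1 : D f = fun=> 0.
  apply: (l2cvg_unique (l2cvg_op FD cv)); apply: eq_l2cvg (l2cvg_cst (@l2_0 R G)) => n x.
  by rewrite /psum (gop_sumr _ _ _ FD) big1// => k _; rewrite D0.
apply/funext => x; apply/eqP; rewrite -subr_eq0 -mulN1r.
exact/eqP/(congr1 (@^~ x) D1).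
Qed.

(** The adjoint maps the range of a block into itself because [S] leaves the
    complement of this range invariant. *)
Lemma S'_mop d (a : 'M[C]_(N d)) f : l2 f -> S' (mop a f) = mop ((A d)^t* *m a) f.
Proof.
move=> lf; apply/funext => x; have lz := @l2_zeta R G x.
have lm (b : 'M[C]_(N d)) h : l2 h -> l2 (mop b h) by exact: gop_l2 (mop_adj b).
rewrite -(inner_zeta (S' (mop a f)) x) -(inner_zeta (mop ((A d)^t* *m a) f) x).
have lS : l2 (S (zeta x)) by exact: gop_l2 SS lz.
rewrite (fop_adj (fop_sym SS))//; last exact: lm.
rewrite -{1}(mul1mx a) -mop_mul (fop_adj (P_self d))//; last exact: lm.
rewrite block_reduces// /P S_mop mop_mul mul1mx mulmx1 -mop_mul.
by rewrite (fop_adj (fop_sym (mop_adj (A d))))//; exact: lm.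
Qed.

Hypothesis w_gt0 : forall d, 0 < w d.
Hypothesis A_inj : forall d, \det (A d) != 0.

(** The eigenprojections of all the blocks, transported by [mop], diagonalize
    [S' S].  Each has as its trace the weight of the block, so an eigenvalue in
    an interval gives this much mass to it, and Rayleigh quotients detect
    eigenvalues. *)
Theorem block_spectral_measure (T : {malg int[G]}) : lact T = (fun f => S' (S f)) ->
  exists mu : {measure set (measurableTypeR R) -> \bar R},
    is_spectral_measure T mu /\
    forall d (v : 'cV[C]_(N d)) (c e : R), v != 0 -> 0 <= c -> c < e ->
      \tr ((A d *m v)^t* *m (A d *m v)) <= c%:C%C * \tr (v^t* *m v) ->
      ((w d)%:E <= mu `]0%R, e[%classic)%E.
Proof.
move=> TE.
pose exE d := cid (hermitian_eigenprojections (A d)).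
pose E d := projT1 (exE d); pose exl d := cid (projT2 (exE d)).
pose l d : 'I_(N d) -> C := projT1 (exl d).
have El d : eigenprojections ((A d)^t* *m A d) (E d) (l d) := projT2 (exl d).
have l_gt0 d j : 0 < l d j := eigenprojections_gt0 (A_inj d) (El d) j.
have lR d j : ((Re (l d j))%:C)%C = l d j.
  by apply: complex_ext => //=; have := l_gt0 d j; rewrite ltcE => /andP[/eqP -> _].
have lRgt0 d j : 0 < Re (l d j).
  by have := l_gt0 d j; rewrite ltcE => /andP[_].
pose J := {d : nat & 'I_(N d)}.
pose q (x : J) : op := mop (E (tag x) (tagged x)).
have q_self x : fop (q x) (q x).
  by have := mop_adj (E (tag x) (tagged x)); rewrite (ep_adj (El _)).
have q_idem x f : q x (q x f) = q x f by rewrite /q mop_mul (ep_mul (El _)) eqxx.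
have q_orth x y f : x != y -> q x (q y f) = fun=> 0.
  case: x y => d j [d' j'] /= xy; rewrite /q /=.
  have [e|dd'] := eqVneq d d'; last by rewrite mop_orth.
  move: e j' xy => <- j' xy; rewrite mop_mul (ep_mul (El _)).
  have [jj|_] := eqVneq j j'; first by rewrite jj eqxx in xy.
  by apply/funext => z; rewrite mop0.
have q_tr x : tr (q x) = ((w (tag x))%:C)%C by rewrite tr_mop (ep_tr (El _)) mul1r.
(* The projections of all blocks in one sequence, padded by zero. *)
pose Q k : op := oapp q (fun _ _ => 0) (choice.pickle_inv k : option J).
pose lam k : R := oapp (fun x : J => Re (l (tag x) (tagged x))) 0 (choice.pickle_inv k : option J).
have z_fop : fop (fun (_ : G -> C) _ => 0) (fun _ _ => 0).
  apply: (eq_gop _ _ (@gop_scale _ _ (fun=> True) 0 _ _ Logic.I (gop_shift _ 1%g))) => f x;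
    by rewrite ?conjc0 mul0r.
have Qself k : fop (Q k) (Q k) by rewrite /Q; case: choice.pickle_inv.
have Qidem k f : Q k (Q k f) = Q k f by rewrite /Q; case: choice.pickle_inv => [x|] //=.
have Qorth k k' f : k != k' -> Q k (Q k' f) = fun=> 0.
  move=> kk'; rewrite /Q; case ex: (choice.pickle_inv k) => [x|//].
  case ey: (choice.pickle_inv k') => [y|/=]; last by rewrite (gop0 (q_self x)).
  apply: q_orth; apply: contraNneq kk' => xy; apply/eqP.
  have := @choice.pickle_invK J k; have := @choice.pickle_invK J k'.
  by rewrite ex ey /= xy => -> ->.
have Qtr k : 0 <= Re (tr (Q k)).
  rewrite /Q; case: choice.pickle_inv => [x|] //=.
  by rewrite q_tr /= ltW.
have Qtotal : (fun n => \sum_(0 <= k < n) Re (tr (Q k))) @ \oo --> (1 : R).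
  have le1 n : \sum_(0 <= k < n) Re (tr (Q k)) <= 1.
    rewrite -(@nsq_zeta R G 1%g).
    rewrite (eq_bigr (fun k => nsq (Q k (zeta 1%g)))); last first.
      by move=> k _; rewrite (nsq_Q_zeta Qself Qidem).
    by apply: bessel => //; exact: l2_zeta.
  (* The enumeration does not respect the order of the blocks, but a long
     enough initial segment contains the first [D] blocks. *)
  have lower D : exists n0, forall n, (n0 <= n)%N ->
      \sum_(0 <= d < D) (N d)%:R * w d <= \sum_(0 <= k < n) Re (tr (Q k)).
    pose pk d (j : 'I_(N d)) : nat := choice.pickle (Tagged (fun d => 'I_(N d)) j : J).
    pose s := [seq pk d j | d <- index_iota 0 D, j <- enum 'I_(N d)].
    exists (\max_(k <- s) k).+1 => n sn.
    have us : uniq s.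
      apply: allpairs_uniq_dep => [|d _|]; [exact: iota_uniq|exact: enum_uniq|].
      by move=> [d j] [d' j'] _ _ /=; exact: (pcan_inj choice.pickleK).
    have ls : all (fun k => (k < n)%N) s.
      by apply/allP => k ks; apply: leq_trans sn; rewrite ltnS; exact: leq_bigmax_seq.
    apply: le_trans (sum_sub_seq Qtr us ls).
    rewrite big_allpairs_dep /=; apply: ler_sum => d _.
    rewrite (eq_bigr (fun=> w d)); last first.
      by move=> j _; rewrite /Q choice.pickleK_inv /= q_tr.
    by rewrite big_const_seq count_predT size_enum_ord iter_addr_0 mulr_natl.
  apply/cvgrPdist_lt => e e0.
  move/cvgrPdist_lt : u_total => /(_ e e0)[D _ /(_ D (leqnn D))/= De].
  have [n0 n0P] := lower D; exists n0 => // n /= /n0P h.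
  have := le1 n; move: De h; rewrite !ltr_norml => /andP[_ De] h h1.
  by apply/andP; split; lra.
have SS2 : fop (fun f => S' (S f)) (fun f => S' (S f)) := gop_comp (fop_sym SS) SS.
have TQ k f : l2 f -> S' (S (Q k f)) = fun x => ((lam k)%:C)%C * Q k f x.
  move=> lf; rewrite /Q /lam; case: choice.pickle_inv => [x|] /=; last first.
    by rewrite (gop0 SS2); apply/funext => y; rewrite mul0r.
  rewrite /q S_mop S'_mop// mulmxA (ep_eig (El _)).
  by apply/funext => y; rewrite mopZ lR.
(* Eigenvalues are bounded since the operator is. *)
have [K K0 bK] := gop_bound SS2.
have lamL k : `|lam k| <= 1 + K.
  rewrite /lam; case ex: (choice.pickle_inv k) => [x|] /=; last by rewrite normr0; lra.
  have lx := lRgt0 (tag x) (tagged x).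
  have lz := @l2_zeta R G 1%g; have lQ : l2 (Q k (zeta 1%g)) by exact: gop_l2 (Qself k) lz.
  have [_] := bK _ lQ; rewrite TQ// nsqZ// (nsq_Q_zeta Qself Qidem).
  have -> : Re (tr (Q k)) = w (tag x) by rewrite /Q ex /= q_tr.
  rewrite ler_pM2r// sqr_normcE /= expr0n /= addr0 /lam ex /= gtr0_norm// => h.
  exact: le_of_sqr_le.
have TT := SS2; rewrite -TE in TT.
exists (spec_measure Qself lam (zeta 1%g)); split.
  exists (spec_proj Q lam); split.
    split; first exact: (spec_pvm Qself Qidem Qorth Qtotal lam).
    move=> f lf; exists (spec_measure Qself lam f).
    have [int _] := spec_integral Qself Qidem Qorth lamL lf.
    split => //; first by move=> B _; exact: (spec_measureE Qself Qidem Qorth lam B lf).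
    by apply: (spec_operator Qself Qidem Qorth Qtotal lamL TT) => // k h lh; rewrite TE TQ.
  by move=> B _; exact: (spec_measureE Qself Qidem Qorth lam B (@l2_zeta R G 1%g)).
move=> d v c e v0 c0 ce Av.
have [j lj] : exists j, l d j <= c%:C%C.
  apply: (small_eigenvalue (El d) (fun j => ltW (l_gt0 d j)) _ v0 Av).
  by rewrite lecR.
pose x : J := Tagged (fun d => 'I_(N d)) j.
have -> : w d = Re (tr (Q (choice.pickle x))) by rewrite /Q choice.pickleK_inv /= q_tr.
apply: (spec_measure_ge Qself Qidem Qorth).
rewrite /lam choice.pickleK_inv inE /= in_itv /= lRgt0 /=.
by apply: le_lt_trans ce; rewrite -lecR lR.
Qed.

End MatrixUnits.

(** * A counter in base m *)

Section CounterMachine.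
Local Open Scope nat_scope.
Variable m : nat.
Implicit Types (w c p t : seq nat) (x y : nat * seq nat).

(** A configuration is the position of the head together with a word, whose
    letter 0 marks the ends of the block of digits.  The machine increments the
    scanned digit and sweeps right to the end of the word; a digit [m] is reset
    to 1, with a move to the left.  Only the left end mark stops it. *)
Definition step x : option (nat * seq nat) :=
  let: (i, w) := x in let s := nth 0 w i in
  if s == 0 then None
  else if s < m then
    Some (if nth 0 w i.+1 == 0 then i else i.+1, set_nth 0 w i s.+1)
  else Some (i.-1, set_nth 0 w i 1).

Lemma stepE i w : step (i, w) = if nth 0 w i == 0 then None
  else if nth 0 w i < m then
    Some (if nth 0 w i.+1 == 0 then i else i.+1, set_nth 0 w i (nth 0 w i).+1)
  else Some (i.-1, set_nth 0 w i 1).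
Proof. by []. Qed.

Definition run n x := iter n (obind step) (Some x).

Lemma runD n k x y : run n x = Some y -> run (k + n) x = run k y.
Proof. by rewrite /run iterD => ->. Qed.

Lemma run_1 x : run 1 x = step x. Proof. by []. Qed.

Lemma run1 n x y : run n x = Some y -> run n.+1 x = step y.
Proof. by rewrite /run iterS => ->. Qed.

Lemma nth_size_cat p s c : nth 0 (p ++ s :: c) (size p) = s.
Proof. by rewrite nth_cat ltnn subnn. Qed.

Lemma nth_size_cat1 p s c : nth 0 (p ++ s :: c) (size p).+1 = nth 0 c 0.
Proof. by rewrite nth_cat ltnNge leqnSn subSn// subnn. Qed.

Lemma set_nth_size_cat p s c s' : set_nth 0 (p ++ s :: c) (size p) s' = p ++ s' :: c.
Proof. by elim: p => //= a p ->. Qed.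

Hypothesis m_gt1 : 1 < m.

Lemma step_up p s c : 0 < s < m -> step (size p, p ++ s :: c) =
  Some (if nth 0 c 0 == 0 then size p else (size p).+1, p ++ s.+1 :: c).
Proof.
move=> /andP[s0 sm].
by rewrite stepE nth_size_cat nth_size_cat1 set_nth_size_cat eqn0Ngt s0 sm.
Qed.

Lemma step_reset p c : step (size p, p ++ m :: c) = Some ((size p).-1, p ++ 1 :: c).
Proof. by rewrite stepE nth_size_cat !set_nth_size_cat ltnn eqn0Ngt (ltnW m_gt1). Qed.

(** The cell in front of [k] cells is incremented [m - 1] times before its
    reset, and each increment triggers a complete sweep of the [k] cells. *)
Lemma run_sweep k p t : 0 < k -> exists2 n, m.-1 ^ k <= n &
  run n (size p, p ++ nseq k 1 ++ 0 :: t) = Some ((size p).-1, p ++ nseq k 1 ++ 0 :: t).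
Proof.
case: k => // k _; elim: k p => [|k IH] p.
  have incr j s : 0 < s -> s + j = m ->
      run j (size p, p ++ s :: 0 :: t) = Some (size p, p ++ m :: 0 :: t).
    elim: j s => [|j IHj] s s0 sj; first by rewrite -sj addn0.
    rewrite -addn1 (@runD 1 _ _ (size p, p ++ s.+1 :: 0 :: t)).
      by apply: IHj => //; rewrite -sj addSnnS.
    by rewrite run_1 step_up//; lia.
  exists m; first by rewrite expn1 leq_pred.
  have -> : m = (m.-1).+1 by lia.
  rewrite (run1 (incr m.-1 1 _ _)) ?step_reset//; lia.
have incr j s : 0 < s -> s + j = m -> exists2 n, j * m.-1 ^ k.+1 <= n &
    run n (size p, p ++ s :: nseq k.+1 1 ++ 0 :: t)
      = Some (size p, p ++ m :: nseq k.+1 1 ++ 0 :: t).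
  elim: j s => [|j IHj] s s0 sj; first by exists 0; rewrite ?mul0n// -sj addn0.
  have [n nk rn] := IH (rcons p s.+1).
  have [n' nk' rn'] := IHj s.+1 isT (etrans (esym (addnS _ _)) (etrans (addnC _ _) (etrans (addnC _ _) sj))).
  exists (n' + (n + 1)); first by rewrite mulSn; lia.
  rewrite (@runD (n + 1) _ _ (size p, p ++ s.+1 :: nseq k.+1 1 ++ 0 :: t))//.
  rewrite (@runD 1 _ _ ((size p).+1, p ++ s.+1 :: nseq k.+1 1 ++ 0 :: t)).
    by move: rn; rewrite size_rcons cat_rcons.
  by rewrite run_1 step_up//; lia.
have [n nk rn] := incr m.-1 1 isT ltac:(lia).
exists n.+1; first by rewrite expnS; lia.
by rewrite (run1 rn) step_reset.
Qed.

Definition start d : nat * seq nat := (1, 0 :: nseq d 1 ++ [:: 0]).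

Lemma run_halts d : 0 < d -> exists n y,
  [/\ m.-1 ^ d <= n, run n (start d) = Some y & step y = None].
Proof.
move=> d0; have [n nd rn] := run_sweep [:: 0] [::] d0.
by exists n; exists (0, 0 :: nseq d 1 ++ [:: 0]).
Qed.

Fixpoint words d : seq (seq nat) :=
  if d is d'.+1 then [seq a :: c | a <- iota 1 m, c <- words d'] else [:: [::]].

Lemma size_words d : size (words d) = m ^ d.
Proof. by elim: d => //= d IH; rewrite size_allpairs size_iota IH expnS. Qed.

Lemma mem_words d c : (c \in words d) = (size c == d) && all (fun a => 0 < a <= m) c.
Proof.
elim: d c => [|d IH] [|a c] //=.
  by apply/negbTE/allpairsPdep => -[? [? [_ _ //]]].
rewrite eqSS; apply/allpairsPdep/idP => [[a' [c' [a'm c'd [-> ->]]]]|].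
  by move: a'm c'd; rewrite mem_iota IH add1n ltnS => -> /andP[-> ->].
by move=> /and3P[sc am cm]; exists a, c; rewrite mem_iota IH add1n ltnS sc am cm.
Qed.

Lemma uniq_words d : uniq (words d).
Proof.
elim: d => //= d IH; apply: allpairs_uniq => //; first exact: iota_uniq.
by move=> [a c] [a' c'] _ _ /= [-> ->].
Qed.

Definition framed c : seq nat := 0 :: c ++ [:: 0].

Definition configs d : seq (nat * seq nat) :=
  [seq (i, framed c) | i <- iota 0 d.+1, c <- words d].

Lemma size_configs d : size (configs d) = d.+1 * m ^ d.
Proof. by rewrite size_allpairs size_iota size_words. Qed.

Lemma framed_inj : injective framed.
Proof. by move=> c c' [] /eqP; rewrite !cats1 eqseq_rcons => /andP[/eqP]. Qed.

Lemma uniq_configs d : uniq (configs d).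
Proof.
apply: allpairs_uniq; [exact: iota_uniq|exact: uniq_words|].
move=> [i c] [i' c'] _ _ e; have ii : i = i' := congr1 fst e.
by rewrite ii (framed_inj (congr1 snd e : framed c = framed c')).
Qed.

Lemma configsP d x : reflect (exists i c, [/\ x = (i, framed c), i <= d, size c = d
    & all (fun a => 0 < a <= m) c]) (x \in configs d).
Proof.
apply: (iffP idP) => [/allpairsPdep[i [c [id cd ->]]]|[i [c [-> id sc cm]]]].
  by exists i, c; move: id cd; rewrite mem_iota mem_words => /= id /andP[/eqP -> ->].
by apply/allpairsPdep; exists i, c; rewrite mem_iota mem_words ltnS id sc eqxx cm.
Qed.

Lemma nth_framed c j : nth 0 (framed c) j = if 0 < j then nth 0 c j.-1 else 0.
Proof.
case: j => //= j; rewrite nth_cat; case: ltnP => // cj; rewrite [RHS]nth_default//.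
by case: (j - size c) => //= k; rewrite nth_nil.
Qed.

Lemma set_nth_framed c i s : 0 < i <= size c ->
  set_nth 0 (framed c) i s = framed (set_nth 0 c i.-1 s).
Proof.
case: i => //= i ic; congr cons; elim: c i ic => // a c IH [|i] //= ic.
by rewrite IH.
Qed.

Lemma all_set_nth (a : pred nat) c i s : i < size c -> a s -> all a c -> all a (set_nth 0 c i s).
Proof. by elim: c i => //= b c IH [|i] /= ic as_ /andP[ab ac]; rewrite ?as_ ?ab ?IH. Qed.

Lemma step_configs d x y : x \in configs d -> step x = Some y -> y \in configs d.
Proof.
move=> /configsP[i [c [-> id sc cm]]]; rewrite stepE.
case: eqP => // /eqP s0; have i0 : 0 < i by move: s0; rewrite nth_framed; case: i id.
have ic : i.-1 < size c by rewrite sc; lia.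
have sz s : size (set_nth 0 c i.-1 s) = d by rewrite size_set_nth sc; lia.
rewrite !set_nth_framed ?i0 ?sc//.
case: ifP => sm [<-]; apply/configsP.
  eexists; exists (set_nth 0 c i.-1 (nth 0 (framed c) i).+1); split; [reflexivity| |exact: sz|].
    rewrite -[c ++ _]/(behead (framed c)) nth_behead nth_framed /=.
    have [di|di] := ltnP i d; first by case: ifP.
    by rewrite nth_default ?eqxx ?sc.
  by apply: all_set_nth.
exists i.-1, (set_nth 0 c i.-1 1); split => //; first lia.
by apply: all_set_nth => //; lia.
Qed.

Lemma start_configs d : 0 < d -> start d \in configs d.
Proof.
move=> d0; apply/configsP; exists 1, (nseq d 1); rewrite size_nseq; split => //.
by rewrite all_nseq; lia.
Qed.

(** If the heads are aligned differently, or the lengths differ, then an end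
    mark of one word meets a digit of the other; otherwise two digits at the
    same cell differ. *)
Lemma configs_clash d d' i w i' w' : (i, w) \in configs d -> (i', w') \in configs d' ->
  (i, w) != (i', w') -> exists j j',
    [/\ j < size w, j' < size w', j + i' = j' + i & nth 0 w j != nth 0 w' j'].
Proof.
move=> /configsP[i0 [c [[-> ->] id sc cm]]] /configsP[i0' [c' [[-> ->] id' sc' cm']]] ne.
have dig (b : seq nat) j : all (fun a => 0 < a <= m) b -> 0 < j <= size b -> 0 < nth 0 (framed b) j.
  move=> /allP bm jb; rewrite nth_framed; case: j jb => //= j jb.
  by have /andP[] := bm _ (mem_nth 0 jb).
have sf (b : seq nat) : size (framed b) = (size b).+2 by rewrite /= size_cat addn1.
have end0 b : nth 0 (framed b) (size b).+1 = 0 by rewrite nth_framed /= nth_default.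
rewrite !sf; have [ii|ii|ii] := ltngtP i0 i0'.
- exists 0, (i0' - i0); split; try lia.
  by rewrite eq_sym -lt0n dig//; lia.
- exists (i0 - i0'), 0; split; try lia.
  by rewrite -lt0n dig//; lia.
subst i0'; have [cc|cc|cc] := ltngtP (size c) (size c').
- exists (size c).+1, (size c).+1; split; try lia.
  by rewrite end0 eq_sym -lt0n dig//; lia.
- exists (size c').+1, (size c').+1; split; try lia.
  by rewrite end0 -lt0n dig//; lia.
have [j jc ncc] : exists2 j, j < size c & nth 0 c j != nth 0 c' j.
  have [/hasP[j]|/hasPn h] := boolP (has (fun j => nth 0 c j != nth 0 c' j) (iota 0 (size c))).
    by rewrite mem_iota => /= jc; exists j.
  case/eqP: ne; congr (_, framed _); apply: (@eq_from_nth _ 0) => // j jc.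
  by apply/eqP; have := h j; rewrite mem_iota negbK; apply.
by exists j.+1, j.+1; rewrite !nth_framed /=; split => //; lia.
Qed.

End CounterMachine.

(** * The wreath product *)

Section WreathProduct.
Variable F : groupType.

(** The unrestricted product: the second component is an arbitrary function on
    the integers, which keeps the type simple. *)
Definition wreath : Type := (int * (int -> F))%type.

HB.instance Definition _ := gen_eqMixin wreath.
HB.instance Definition _ := gen_choiceMixin wreath.

Implicit Types x y z : wreath.

Definition wone : wreath := (0, fun _ => 1%g).
Definition winv x : wreath := (- x.1, fun i => (x.2 (i + x.1))^-1%g).
Definition wmul x y : wreath := (x.1 + y.1, fun i => (x.2 (i - y.1) * y.2 i)%g).

Lemma wmulA : associative wmul.
Proof.
move=> [a f] [b g] [c h]; rewrite /wmul /=; congr pair; first exact: addrA.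
by apply/funext => i; rewrite mulgA opprD addrA addrAC.
Qed.

Lemma wmul1 : left_id wone wmul.
Proof. by move=> [a f]; rewrite /wmul /= add0r; congr pair; apply/funext => i; rewrite mul1g. Qed.

Lemma wmulr1 : right_id wone wmul.
Proof.
move=> [a f]; rewrite /wmul /= addr0; congr pair; apply/funext => i.
by rewrite subr0 mulg1.
Qed.

Lemma wmulV : left_inverse wone winv wmul.
Proof.
move=> [a f]; rewrite /wmul /winv /= addNr; congr pair; apply/funext => i.
by rewrite subrK mulVg.
Qed.

Lemma wmulrV : right_inverse wone winv wmul.
Proof.
move=> [a f]; rewrite /wmul /winv /= subrr; congr pair; apply/funext => i.
by rewrite opprK mulgV.
Qed.

HB.instance Definition _ := isGroup.Build wreath wmulA wmul1 wmulr1 wmulV wmulrV.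

Definition site (j : int) (a : F) : wreath := (0, fun i => if i == j then a else 1%g).
Definition move_head (n : int) : wreath := (n, fun _ => 1%g).

Lemma wmulE x y : (x * y)%g = wmul x y. Proof. by []. Qed.

Lemma siteM j a b : (site j (a * b) = site j a * site j b)%g.
Proof.
rewrite wmulE /wmul /site /= addr0; congr pair; apply/funext => i.
by rewrite subr0; case: ifP; rewrite ?mulg1.
Qed.

Lemma site_comm j k a b : j != k -> (site j a * site k b = site k b * site j a)%g.
Proof.
move=> jk; rewrite !wmulE /wmul /=; congr pair; apply/funext => i.
rewrite subr0; have [ij|_] := eqVneq i j; last by rewrite mul1g mulg1.
by rewrite -ij in jk; rewrite (negbTE jk) mulg1 mul1g.
Qed.

Lemma move_site n j a : (move_head n * site j a = site (j - n) a * move_head n)%g.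
Proof.
rewrite !wmulE /wmul /= addrC; congr pair; apply/funext => i.
by rewrite mul1g mulg1 (inj_eq (addIr (- n))).
Qed.

Lemma move_headD n k : (move_head n * move_head k = move_head (n + k))%g.
Proof. by rewrite wmulE /wmul /=; congr pair; apply/funext => i; rewrite mul1g. Qed.

Lemma site1 j : site j 1 = 1%g.
Proof. by congr pair; apply/funext => i; case: ifP. Qed.

Lemma siteV j a : (site j a)^-1%g = site j (a^-1)%g.
Proof. by apply: mulg1_eq; rewrite -siteM mulgV site1. Qed.

Lemma move_head0 : move_head 0 = 1%g. Proof. by []. Qed.

Lemma move_headV n : (move_head n)^-1%g = move_head (- n).
Proof. by apply: mulg1_eq; rewrite move_headD subrr. Qed.

End WreathProduct.

(** * Matrix units at the cells of the tape *)

Section SiteOperators.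
Context {R : realType} {K : finFieldType}.
Local Notation C := R[i].
Local Notation Re := (@complex.Re R).
Local Notation W := (wreath {perm K}).
Local Notation mv n := (@move_head {perm K} n).
Local Notation op := ((W -> C) -> (W -> C)).
Implicit Types (f h : W -> C) (a b c d v : K) (j k n : int).

Variable chi : K -> int.
Hypothesis chiD : forall a b, chi (a + b) = chi a * chi b.
Hypothesis chi_sq : forall a, chi a * chi a = 1.
Hypothesis chi_neq1 : exists a, chi a != 1.

Local Notation q := (#|K|%:R : C).

Definition transl v : {perm K} := perm (@addIr K v).

(** The value at [b = 0] is a convention that makes [dilat] total. *)
Lemma scale_inj b : injective (fun x => if b == 0 then x else b * x).
Proof. by move=> x y /=; case: eqVneq => // b0 /(mulfI b0). Qed.

Definition dilat b : {perm K} := perm (@scale_inj b).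

Lemma translD a b : (transl a * transl b)%g = transl (a + b).
Proof. by apply/permP => x; rewrite permM !permE addrA. Qed.

Lemma dilatM a b : a != 0 -> b != 0 -> (dilat a * dilat b)%g = dilat (a * b).
Proof.
move=> a0 b0; apply/permP => x; rewrite permM !permE mulf_eq0 (negbTE a0) (negbTE b0) /=.
by rewrite mulrA (mulrC b).
Qed.

Lemma dilat1 : dilat 1 = 1%g.
Proof. by apply/permP => x; rewrite !permE oner_eq0 mul1r. Qed.

Lemma dilat_transl b v : b != 0 -> (dilat b * transl v)%g = (transl (v / b)%R * dilat b)%g.
Proof.
move=> b0; apply/permP => x; rewrite !permM !permE (negbTE b0).
by rewrite mulrDr mulrCA mulfV// mulr1.
Qed.

Lemma transl0 : transl 0 = 1%g.
Proof. by apply/permP => x; rewrite !permE addr0. Qed.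

Lemma translV v : (transl v)^-1%g = transl (- v).
Proof. by apply: mulg1_eq; rewrite translD subrr transl0. Qed.

Lemma dilatV b : b != 0 -> (dilat b)^-1%g = dilat b^-1.
Proof. by move=> b0; apply: mulg1_eq; rewrite dilatM ?invr_eq0// mulfV// dilat1. Qed.

Lemma chi0 : chi 0 = 1.
Proof. by rewrite -[0](subrr (0 : K)) subr0 -[X in chi X]addr0 chiD chi_sq. Qed.

Lemma chiN a : chi (- a) = chi a.
Proof. by rewrite -[LHS]mulr1 -(chi_sq a) mulrA -chiD addNr chi0 mul1r. Qed.

(** The sum is invariant under a translation of [v] that multiplies it by a
    sign -1. *)
Lemma sum_chi a : \sum_v chi (a * v) = if a == 0 then #|K|%:R else 0.
Proof.
case: eqVneq => [->|a0].
  rewrite (eq_bigr (fun=> 1)); last by move=> v _; rewrite mul0r chi0.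
  by rewrite sumr_const.
have [b b1] := chi_neq1.
have e : chi b * \sum_v chi (a * v) = \sum_v chi (a * v).
  rewrite mulr_sumr [RHS](reindex (fun v => v + b / a)) /=; last first.
    by exists (fun v => v - b / a) => v _; rewrite ?addrK ?subrK.
  by apply: eq_bigr => v _; rewrite mulrDr mulrCA mulfV// mulr1 chiD mulrC.
move/eqP: e; rewrite -subr_eq0 -[X in _ - X]mul1r -mulrBl mulf_eq0 subr_eq0 (negbTE b1).
by move=> /eqP.
Qed.

(** The letter [a] stands for the character [v |-> chi (a v)].  The dilation by
    [ratio a b] carries one of the characters [a] and [b] to the other when both
    are trivial or both are not, that is, when [same a b]. *)
Definition ratio a b : K := if b == 0 then 1 else a / b.

Definition same a b := (a == 0) == (b == 0).

Lemma ratio_neq0 a b : same a b -> ratio a b != 0.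
Proof.
rewrite /same /ratio; have [b0|b0] := eqVneq b 0; first by rewrite oner_eq0.
by move=> /eqP/negbT a0; rewrite mulf_neq0 ?invr_eq0.
Qed.

Lemma ratioM a b c : same a b -> same b c -> ratio a b * ratio b c = ratio a c.
Proof.
rewrite /same /ratio; have [c0|c0] := eqVneq c 0; first by move=> _ /eqP ->; rewrite mul1r.
by move=> _ /eqP b0; rewrite b0 mulrA divfK// b0.
Qed.

Lemma ratioV a b : same a b -> (ratio a b)^-1 = ratio b a.
Proof.
rewrite /same /ratio; have [b0|b0] := eqVneq b 0; first by move=> /eqP ->; rewrite invr1.
by move=> /eqP ->; rewrite invf_div.
Qed.

Lemma divr_ratio a b : same a b -> a / ratio a b = b.
Proof.
rewrite /same /ratio; have [b0|b0] := eqVneq b 0; first by move=> /eqP/eqP ->; rewrite mul0r b0.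
by move=> /eqP a0; rewrite invf_div mulrC divfK// a0.
Qed.

Definition uelt a b v : {perm K} := (transl v * dilat (ratio a b))%g.

(** [q] times the matrix unit from the character [b] to the character [a] of
    the additive group, at the cell [j]. *)
Definition qunit j a b : op :=
  fun f x => \sum_v (chi (a * v))%:~R * lshift (site j (uelt a b v)) f x.

Definition unit_op j a b : op := fun f x => q^-1 * qunit j a b f x.

Lemma uelt_inv a b v : same a b ->
  ((uelt a b v)^-1)%g = uelt b a (- (v * ratio a b)).
Proof.
move=> ab; have r0 := ratio_neq0 ab; rewrite /uelt invgM dilatV// translV.
by rewrite dilat_transl ?invr_eq0// invrK mulNr ratioV.
Qed.

Lemma uelt_mul a b c d v v' : same a b -> (uelt a b v * uelt c d v')%g =
  (transl (v + v' / ratio a b)%R * (dilat (ratio a b) * dilat (ratio c d)))%g.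
Proof.
move=> ab; rewrite /uelt -mulgA (mulgA (dilat _)) dilat_transl ?ratio_neq0//.
by rewrite -translD !mulgA.
Qed.

Lemma qunit_gop j a b : same a b -> gop intcoef (qunit j a b) (qunit j b a).
Proof.
move=> ab; have r0 := ratio_neq0 ab.
have i0 : intcoef (0 : C) by exists 0.
apply: (eq_gop _ _ (@gop_sum _ _ intcoef _ (index_enum K) xpredT
  (fun v f x => (chi (a * v))%:~R * lshift (site j (uelt a b v)) f x)
  (fun v f x => conjc ((chi (a * v))%:~R : C) * lshift (site j (uelt a b v))^-1 f x) i0 _)) => //.
  move=> f x; rewrite [RHS](reindex (fun v => - (v * ratio a b))) /=; last first.
    exists (fun v => - (v / ratio a b)) => v _; first by rewrite mulNr opprK mulfK.
    by rewrite mulNr opprK divfK.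
  apply: eq_bigr => v _; rewrite conjc_int siteV uelt_inv//; congr (_%:~R * _).
  have e : b * ratio a b = a by rewrite -{1}(divr_ratio ab) divfK.
  by rewrite mulrN chiN mulrCA e mulrC.
by move=> v; apply: gop_scale; [exists (chi (a * v))|exact: gop_shift].
Qed.

Lemma conjc_qV : conjc (q^-1) = q^-1.
Proof. by rewrite (fmorphV (@conjc R)) rmorph_nat. Qed.

Lemma unit_op_fop j a b : same a b -> fop (unit_op j a b) (unit_op j b a).
Proof.
move=> ab; apply: (eq_gop _ _ (gop_scale (c := q^-1) _ (gopW (qunit_gop j ab)))) => // f x.
by rewrite conjc_qV.
Qed.

(** After the change of variables [v |-> v - v' / ratio a b] the sum over [v']
    is a character sum, which vanishes unless [b = c]. *)
Lemma qunit_mul j a b c d f x : same a b -> same c d ->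
  qunit j a b (qunit j c d f) x = if b == c then q * qunit j a d f x else 0.
Proof.
move=> ab cd; have r0 := ratio_neq0 ab.
pose r := (dilat (ratio a b) * dilat (ratio c d))%g.
transitivity (\sum_v (chi (a * v))%:~R * ((\sum_v' chi ((c - b) * v'))%:~R *
    lshift (site j (transl v * r)%g) f x) : C).
  rewrite /qunit; transitivity (\sum_v \sum_v' (chi (a * v))%:~R * ((chi (c * v'))%:~R *
      lshift (site j (transl (v + v' / ratio a b) * r)%g) f x) : C).
    apply: eq_bigr => v _; rewrite {1}/lshift mulr_sumr; apply: eq_bigr => v' _.
    by rewrite -[lshift _ f _]/(lshift (site j (uelt a b v)) (lshift _ f) x) lshiftE -siteM
       uelt_mul.
  rewrite exchange_big /=.
  transitivity (\sum_v' \sum_v (chi (a * v))%:~R * ((chi ((c - b) * v'))%:~R *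
      lshift (site j (transl v * r)%g) f x) : C).
    apply: eq_bigr => v' _; rewrite (reindex (fun v => v - v' / ratio a b)) /=; last first.
      by exists (fun v => v + v' / ratio a b) => v _; rewrite ?addrK ?subrK.
    apply: eq_bigr => v _; rewrite subrK !mulrA -!intrM; congr (_%:~R * _).
    rewrite mulrBr (mulrA a v') (mulrAC a v') divr_ratio// mulrBl !chiD !chiN.
    by rewrite -mulrA (mulrC (chi (b * v'))).
  rewrite exchange_big /=; apply: eq_bigr => v _.
  by rewrite -mulr_sumr -mulr_suml rmorph_sum.
rewrite sum_chi subr_eq0 eq_sym; case: eqVneq => [bc|_]; last first.
  by rewrite big1// => v _; rewrite mul0r mulr0.
rewrite /qunit mulr_sumr; apply: eq_bigr => v _.
rewrite mulrCA; congr (_ * (_ * _)); first by rewrite natz.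
by subst c; rewrite /uelt /r dilatM ?ratioM ?ratio_neq0.
Qed.

Lemma q_neq0 : q != 0.
Proof. by rewrite pnatr_eq0 -lt0n; apply/card_gt0P; exists 0. Qed.

Lemma qunitZ j a b e f x : qunit j a b (fun y => e * f y) x = e * qunit j a b f x.
Proof. by rewrite /qunit mulr_sumr; apply: eq_bigr => v _; rewrite /lshift mulrCA. Qed.

Lemma unit_op_mul j a b c d f : same a b -> same c d ->
  unit_op j a b (unit_op j c d f) = if b == c then unit_op j a d f else fun=> 0.
Proof.
move=> ab cd; apply/funext => x; rewrite {1}/unit_op {1}/unit_op qunitZ qunit_mul//.
case: ifP => _; last by rewrite !mulr0.
by rewrite /unit_op; congr (_ * _); rewrite mulrA mulVf ?q_neq0// mul1r.
Qed.

Lemma unit_op_comm j k a b c d f : j != k ->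
  unit_op j a b (unit_op k c d f) = unit_op k c d (unit_op j a b f).
Proof.
move=> jk; apply/funext => x; rewrite /unit_op !qunitZ; congr (_ * (_ * _)).
rewrite /qunit; under eq_bigr do rewrite mulr_sumr.
under [RHS]eq_bigr do rewrite mulr_sumr.
rewrite exchange_big; apply: eq_bigr => v _; apply: eq_bigr => v' _.
rewrite mulrCA; congr (_ * (_ * _)).
rewrite -[LHS]/(lshift (site j (uelt a b v')) (lshift (site k (uelt c d v)) f) x).
rewrite -[RHS]/(lshift (site k (uelt c d v)) (lshift (site j (uelt a b v')) f) x).
by rewrite !lshiftE site_comm.
Qed.

Lemma unit_op_move n j a b f :
  lshift (mv n) (unit_op j a b f) = unit_op (j - n) a b (lshift (mv n) f).
Proof.
apply/funext => x; rewrite /unit_op /qunit {1}/lshift; congr (_ * _).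
apply: eq_bigr => v _; congr (_ * _).
rewrite -[LHS]/(lshift (mv n) (lshift (site j (uelt a b v)) f) x).
by rewrite !lshiftE move_site.
Qed.

(** * Words on the tape *)

Fixpoint tape k (xs ys : seq K) f : W -> C :=
  match xs, ys with
  | a :: xs', b :: ys' => unit_op k a b (tape (k + 1) xs' ys' f)
  | _, _ => f
  end.

Lemma unit_op_tape j k a b xs ys f : j < k ->
  unit_op j a b (tape k xs ys f) = tape k xs ys (unit_op j a b f).
Proof.
elim: xs ys k => [|c xs IH] [|d ys] k jk //=.
rewrite unit_op_comm ?lt_eqF// IH//; lia.
Qed.

Lemma tape_fop k xs ys : all2 same xs ys -> fop (tape k xs ys) (tape k ys xs).
Proof.
elim: xs ys k => [|a xs IH] [|b ys] k //= => [_|/andP[ab xsys]].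
  apply: (eq_gop _ _ (gop_shift _ 1%g)) => f x; rewrite ?invg1 lshift1//.
apply: (eq_gop _ _ (gop_comp (unit_op_fop k ab) (IH _ (k + 1) xsys))) => // f x.
by rewrite unit_op_tape//; lia.
Qed.

Lemma tape_mul k xs ys zs f : all2 same xs ys -> all2 same ys zs ->
  tape k xs ys (tape k ys zs f) = tape k xs zs f.
Proof.
elim: xs ys zs k => [|a xs IH] [|b ys] [|c zs] k //= /andP[ab xy] /andP[bc yz].
by rewrite -unit_op_tape ?unit_op_mul ?eqxx ?IH//; lia.
Qed.

Lemma unit_op0 j a b : unit_op j a b (fun=> 0) = fun=> 0.
Proof.
apply/funext => x; rewrite /unit_op /qunit big1 ?mulr0// => v _.
by rewrite /lshift mulr0.
Qed.

Lemma unit_op_read k p s c xs ys f : (p < size xs)%N -> all2 same xs ys -> same s c ->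
  unit_op (k + p%:Z) s c (tape k xs ys f) =
  if c == nth 0 xs p then tape k (set_nth 0 xs p s) ys f else fun=> 0.
Proof.
elim: p k xs ys => [|p IH] k [|a xs] [|b ys] //= px /andP[ab xy] sc.
  by rewrite addr0 unit_op_mul//; case: ifP.
rewrite unit_op_comm; last by lia.
rewrite (_ : k + p.+1%:Z = k + 1 + p%:Z); last by lia.
by rewrite IH//; case: ifP => // _; rewrite unit_op0.
Qed.

Lemma tape_unit_op k p b c xs ys f : (p < size xs)%N -> all2 same xs ys -> same b c ->
  tape k xs ys (unit_op (k + p%:Z) b c f) =
  if nth 0 ys p == b then tape k xs (set_nth 0 ys p c) f else fun=> 0.
Proof.
elim: p k xs ys => [|p IH] k [|a xs] [|d ys] //= px /andP[ad xy] bc.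
  rewrite addr0 -unit_op_tape; last by lia.
  by rewrite unit_op_mul//; case: ifP.
rewrite (_ : k + p.+1%:Z = k + 1 + p%:Z); last by lia.
by rewrite IH//; case: ifP => // _; rewrite unit_op0.
Qed.

Lemma set_nth_nth (T : Type) (x0 : T) (s : seq T) p : (p < size s)%N ->
  set_nth x0 s p (nth x0 s p) = s.
Proof. by elim: s p => // a s IH [|p] //= ps; rewrite IH. Qed.

(** Inserting the projection onto the letter of the second word at the common
    cell annihilates the first word. *)
Lemma tape_clash k k' p p' xs ys zs ws f : (p < size xs)%N -> (p' < size zs)%N ->
  all2 same xs ys -> all2 same zs ws -> k + p%:Z = k' + p'%:Z ->
  nth 0 ys p != nth 0 zs p' -> tape k xs ys (tape k' zs ws f) = fun=> 0.
Proof.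
move=> px pz xy zw kk ne; set c := nth 0 zs p'.
have cc : same c c by rewrite /same.
have := @unit_op_read k' p' c c zs ws f pz zw cc; rewrite eqxx set_nth_nth// => <-.
by rewrite -kk tape_unit_op// (negbTE ne).
Qed.

Lemma tape_move n k xs ys f :
  lshift (mv n) (tape k xs ys f) = tape (k - n) xs ys (lshift (mv n) f).
Proof.
elim: xs ys k => [|a xs IH] [|b ys] k //=.
by rewrite unit_op_move IH addrAC.
Qed.

(** Among the group elements occurring in the product of the projections, only
    the identity contributes, with coefficient [q ^-1] for each cell. *)
Lemma tape_diag k xs (l : int -> {perm K}) : (forall i, k <= i -> l i = 1%g) ->
  tape k xs xs (zeta 1%g) ((0, l) : W) = q^-1 ^+ size xs * zeta 1%g ((0, l) : W).
Proof.
elim: xs k l => [|a xs IH] k l l1 /=; first by rewrite mul1r.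
rewrite /unit_op exprS -mulrA; congr (_ * _).
have uE v : uelt a a v = transl v.
  rewrite /uelt /ratio; case: eqVneq => [_|a0]; first by rewrite dilat1 mulg1.
  by rewrite mulfV// dilat1 mulg1.
rewrite /qunit (bigD1 0)//= mulr0 chi0 mul1r big1 ?addr0.
  by rewrite uE transl0 site1 lshift1 IH// => i ki; apply: l1; lia.
move=> v v0; rewrite uE /lshift siteV translV wmulE /wmul /= add0r IH; last first.
  by move=> i ki; rewrite l1 ?mulg1; [case: eqP => //; lia|lia].
rewrite /zeta (_ : (_ == _) = false) ?mulr0//; apply/negbTE/eqP => e.
have := congr1 (fun y : W => y.2 k 0) e; rewrite /= subr0 eqxx l1// mulg1 !permE add0r => /eqP.
by rewrite oppr_eq0 (negbTE v0).
Qed.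

Lemma tr_tape k xs : tr (tape k xs xs) = q^-1 ^+ size xs.
Proof. by rewrite /tr -[X in _ X = _]/((0, fun _ => 1%g) : W) tape_diag// /zeta eqxx mulr1. Qed.

End SiteOperators.

(** * The machine as an operator *)

Section CounterOperator.
Local Open Scope sesquilinear_scope.
Context {R : realType} {K : finFieldType}.
Local Notation C := R[i].
Local Notation Re := (@complex.Re R).
Local Notation W := (wreath {perm K}).
Local Notation mv n := (@move_head {perm K} n).
Local Notation op := ((W -> C) -> (W -> C)).
Implicit Types (f h : W -> C) (x y z : nat * seq nat) (d i j s : nat).

Variable chi : K -> int.
Hypothesis chiD : forall a b, chi (a + b) = chi a * chi b.
Hypothesis chi_sq : forall a, chi a * chi a = 1.
Hypothesis chi_neq1 : exists a, chi a != 1.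

Variables (m : nat) (sym : nat -> K).
Hypothesis m_gt1 : (1 < m)%N.
Hypothesis sym0 : sym 0%N = 0.
Hypothesis sym_inj : forall a b, (a <= m)%N -> (b <= m)%N -> sym a = sym b -> a = b.

Local Notation q := (#|K|%:R : C).
Local Notation uop j a b := (@unit_op R K chi j (sym a) (sym b)).

Lemma sym_eq0 a : (a <= m)%N -> (sym a == 0) = (a == 0%N).
Proof. by move=> am; apply/eqP/eqP => [|->//]; rewrite -sym0 => /sym_inj ->. Qed.

(** The matrix unit from the configuration [y] to the configuration [x]: the head
    is at the origin, so that a head at the position [i] of a word puts the first
    letter of the word at the cell [- i]. *)
Definition place x y : op := fun f =>
  tape chi (- x.1%:Z) (map sym x.2) (map sym y.2) (lshift (mv (x.1%:Z - y.1%:Z)) f).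

Definition alike (w w' : seq nat) := all2 same (map sym w) (map sym w').

Lemma alike_size w w' : alike w w' -> size w = size w'.
Proof.
rewrite /alike; elim: w w' => [|a w IH] [|b w'] //= /andP[_ /IH ->]//.
Qed.

Lemma alike_configs d x y : x \in configs m d -> y \in configs m d -> alike x.2 y.2.
Proof.
move=> /configsP[i [c [-> _ sc cm]]] /configsP[i' [c' [-> _ sc' cm']]].
rewrite /alike /framed /= sym0 !map_cat /= sym0 {1}/same eqxx /=.
rewrite -sc' in sc; elim: c c' sc cm cm' {sc'} => [|a c IH] [|b c'] //=.
  by rewrite /same eqxx.
move=> [sc] /andP[am cm] /andP[bm cm']; rewrite IH// andbT /same !sym_eq0; lia.
Qed.

Lemma place_fop d x y : x \in configs m d -> y \in configs m d -> fop (place x y) (place y x).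
Proof.
move=> xd yd; have xy := alike_configs xd yd.
apply: (eq_gop _ _ (gop_comp (tape_fop chiD chi_sq (- x.1%:Z) xy) (gop_shift _ (mv (x.1%:Z - y.1%:Z))))).
  by [].
move=> f z; rewrite move_headV tape_move /place; congr (tape _ _ _ _ (lshift (mv _) _) _); lia.
Qed.

Lemma nth_sym w p : (p < size w)%N -> nth 0 (map sym w) p = sym (nth 0%N w p).
Proof. by move=> pw; rewrite (nth_map 0%N). Qed.

Lemma configs_le d x j : x \in configs m d -> (nth 0%N x.2 j <= m)%N.
Proof.
move=> /configsP[i [c [-> _ sc cm]]]; rewrite /= nth_framed; case: ifP => // _.
have [jc|jc] := ltnP j.-1 (size c); last by rewrite nth_default.
by have /allP/(_ _ (mem_nth 0%N jc))/andP[] := cm.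
Qed.

Lemma place_mul d d' x y z t f : x \in configs m d -> y \in configs m d ->
  z \in configs m d' -> t \in configs m d' ->
  place x y (place z t f) = if y == z then place x t f else fun=> 0.
Proof.
move=> xd yd zd td; have [xy zt] := (alike_configs xd yd, alike_configs zd td).
rewrite {1}/place {1}/place tape_move lshiftE move_headD.
case: eqVneq => [e|yz].
  subst z; rewrite (_ : - y.1%:Z - _ = - x.1%:Z); last by lia.
  rewrite (tape_mul chiD chi_sq chi_neq1)// /place.
  by rewrite addrA subrK.
move: y z yz xy zt yd zd => [i w] [i' w'] yz /= xy zt yd zd.
have [j [j' [jw jw' jj ne]]] := configs_clash m_gt1 yd zd yz.
have sx := alike_size xy.
apply: (tape_clash chiD chi_sq chi_neq1 (p := j) (p' := j')) => //; rewrite ?size_map ?sx//; first lia.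
rewrite !nth_sym//; apply: contraNneq ne => /sym_inj h; apply/eqP/h.
  exact: (configs_le j yd).
exact: (configs_le j' zd).
Qed.

(** A word with [d] digits occupies [d + 2] cells, each with trace [q ^-1]. *)
Lemma tr_place d x : x \in configs m d -> tr (place x x) = q^-1 ^+ d.+2.
Proof.
move=> xd; have sx : size x.2 = d.+2.
  by move/configsP : xd => [i [c [-> _ <- _]]]; rewrite /= size_cat addn1.
rewrite /tr /place subrr move_head0 lshift1.
by rewrite -[LHS]/(tr (tape chi _ _ _)) (tr_tape chiD chi_sq) size_map sx.
Qed.

Lemma place_read i w z s s' f : (i < size w)%N -> alike w z.2 ->
  (0 < s <= m)%N -> (0 < s' <= m)%N -> (nth 0%N w i <= m)%N ->
  uop 0 s' s (place (i, w) z f) =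
  if s == nth 0%N w i then place (i, set_nth 0%N w i s') z f else fun=> 0.
Proof.
move=> iw wz /andP[s0 sm] /andP[s'0 s'm] wm; rewrite {1}/place /=.
have := unit_op_read chiD chi_sq chi_neq1 (- i%:Z) (p := i) (s := sym s') (c := sym s).
rewrite addNr => ->//; rewrite ?size_map ?nth_sym//; last by rewrite /same !sym_eq0//; lia.
rewrite (_ : (sym s == _) = (s == nth 0%N w i)); last first.
  by apply/eqP/eqP => [|->//]; exact: sym_inj.
case: ifP => // _; rewrite /place /=; congr (tape _ _ _ _ _).
apply: (@eq_from_nth _ 0) => [|j]; first by rewrite size_set_nth !size_map size_set_nth.
rewrite size_set_nth size_map (maxn_idPr iw) => jw.
rewrite nth_sym ?size_set_nth ?(maxn_idPr iw)// !nth_set_nth /=.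
by case: eqP => // _; rewrite nth_sym.
Qed.

Lemma place_mark i w z f : (i.+1 < size w)%N -> alike w z.2 -> (nth 0%N w i.+1 <= m)%N ->
  uop 1 0 0 (place (i, w) z f) = if nth 0%N w i.+1 == 0%N then place (i, w) z f else fun=> 0.
Proof.
move=> iw wz wm; rewrite {1}/place /=.
have := unit_op_read chiD chi_sq chi_neq1 (- i%:Z) (p := i.+1) (s := sym 0%N) (c := sym 0%N).
rewrite (_ : - i%:Z + i.+1%:Z = 1); last by lia.
move=> ->//; rewrite ?size_map ?nth_sym//; last by rewrite /same.
rewrite sym0 eq_sym sym_eq0//; case: eqP => // w0.
have e : nth 0 (map sym w) i.+1 = 0 by rewrite nth_sym// w0.
by rewrite /place /= -[X in set_nth _ _ _ X]e set_nth_nth// size_map.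
Qed.

Lemma place_right i w z f : lshift (mv 1) (place (i, w) z f) = place (i.+1, w) z f.
Proof.
rewrite /place /= tape_move lshiftE move_headD.
by congr (tape _ _ _ _ (lshift (mv _) _)); lia.
Qed.

Lemma place_left i w z f : (0 < i)%N ->
  lshift (mv (-1)) (place (i, w) z f) = place (i.-1, w) z f.
Proof.
move=> i0; rewrite /place /= tape_move lshiftE move_headD.
congr (tape _ _ _ _ (lshift (mv _) _)); lia.
Qed.

Lemma alike_set_nth w w' i s : alike w w' -> (i < size w)%N ->
  same (sym s) (sym (nth 0%N w i)) -> alike (set_nth 0%N w i s) w'.
Proof.
rewrite /alike; elim: w w' i => [|a w IH] [|b w'] [|i] //= /andP[ab ww'] iw.
  by rewrite /same => /eqP ->; rewrite ww' andbT.
by rewrite ab /=; exact: IH.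
Qed.

(** Write [s + 1] over [s], then move right unless the next cell carries an end
    mark: the projection onto the mark at the cell 1 separates the two cases. *)
Definition up_op s : op := fun f (x : W) =>
  lshift (mv 1) (fun y : W => uop 0 s.+1 s f y - uop 1 0 0 (uop 0 s.+1 s f) y) x
  + uop 1 0 0 (uop 0 s.+1 s f) x.

Definition machine : op := fun f (x : W) =>
  \sum_(1 <= s < m) up_op s f x + lshift (mv (-1)) (uop 0 1 m f) x.

(** At most one summand of the machine accepts the scanned letter. *)
Lemma machine_place d x z f : x \in configs m d -> z \in configs m d ->
  machine (place x z f) = if step m x is Some y then place y z f else fun=> 0.
Proof.
move=> xd zd; have xz := alike_configs xd zd; have wm0 := configs_le x.1 xd; have := configs_le _ xd.
move: xd xz; case: x wm0 => i w /= wm0 xd wz wm.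
have iw : (i.+1 < size w)%N.
  move/configsP : xd => [i0 [c [[-> ->] id sc _]]].
  by rewrite /= size_cat addn1 sc; lia.
have i0 : nth 0%N w i = m -> (0 < i)%N.
  case: (i) => // wm'; move/configsP : xd => [i' [c [[_ wE] _ _ _]]].
  by move: m_gt1; rewrite -wm' wE.
have upE s : (0 < s < m)%N -> up_op s (place (i, w) z f) =
    if s == nth 0%N w i then
      place (if nth 0%N w i.+1 == 0%N then i else i.+1, set_nth 0%N w i s.+1) z f
    else fun=> 0.
  move=> sm; apply/funext => t; rewrite /up_op place_read//; try lia.
  case: eqP => [sw|_]; last by rewrite !(unit_op0 chi) /lshift subr0 addr0.
  have wz' : alike (set_nth 0%N w i s.+1) z.2.
    apply: alike_set_nth => //; first exact: ltnW.
    by rewrite -sw /same !sym_eq0//; lia.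
  have i1 : (i.+1 == i) = false by lia.
  rewrite place_mark ?nth_set_nth ?size_set_nth ?(maxn_idPr (ltnW iw))/= ?i1//.
  case: eqP => _.
    by rewrite /lshift subrr add0r.
  rewrite addr0 -[RHS](congr1 (@^~ t) (place_right _ _ _ _)).
  by rewrite /lshift subr0.
apply/funext => t; rewrite /machine place_read ?(ltnW iw)//; try lia.
under eq_big_nat => s sm do rewrite upE//.
set s0 := nth 0%N w i in wm0 *.
case: (ltnP s0 m) => sm; last first.
  have sm0 : s0 = m by apply/eqP; rewrite eqn_leq wm0.
  rewrite sm0; have -> : (m == 0%N) = false by lia.
  rewrite eqxx big_nat_cond big1 ?add0r => [|s /andP[/andP[_ sm'] _]]; last first.
    by rewrite ltn_eqF.
  by rewrite ?ltnn; rewrite (place_left _ _ _ (i0 sm0)).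
have -> : (m == s0) = false by lia.
rewrite /lshift addr0; case: (eqVneq s0 0%N) => s00.
  rewrite big_nat_cond big1// => s /andP[/andP[s1 _] _].
  by rewrite s00 gtn_eqF.
rewrite (bigD1_seq s0) ?mem_index_iota ?iota_uniq//=; last by lia.
by rewrite eqxx big1 ?addr0// => s /negbTE ->.
Qed.

End CounterOperator.

(** * Integrality of the machine *)

Section IntegralityOfTheMachine.
Context {R : realType} {K : finFieldType}.
Local Notation C := R[i].
Local Notation W := (wreath {perm K}).
Local Notation mv n := (@move_head {perm K} n).
Local Notation op := ((W -> C) -> (W -> C)).
Implicit Types (f h : W -> C) (t : W) (j s : nat).

Variable chi : K -> int.
Hypothesis chiD : forall a b, chi (a + b) = chi a * chi b.
Hypothesis chi_sq : forall a, chi a * chi a = 1.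

Variables (m : nat) (sym : nat -> K).
Hypothesis m_gt1 : (1 < m)%N.
Hypothesis sym0 : sym 0%N = 0.
Hypothesis sym_inj : forall a b, (a <= m)%N -> (b <= m)%N -> sym a = sym b -> a = b.

Local Notation q := (#|K|%:R : C).
Local Notation uop j a b := (@unit_op R K chi j (sym a) (sym b)).

Definition integral_op (U : op) := exists V, gop intcoef U V.

Lemma eq_integral U U' : (forall f, U f =1 U' f) -> integral_op U -> integral_op U'.
Proof. by move=> UU' [V UV]; exists V; apply: eq_gop UV. Qed.

Lemma integral_shift g : integral_op (lshift g).
Proof. by exists (lshift g^-1); exact: gop_shift. Qed.

Lemma integral_scale (n : int) U : integral_op U -> integral_op (fun f t => n%:~R * U f t).
Proof. by move=> [V UV]; eexists; apply: gop_scale UV; exists n. Qed.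

Lemma integral_add U V : integral_op U -> integral_op V -> integral_op (fun f t => U f t + V f t).
Proof. by move=> [U' UU'] [V' VV']; eexists; exact: gop_add UU' VV'. Qed.

Lemma integral_comp U V : integral_op U -> integral_op V -> integral_op (fun f => U (V f)).
Proof. by move=> [U' UU'] [V' VV']; eexists; exact: gop_comp UU' VV'. Qed.

Lemma integral_sum n (U : nat -> op) : (forall j, (j < n)%N -> integral_op (U j)) ->
  integral_op (fun f t => \sum_(j < n) U j f t).
Proof.
elim: n => [|n IH] Uint.
  apply: eq_integral (integral_scale 0 (integral_shift 1%g)) => f t.
  by rewrite big_ord0 mul0r.
have Uint' j : (j < n)%N -> integral_op (U j) by move=> jn; apply: Uint; exact: ltnW.
apply: eq_integral (integral_add (IH Uint') (Uint n (ltnSn n))) => f t.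
by rewrite big_ord_recr.
Qed.

Lemma unit_opZ (j : int) a b e f t :
  @unit_op R K chi j a b (fun y => e * f y) t = e * @unit_op R K chi j a b f t.
Proof. by rewrite /unit_op qunitZ mulrCA. Qed.

Lemma integral_unit (j : int) a b : same a b ->
  integral_op (fun f t => q * @unit_op R K chi j a b f t).
Proof.
move=> ab; exists (qunit chi j b a); apply: eq_gop (qunit_gop chiD chi_sq j ab) => // f t.
by rewrite /unit_op mulrA mulfV ?q_neq0// mul1r.
Qed.

Lemma same_sym a b : (0 < a <= m)%N -> (0 < b <= m)%N -> same (sym a) (sym b).
Proof. by move=> am bm; rewrite /same !(sym_eq0 sym0 sym_inj); lia. Qed.

(** One factor [q] for each of the two matrix units. *)
Lemma integral_up s : (0 < s < m)%N ->
  integral_op (fun f t => q ^+ 2 * @up_op R K chi sym s f t).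
Proof.
move=> sm; have ss : same (sym s.+1) (sym s) by apply: same_sym; lia.
have U := integral_unit 0 ss.
have PU := integral_comp (integral_unit 1 (_ : same (sym 0%N) (sym 0%N))) U.
have {}PU := PU (eqxx _).
have qU := integral_scale #|K|%:Z U.
have := integral_add (integral_comp (integral_shift (mv 1))
  (integral_add qU (integral_scale (-1) PU))) PU.
apply: eq_integral => f t; rewrite /up_op /lshift !unit_opZ /= -[(_%:~R : C)]pmulrn.
by rewrite mulrN1z; ring.
Qed.

Lemma integral_machine :
  integral_op (fun f t => q ^+ 2 * @machine R K chi m sym f t).
Proof.
have ss : same (sym 1%N) (sym m) by apply: same_sym; lia.
have up : integral_op (fun f t => \sum_(j < m.-1) q ^+ 2 * @up_op R K chi sym j.+1 f t).
  apply: (integral_sum (U := fun j f t => q ^+ 2 * @up_op R K chi sym j.+1 f t)) => j jm.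
  by apply: integral_up; lia.
have down := integral_comp (integral_shift (mv (-1)))
  (integral_scale #|K|%:Z (integral_unit 0 ss)).
apply: eq_integral (integral_add up down) => f t; rewrite /machine mulrDr; congr (_ + _).
  by rewrite big_add1 big_mkord mulr_sumr.
by rewrite /lshift -[(_%:~R : C)]pmulrn; ring.
Qed.

End IntegralityOfTheMachine.

(** * The spectral measure of the counter *)

Section Weights.
Context {R : realType}.
Implicit Types (r x : R) (n d m : nat).

Lemma bernoulli x n : 0 <= x -> 1 + n%:R * x <= (1 + x) ^+ n.
Proof.
move=> x0; elim: n => [|n IH]; first by rewrite expr0 mul0r addr0.
have x1 : 0 <= 1 + x by rewrite addr_ge0.
rewrite exprS -natr1; apply: le_trans (ler_wpM2l x1 IH).
have n0 : 0 <= n%:R * x * x by rewrite !mulr_ge0.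
by rewrite -subr_ge0; apply: le_trans n0 _; rewrite le_eqVlt; apply/orP; left; apply/eqP; ring.
Qed.

(** Bernoulli's inequality bounds [n s ^ n] for the square root [s] of [r]. *)
Lemma cvg_mulrn_expr r : 0 < r < 1 -> (fun n => n%:R * r ^+ n) @ \oo --> (0 : R).
Proof.
move=> /andP[r0 r1]; pose s := Num.sqrt r.
have s0 : 0 < s by rewrite sqrtr_gt0.
have s1 : s < 1 by rewrite -[X in _ < X]sqrtr1 ltr_sqrt.
have x0 : 0 < s^-1 - 1 by rewrite subr_gt0 invf_gt1.
have sn : s ^+ n @[n --> \oo] --> (0 : R) by apply: cvg_expr; rewrite gtr0_norm.
have lim : (s^-1 - 1)^-1 * s ^+ n @[n --> \oo] --> (0 : R).
  by rewrite -[X in _ --> X](mulr0 (s^-1 - 1)^-1); exact: cvgMr.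
apply: (@squeeze_cvgr _ _ _ _ (fun=> 0) (fun n => (s^-1 - 1)^-1 * s ^+ n)) => //; last first.
  exact: cvg_cst.
near=> n; rewrite mulr_ge0 ?exprn_ge0 ?(ltW r0)//=.
have -> : r = s * s by rewrite -expr2 sqr_sqrtr// ltW.
rewrite exprMn mulrA ler_wpM2r ?exprn_ge0 ?(ltW s0)//.
rewrite -[leRHS]mulr1 ler_pdivlMl// mulrA -ler_pdivlMr ?exprn_gt0// mul1r -exprVn mulrC.
apply: le_trans (_ : 1 + n%:R * (s^-1 - 1) <= _); first by rewrite lerDr.
by apply: le_trans (bernoulli n (ltW x0)) _; rewrite addrCA subrr addr0.
Unshelve. all: by end_near.
Qed.

(** With [r = m / (m + 1)] this is the series of [(d + 1) r ^ d (1 - r) ^ 2],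
    the derivative of the geometric series. *)
Lemma weights_total m : (0 < m)%N ->
  (fun n => \sum_(0 <= d < n) (d.+1 * m ^ d)%:R * (m.+1%:R : R)^-1 ^+ d.+2) @ \oo --> (1 : R).
Proof.
move=> m0; pose r : R := m%:R / m.+1%:R.
have M0 : (0 : R) < m.+1%:R by rewrite ltr0n.
have r01 : 0 < r < 1 by rewrite divr_gt0 ?ltr0n//= ltr_pdivrMr// mul1r ltr_nat.
have rV : (m.+1%:R : R)^-1 = 1 - r by rewrite /r -natr1; field; rewrite natr1 gt_eqF.
have sumE n : \sum_(0 <= d < n) (d.+1 * m ^ d)%:R * (m.+1%:R : R)^-1 ^+ d.+2 =
    1 - (n%:R * r ^+ n * (1 - r) + r ^+ n).
  elim: n => [|n IH]; first by rewrite big_nil mul0r mul0r add0r subrr.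
  rewrite big_nat_recr//= IH natrM natrX.
  have -> : (n.+1%:R * m%:R ^+ n * m.+1%:R^-1 ^+ n.+2 : R) = n.+1%:R * r ^+ n * (1 - r) ^+ 2.
    have rE : r ^+ n = m%:R ^+ n * (1 - r) ^+ n by rewrite -exprMn -rV.
    rewrite rV -addn2 exprD rE; ring.
  rewrite -[n.+1%:R]natr1 [r ^+ n.+1]exprS; ring.
have n1 := cvg_mulrn_expr r01; have /andP[r0 r1] := r01.
have rn : r ^+ n @[n --> \oo] --> (0 : R) by apply: cvg_expr; rewrite gtr0_norm.
have lim : (fun n => 1 - (n%:R * r ^+ n * (1 - r) + r ^+ n)) @ \oo --> 1 - (0 * (1 - r) + 0).
  by apply: cvgB; [exact: cvg_cst|apply: cvgD rn; exact: cvgMl].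
rewrite mul0r addr0 subr0 in lim.
by rewrite (_ : (fun n => _) = (fun n => 1 - (n%:R * r ^+ n * (1 - r) + r ^+ n)))//; exact/funext.
Qed.

End Weights.

Section MachineSpectrum.
Local Open Scope sesquilinear_scope.
Context {R : realType} {K : finFieldType}.
Local Notation C := R[i].
Local Notation W := (wreath {perm K}).
Local Notation op := ((W -> C) -> (W -> C)).
Implicit Types (f h : W -> C) (t : W) (d n : nat).

Variable chi : K -> int.
Hypothesis chiD : forall a b, chi (a + b) = chi a * chi b.
Hypothesis chi_sq : forall a, chi a * chi a = 1.
Hypothesis chi_neq1 : exists a, chi a != 1.

Variables (m : nat) (sym : nat -> K).
Hypothesis m_gt1 : (1 < m)%N.
Hypothesis sym0 : sym 0%N = 0.
Hypothesis sym_inj : forall a b, (a <= m)%N -> (b <= m)%N -> sym a = sym b -> a = b.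

Local Notation q := (#|K|%:R : C).
Local Notation machine := (@machine R K chi m sym).
Local Notation place := (@place R K chi sym).

Variable B : nat.

Definition counter_op : op := fun f t => q ^+ 2 * (f t - B%:R * machine f t).

Lemma integral_counter : integral_op counter_op.
Proof.
have := integral_add (integral_scale (#|K| ^ 2)%:Z (integral_shift 1%g))
  (integral_scale (- B%:Z) (@integral_machine R K chi chiD chi_sq m sym m_gt1 sym0 sym_inj)).
apply: eq_integral => f t; rewrite /counter_op lshift1 mulrNz -!pmulrn natrX; ring.
Qed.

Lemma counter_selfadjoint : exists2 D, gop intcoef counter_op D & exists T : {malg int[W]},
  lact T = (fun f => D (counter_op f)) /\ self_adjoint T.
Proof.
have [D dD] := integral_counter; exists D => //; apply: gop_int_selfadj.
have intJ (c : C) : intcoef c -> intcoef (conjc c) by move=> [n ->]; exists n; exact: conjc_int.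
exact: gop_comp (gop_sym intJ dD) dD.
Qed.

Section Block.
Variable d : nat.
Local Notation N := (size (configs m d)).
Implicit Types (i k l : 'I_N).

Definition conf i := nth (0%N, [::]) (configs m d) i.

Lemma conf_in i : conf i \in configs m d. Proof. exact: mem_nth. Qed.

Lemma conf_eq i k : (conf i == conf k) = (i == k).
Proof. by rewrite nth_uniq// uniq_configs. Qed.

Lemma confP x : x \in configs m d -> exists i, x = conf i.
Proof.
by move=> xd; have xN := xd; rewrite -index_mem in xN; exists (Ordinal xN); rewrite /conf /= nth_index.
Qed.

(** The matrix of [1 - B sigma] on the configurations with [d] digits. *)
Definition block : 'M[int]_N :=
  \matrix_(k, i) ((k == i)%:R - B%:R * (step m (conf i) == Some (conf k))%:R).

Definition cblock : 'M[C]_N := q ^+ 2 *: map_mx intr block.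

Lemma cblockE k i :
  cblock k i = q ^+ 2 * ((k == i)%:R - B%:R * (step m (conf i) == Some (conf k))%:R).
Proof. by rewrite !mxE rmorphB rmorphM !rmorph_nat. Qed.

Lemma counter_place i l f :
  counter_op (place (conf i) (conf l) f) = fun t => \sum_k cblock k i * place (conf k) (conf l) f t.
Proof.
apply/funext => t; rewrite /counter_op.
rewrite (machine_place chiD chi_sq chi_neq1 m_gt1 sym0 sym_inj _ (conf_in i) (conf_in l)).
have sumE (e : 'I_N -> C) : \sum_k cblock k i * e k =
    q ^+ 2 * (e i - B%:R * \sum_k (step m (conf i) == Some (conf k))%:R * e k).
  under eq_bigr do rewrite cblockE -mulrA mulrBl -mulrA.
  rewrite -mulr_sumr sumrB -mulr_sumr (bigD1 i)//= eqxx mul1r big1 ?addr0// => k /negbTE ->.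
  by rewrite mul0r.
rewrite sumE; congr (_ * (_ - _ * _)).
case e : (step m (conf i)) => [y|]; last by rewrite big1// => k _; rewrite mul0r.
have [k yk] := confP (step_configs m_gt1 (conf_in i) e).
rewrite yk (bigD1 k)//= eqxx mul1r big1 ?addr0// => k' /negbTE kk'.
by rewrite (inj_eq Some_inj) conf_eq eq_sym kk' mul0r.
Qed.

(** Modulo 2 the block is the identity. *)
Lemma cblock_inj : ~~ odd B -> \det cblock != 0.
Proof.
move=> B2; rewrite detZ mulf_eq0 negb_or !expf_neq0 ?q_neq0//= det_map_mx intr_eq0.
have e : map_mx (intr : int -> 'F_2) block = 1%:M.
  apply/matrixP => k i; rewrite !mxE rmorphB rmorphM !rmorph_nat -[B]odd_double_half (negbTE B2).
  by rewrite add0n -muln2 natrM pchar_Zp// mulr0 mul0r subr0.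
have := congr1 determinant e; rewrite det1 det_map_mx.
by apply: contra_eq_neq => ->; rewrite eq_sym oner_eq0.
Qed.

Lemma run_conf n x y : x \in configs m d -> run m n x = Some y -> y \in configs m d.
Proof.
move=> xd; elim: n y => [|n IH] y; first by move=> [<-].
rewrite /run iterS -/(run m n x); case e : (run m n x) => [y'|]//= s.
exact: (step_configs m_gt1 (IH _ e) s).
Qed.

(** The vector has the coordinate [B ^ n] at the configuration reached after [n]
    steps, for [n <= L].  Its image telescopes: only the initial configuration
    survives, since no configuration follows the last one. *)
Lemma trace_col_nat (e : 'I_N -> nat) (u : 'cV[C]_N) : (forall k, u k 0 = (e k)%:R) ->
  \tr (u^t* *m u) = (\sum_k e k ^ 2)%:R.
Proof.
move=> ue; rewrite /mxtrace big_ord1 mxE natr_sum; apply: eq_bigr => k _.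
by rewrite !mxE !ue conjC_nat natrX expr2.
Qed.

Lemma cblock_short L x y : (0 < B)%N -> x \in configs m d ->
  run m L x = Some y -> step m y = None ->
  exists2 v : 'cV[C]_N, v != 0 & \tr ((cblock *m v)^t* *m (cblock *m v))
    * B%:R ^+ L ^+ 2 <= q ^+ 4 * \tr (v^t* *m v).
Proof.
move=> B0 xd rL sy; pose g k n : nat := (B ^ n * (run m n x == Some (conf k)))%N.
pose e k := (\sum_(n < L.+1) g k n)%N.
pose v : 'cV[C]_N := \col_k (e k)%:R.
have ve k : v k 0 = (e k)%:R by rewrite mxE.
have nextE n k : ((\sum_i (step m (conf i) == Some (conf k)) * g i n) * B = g k n.+1)%N.
  rewrite /g /run iterS -/(run m n x); case rn : (run m n x) => [z|] /=; last first.
    rewrite [RHS]muln0 big1; first by rewrite mul0n.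
    by move=> i _; rewrite !muln0.
  have [j zj] := confP (run_conf xd rn).
  rewrite zj (bigD1 j)//= eqxx muln1 big1 ?addn0 => [|i /negbTE ij].
    by rewrite -mulnA -expnSr mulnC.
  rewrite [X in (_ * (_ * nat_of_bool X))%N](_ : _ = false) ?muln0//.
  by rewrite (inj_eq Some_inj) conf_eq eq_sym ij.
have Av k : (cblock *m v) k 0 = (#|K| ^ 2 * (x == conf k))%:R.
  rewrite mxE; transitivity (q ^+ 2 * ((e k)%:R - (\sum_(n < L.+1) g k n.+1)%:R) : C).
    under eq_bigr do rewrite cblockE ve -mulrA mulrBl.
    rewrite -mulr_sumr sumrB (bigD1 k)//= eqxx mul1r big1 ?addr0 => [|i]; last first.
      by rewrite eq_sym => /negbTE ->; rewrite mul0r.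
    congr (_ * (_ - _)); under [in RHS]eq_bigr do rewrite -nextE.
    rewrite -big_distrl exchange_big /= natrM mulrC natr_sum mulr_sumr.
    apply: eq_bigr => i _; rewrite -mulrA; congr (_ * _).
    by rewrite -natrM /e big_distrr.
  rewrite big_ord_recr /= {2}/g /run iterS -/(run m L x) rL /= sy muln0 addn0.
  rewrite /e big_ord_recl natrD.
  under eq_bigr do rewrite /bump /=.
  by rewrite addrK /g expn0 mul1n natrM natrX.
have [j yj] := confP (run_conf xd rL).
have ej : (B ^ L <= e j)%N.
  by rewrite /e big_ord_recr /= {2}/g rL yj eqxx muln1 leq_addl.
exists v.
  apply: contraTneq ej => v0; have := ve j.
  by rewrite v0 mxE => /eqP; rewrite eq_sym pnatr_eq0 => /eqP ->; rewrite -ltnNge expn_gt0 B0.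
rewrite (trace_col_nat Av) (trace_col_nat ve) -!natrX -!natrM ler_nat.
have [l ->] := confP xd.
rewrite (bigD1 l)//= eqxx muln1 big1 ?addn0 => [|k]; last first.
  by rewrite eq_sym conf_eq => /negbTE ->; rewrite muln0.
rewrite -expnM leq_mul2l; apply/orP; right.
by rewrite (bigD1 j)//= (leq_trans _ (leq_addr _ _))// leq_exp2r.
Qed.

End Block.
Hypothesis card_sym : #|K| = m.+1.
Hypothesis B_even : ~~ odd B.
Hypothesis B_big : (#|K| ^ 4 < B)%N.

(** The condition [B_big] makes the bound [q ^ 4 B ^- (2 L)] on the eigenvalue
    smaller than [B ^- L]. *)
Lemma counter_spectrum : exists (T : {malg int[W]})
  (mu : {measure set (measurableTypeR R) -> \bar R}),
  [/\ self_adjoint T, is_spectral_measure T mu &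
   forall d, (0 < d)%N -> exists2 L, (m.-1 ^ d <= L)%N &
     (((#|K|%:R : R)^-1 ^+ d.+2)%:E <= mu `]0%R, (B%:R ^- L)[%classic)%E].
Proof.
have [D dD [T [TE Tself]]] := counter_selfadjoint.
pose u d (i j : 'I_(size (configs m d))) : op := place (conf i) (conf j).
pose w d : R := (#|K|%:R : R)^-1 ^+ d.+2.
have u_adj d i j : fop (u d i j) (u d j i).
  exact: (place_fop chiD chi_sq m_gt1 sym0 sym_inj (conf_in i) (conf_in j)).
have u_mul d i j k l f : u d i j (u d k l f) = if j == k then u d i l f else fun=> 0.
  rewrite /u (place_mul chiD chi_sq chi_neq1 m_gt1 sym0 sym_inj _
    (conf_in i) (conf_in j) (conf_in k) (conf_in l)).
  by rewrite conf_eq.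
have u_orth d d' i j k l f : d != d' -> u d i j (u d' k l f) = fun=> 0.
  move=> dd'.
  rewrite /u (place_mul chiD chi_sq chi_neq1 m_gt1 sym0 sym_inj _
    (conf_in i) (conf_in j) (conf_in k) (conf_in l)).
  case: eqP => // e; have /configsP[i1 [c1 [e1 _ s1 _]]] := conf_in j.
  have /configsP[i2 [c2 [e2 _ s2 _]]] := conf_in k.
  have := congr1 (fun x => size x.2) e; rewrite e1 e2 /= !size_cat s1 s2 => /eqP.
  by rewrite eqSS eqn_add2r (negbTE dd').
have u_tr d i : tr (u d i i) = (w d)%:C%C.
  rewrite /u (tr_place chiD chi_sq sym (conf_in i)) /w.
  by rewrite rmorphXn fmorphV rmorph_nat.
have u_total : (fun n => \sum_(0 <= d < n) (size (configs m d))%:R * w d) @ \oo --> (1 : R).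
  have := @weights_total R m (ltnW m_gt1); apply: cvg_trans; apply: near_eq_cvg; near=> n.
  by apply: eq_bigr => d _; rewrite size_configs /w card_sym.
have S_u d i j f : counter_op (u d i j f) = fun t => \sum_k cblock d k i * u d k j f t.
  exact: counter_place.
have w_gt0 d : 0 < w d by rewrite exprn_gt0// invr_gt0 ltr0n card_sym.
have [mu [Tmu muP]] := block_spectral_measure u_adj u_mul u_orth u_tr u_total (gopW dD)
  S_u w_gt0 (fun d => @cblock_inj d B_even) TE.
exists T, mu; split => // d d0.
have [L [y [Lm rL sy]]] := run_halts m_gt1 d0.
have [v v0 vP] := cblock_short (leq_ltn_trans (leq0n _) B_big) (start_configs m_gt1 d0) rL sy.
exists L => //.
have BL0 : (0 : R) < B%:R ^+ L by rewrite exprn_gt0// ltr0n (leq_ltn_trans _ B_big).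
have L0 : (0 < L)%N by apply: leq_trans Lm; rewrite expn_gt0; lia.
apply: (muP d v (#|K|%:R ^+ 4 / B%:R ^+ L ^+ 2)) => //.
  rewrite -[X in _ < X]mul1r expr2 invfM mulrA ltr_pM2r ?invr_gt0// ltr_pdivrMr// mul1r.
  by rewrite -!natrX ltr_nat (leq_trans B_big)// -[X in (X <= _)%N]expn1 leq_pexp2l//; lia.
rewrite rmorphM fmorphV !rmorphXn !rmorph_nat /= mulrAC ler_pdivlMr//.
by rewrite exprn_gt0// exprn_gt0// ltr0n (leq_ltn_trans _ B_big).
Unshelve. all: by end_near.
Qed.

End MachineSpectrum.

(** * The field and the final estimates *)

(** A coordinate of [K] as a vector space over the field with two elements, put
    in the exponent of -1. *)
Lemma sign_character (K : finFieldType) : 2 \in [pchar K] -> exists chi : K -> int,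
  [/\ forall a b, chi (a + b) = chi a * chi b, forall a, chi a * chi a = 1
    & exists a, chi a != 1].
Proof.
move=> K2; have [phi phi_lin phi_bij] := pprimeChar_vectAxiom K2.
have phiD (a b : K) : phi (a + b) = phi a + phi b.
  by rewrite -[a in LHS](scale1r (a : pPrimeCharType K2)) phi_lin scale1r.
have phi0 : phi 0 = 0 by apply: (addIr (phi 0)); rewrite -phiD !add0r.
have [i phi1] : exists i, phi 1 0 i != 0.
  apply/existsP; rewrite -negb_forall; apply/negP => /forallP h.
  have /(bij_inj phi_bij)/eqP : phi 1 = phi 0.
    by rewrite phi0; apply/rowP => i; rewrite mxE; apply/eqP.
  by rewrite oner_eq0.
have F2 (x y : 'F_2) : (x + y != 0) = (x != 0) (+) (y != 0).
  by case: x => [[|[|]]] // hx; case: y => [[|[|]]].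
exists (fun a => (-1) ^+ (phi a 0 i != 0)); split.
- by move=> a b; rewrite phiD mxE F2 signr_addb.
- by move=> a; rewrite -signr_addb addbb.
- by exists 1; rewrite phi1.
Qed.

Lemma letters (K : finFieldType) : exists sym : nat -> K, sym 0%N = 0 /\
  forall a b, (a <= #|K|.-1)%N -> (b <= #|K|.-1)%N -> sym a = sym b -> a = b.
Proof.
pose s := 0 :: rem (0 : K) (enum K).
have us : uniq s by rewrite /= mem_rem_uniq ?enum_uniq// !inE eqxx rem_uniq// enum_uniq.
have K0 : (0 < #|K|)%N by apply/card_gt0P; exists 0.
have ss : size s = #|K| by rewrite /= size_rem ?mem_enum// -cardE prednK.
exists (nth 0 s); split => // a b am bm /eqP.
rewrite -[(a <= _)%N]ltnS prednK// in am; rewrite -[(b <= _)%N]ltnS prednK// in bm.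
by rewrite nth_uniq ?ss// => /eqP.
Qed.

Section Estimates.
Context {R : realType}.
Implicit Types (delta eta C c x : R).

(** As [2 ^ k - 2 >= 2 ^ (k - 1)], it suffices that [(k - 1) (1 + delta) >= k]. *)
Lemma alphabet_size delta : 0 < delta -> exists2 k, (1 < k)%N &
  ((2 ^ k)%N%:R : R) <= ((2 ^ k - 2)%N%:R) `^ (1 + delta).
Proof.
move=> d0; pose k := (Num.truncn ((1 + delta) / delta)).+1.
have kd : 1 + delta <= k%:R * delta.
  by rewrite -ler_pdivrMr//; apply/ltW; exact: truncnS_gt.
have k1 : (1 < k)%N.
  rewrite -(ltr_nat R); apply: lt_le_trans (_ : (1 + delta) / delta <= _).
    by rewrite ltr_pdivlMr// mul1r ltrDr.
  by rewrite ler_pdivrMr.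
exists k => //; apply: le_trans (_ : ((2 ^ k.-1)%N%:R : R) `^ (1 + delta) <= _).
  rewrite !natrX -!powR_mulrn// -powRrM; apply: ler_powR; first by rewrite ler1n.
  rewrite -subn1 natrB//; lra.
apply: ge0_ler_powR; rewrite ?nnegrE ?ler0n//; first lra.
rewrite ler_nat; have -> : (2 ^ k = 2 * 2 ^ k.-1)%N by rewrite -expnS prednK.
have : (2 ^ 1 <= 2 ^ k.-1)%N by rewrite leq_exp2l//; lia.
lia.
Qed.

(** With [b = eta / (2 a)], the inequality [b y <= expR (b y)] at [y = - ln e]
    bounds [y `^ a] by a multiple of [e `^ (- (eta / 2))]. *)
Lemma powR_log_small a eta c : 0 < a -> 0 < eta -> 0 < c ->
  \forall e \near (0 : R)^'+, e `^ eta * `|ln e| `^ a < c.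
Proof.
move=> a0 eta0 c0; pose b := eta / (2 * a).
have b0 : 0 < b by rewrite divr_gt0// mulr_gt0.
have r0 : 0 < (c * b `^ a) `^ (2 / eta) by rewrite powR_gt0// mulr_gt0// powR_gt0.
near=> e.
have e0 : 0 < e by near: e; exact: nbhs_right_gt.
have e1 : e < 1 by near: e; exact: nbhs_right_lt.
have er : e < (c * b `^ a) `^ (2 / eta) by near: e; exact: nbhs_right_lt.
have ln0 : ln e < 0 by rewrite ln_lt0// e0.
rewrite ltr0_norm//; have y0 : 0 <= - ln e by rewrite oppr_ge0 ltW.
have step1 : (- ln e) `^ a <= e `^ (- (eta / 2)) / b `^ a.
  rewrite ler_pdivlMr ?powR_gt0// -powRM ?(ltW b0)//.
  have -> : e `^ (- (eta / 2)) = (e `^ (- b)) `^ a.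
    by rewrite -powRrM; congr (_ `^ _); rewrite /b; field; rewrite !gt_eqF.
  apply: ge0_ler_powR; rewrite ?nnegrE ?powR_ge0 ?(ltW a0) ?(mulr_ge0 y0 (ltW b0))//.
  rewrite /powR gt_eqF//; apply: le_trans (expR_ge1Dx _); lra.
have step2 : e `^ (eta / 2) < c * b `^ a.
  have -> : c * b `^ a = ((c * b `^ a) `^ (2 / eta)) `^ (eta / 2).
    rewrite -powRrM (_ : 2 / eta * (eta / 2) = 1); last by field; rewrite gt_eqF.
    by rewrite powRr1// mulr_ge0 ?powR_ge0 ?(ltW c0).
  by apply: gt0_ltr_powR; rewrite ?nnegrE ?powR_ge0 ?divr_gt0 ?(ltW e0).
apply: le_lt_trans (ler_wpM2l (powR_ge0 _ _) step1) _.
rewrite mulrA ltr_pdivrMr ?powR_gt0//; apply: le_lt_trans step2.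
rewrite -powRD; last by rewrite (gt_eqF e0) implybT.
by rewrite (_ : eta + _ = eta / 2)//; field.
Unshelve. all: by end_near.
Qed.

End Estimates.

Theorem theorem2 (R : realType) (delta : R) (delta_gt0 : 0 < delta) :
  exists (G : groupType) (S : {malg int[G]})
         (mu : {measure set (measurableTypeR R) -> \bar R}),
    [/\ self_adjoint S,
        is_spectral_measure S mu,
        (exists (C : R) (eps : nat -> R),
          [/\ 0 < C,
              (forall i, 0 < eps i),
              eps @ \oo --> (0 : R)
            & forall i, ((C / (`|ln (eps i)| `^ (1 + delta)))%:E
                           < mu `]0%R, eps i[%classic)%E])
      & ~ (exists (C' eta : R),
            [/\ 0 < C', 0 < eta
              & \forall e \near (0 : R)^'+,
                  (mu `]0%R, e[%classic < (C' * e `^ eta)%:E)%E])].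
Proof.
have [k k1 qk] := alphabet_size delta_gt0.
have [K K2 cK] := pPrimePowerField (isT : prime 2) (ltnW k1).
have [chi [chiD chi_sq chi_neq1]] := sign_character K2.
have [sym [sym0 sym_inj]] := letters K.
(* The digits are the [#|K| - 1] nonzero elements of [K]. *)
have K4 : (4 <= #|K|)%N by rewrite cK -[4%N]/(2 ^ 2)%N leq_exp2l.
have m_gt1 : (1 < #|K|.-1)%N by lia.
have K_gt3 : (1 < (#|K|.-1).-1)%N by lia.
have card_sym : #|K| = #|K|.-1.+1 by lia.
pose B := (2 * #|K| ^ 4)%N.
have B_even : ~~ odd B by rewrite oddM.
have K4_gt0 : (0 < #|K| ^ 4)%N by rewrite expn_gt0; lia.
have B_big : (#|K| ^ 4 < B)%N by rewrite /B; lia.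
have B2 : (2 <= B)%N by rewrite /B; lia.
have [S [mu [Sself Smu muP]]] := @counter_spectrum R K chi chiD chi_sq chi_neq1 _ sym m_gt1
  sym0 sym_inj B card_sym B_even B_big.
have runs i : exists l, ((#|K|.-1).-1 ^ i.+1 <= l)%N /\
    (((#|K|%:R : R)^-1 ^+ i.+3)%:E <= mu `]0%R, (B%:R ^- l)[%classic)%E.
  by have [l l1 l2] := muP i.+1 isT; exists l.
have [L LP] := boolp.choice runs.
pose q : R := #|K|%:R.
have q0 : 0 < q by rewrite ltr0n; lia.
have lnB : 0 < ln (B%:R : R) by rewrite ln_gt0// ltr1n.
pose b := ln (B%:R : R) `^ (1 + delta).
have b0 : 0 < b by rewrite powR_gt0.
(* [|ln (eps i)|] is [L i * ln B] and [L i `^ (1 + delta)] is at least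
   [q ^ (i + 1)], to be compared with the weight [q ^- (i + 3)]; halving gives the
   strict inequality. *)
pose C := b * q ^- 2 / 2.
have C0 : 0 < C by rewrite divr_gt0// mulr_gt0// invr_gt0 exprn_gt0.
pose eps i : R := B%:R ^- L i.
have eps0 i : 0 < eps i by rewrite invr_gt0 exprn_gt0// ltr0n; lia.
have d1 : 0 <= 1 + delta by rewrite addr_ge0// ltW.
have lnE i : `|ln (eps i)| = (L i)%:R * ln B%:R.
  rewrite lnV ?posrE ?exprn_gt0 ?ltr0n//; last exact: ltnW.
  rewrite lnXn ?ltr0n; last exact: ltnW.
  by rewrite normrN normrMn ger0_norm ?(ltW lnB)// mulr_natl.
have lowP i : ((C / (`|ln (eps i)| `^ (1 + delta)))%:E < mu `]0%R, eps i[%classic)%E.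
  have [Li muL] := LP i; apply: lt_le_trans muL; rewrite lte_fin.
  rewrite lnE powRM ?ler0n// ?(ltW lnB)// -/b -/q.
  have qL : q ^+ i.+1 <= (L i)%:R `^ (1 + delta).
    apply: le_trans (_ : (((#|K| - 2) ^ i.+1)%N%:R : R) `^ (1 + delta) <= _).
      rewrite natrX -[X in _ <= X `^ _]powR_mulrn ?ler0n// -powRrM mulrC powRrM powR_mulrn ?powR_ge0//.
      by rewrite lerXn2r ?nnegrE ?powR_ge0 ?(ltW q0)// /q cK.
    apply: ge0_ler_powR; rewrite ?nnegrE ?ler0n// ler_nat.
    by rewrite subn2.
  have qi0 : 0 < q ^+ i.+1 by rewrite exprn_gt0.
  rewrite ltr_pdivrMr; last by rewrite mulr_gt0//; exact: lt_le_trans qL.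
  apply: lt_le_trans (_ : q^-1 ^+ i.+3 * (q ^+ i.+1 * b) <= _); last first.
    by rewrite ler_pM2l ?exprn_gt0 ?invr_gt0// ler_pM2r.
  have -> : q^-1 ^+ i.+3 * (q ^+ i.+1 * b) = b * q ^- 2.
    have qV : q^-1 ^+ i.+1 * q ^+ i.+1 = 1 by rewrite -exprMn mulVf ?expr1n ?gt_eqF.
    by rewrite -[i.+3](addn2 i.+1) exprD mulrACA qV mul1r exprVn mulrC.
  by rewrite ltr_pdivrMr// ltr_pMr ?ltr1n// mulr_gt0// invr_gt0 exprn_gt0.
have eps_cvg : eps @ \oo --> (0 : R).
  have half : (2^-1 : R) ^+ n @[n --> \oo] --> (0 : R).
    by apply: cvg_expr; rewrite gtr0_norm// invf_lt1 ?ltr1n.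
  apply: (@squeeze_cvgr _ _ _ _ (fun=> 0) (fun n => 2^-1 ^+ n)) => //; last exact: cvg_cst.
  near=> n; rewrite ltW//= exprVn lef_pV2 ?posrE ?exprn_gt0 ?ltr0n//; last exact: ltnW.
  have [Ln _] := LP n; rewrite -!natrX ler_nat.
  have nL : (n <= L n)%N.
    apply: leq_trans Ln; apply: leq_trans (_ : 2 ^ n.+1 <= _)%N.
      by apply/ltnW/(ltn_trans (ltnSn n)); exact: ltn_expl.
    by rewrite leq_exp2r.
  apply: leq_trans (_ : B ^ n <= _)%N; last by rewrite leq_exp2l.
  by case: (n) => // n'; rewrite leq_exp2r.
exists (wreath {perm K} : groupType), S, mu; split => //; first by exists C, eps.
move=> [C' [eta [C'0 eta0 upP]]].
have a0 : 0 < 1 + delta by rewrite addr_gt0.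
have small := powR_log_small a0 eta0 (divr_gt0 C0 C'0).
have both : \forall e \near (0 : R)^'+, (mu `]0%R, e[%classic < (C' * e `^ eta)%:E)%E /\
  e `^ eta * `|ln e| `^ (1 + delta) < C / C'.
  by near=> e; split; near: e.
have [i _ /(_ i (leqnn i)) /(_ (eps0 i)) [up sm]] := eps_cvg _ both.
have := lt_trans (lowP i) up; rewrite lte_fin.
have ln0 : 0 < `|ln (eps i)| `^ (1 + delta).
  have [Li _] := LP i; rewrite lnE powR_gt0// mulr_gt0// ltr0n.
  by apply: leq_trans Li; rewrite expn_gt0 (ltnW K_gt3).
rewrite ltr_pdivrMr// -mulrA -ltr_pdivrMl// mulrC => lm.
by have := lt_trans lm sm; rewrite ltxx.
Unshelve. all: by end_near.
Qed.
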